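(* Let $\alpha,\beta\in(0,1)$, $a,b\in H_0^1(\Omega)$, and $f,g,\psi\in L^2(\Omega)$. Suppose that $\mu,\nu\in L^\infty(0,\infty)$ satisfy, for some $p_0>0$, $$e^{p_0t}\mu(t),\quad e^{p_0t}\nu(t)\quad\text{belong to }L^1(0,\infty),$$ and assume that $$(A^{-1}a,\psi)\neq0,\qquad (B^{-1}b,\psi)\neq0.$$ Let $u$ be the solution of $$\partial_t^\alpha(u-a)+Au=\mu(t)f(x)\ \text{ in }\Omega\times(0,\infty),\qquad u=0\ \text{ on }\partial\Omega\times(0,\infty),\qquad u-a\in H_\alpha(0,T;L^2(\Omega))\ \text{ for every }T>0,$$ and let $v$ be the solution of $$\partial_t^\beta(v-b)+Bv=\nu(t)g(x)\ \text{ in }\Omega\times(0,\infty),\qquad v=0\ \text{ on }\partial\Omega\times(0,\infty),\qquad v-b\in H_\beta(0,T;L^2(\Omega))\ \text{ for every }T>0.$$ If $$\int_\Omega u(x,t)\psi(x)\,dx=\int_\Omega v(x,t)\psi(x)\,dx\qquad\text{for all }t>0,$$ then $$\alpha=\beta,\qquad (A^{-1}a,\psi)=(B^{-1}b,\psi).$$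
   Context: $\Omega\subset\mathbb R^N$, $N\ge1$, is a bounded connected domain with smooth boundary $\partial\Omega$. All coefficients and data are real-valued; $(\cdot,\cdot)$ is the scalar product of $L^2(\Omega)$. Elliptic operators: $Aw=-\sum_{i,j=1}^N\partial_i(a_{ij}(x)\partial_jw)-c(x)w$ and $Bw=-\sum_{i,j=1}^N\partial_i(b_{ij}(x)\partial_jw)-d(x)w$, both with domain $H^2(\Omega)\cap H^1_0(\Omega)$, where $a_{ij}=a_{ji}$, $b_{ij}=b_{ji}$, $c$, $d$ are in $C^1(\overline\Omega)$, $c\le0$, $d\le0$, and for some $\kappa_A,\kappa_B>0$, $\sum_{i,j}a_{ij}(x)\zeta_i\zeta_j\ge\kappa_A|\zeta|^2$ and $\sum_{i,j}b_{ij}(x)\zeta_i\zeta_j\ge\kappa_B|\zeta|^2$ for all $x\in\overline\Omega$, $\zeta\in\mathbb R^N$. Then $A$ and $B$ are positive self-adjoint operators in $L^2(\Omega)$ with compact inverses. Fractional derivative: for $0<\gamma<1$ and $w\in L^2(0,T;L^2(\Omega))$ put $J^\gamma w(t)=\frac1{\Gamma(\gamma)}\int_0^t(t-s)^{\gamma-1}w(s)\,ds$ (Bochner integral). Set $H_\gamma(0,T;L^2(\Omega))=J^\gamma L^2(0,T;L^2(\Omega))$ and $\partial_t^\gamma=(J^\gamma)^{-1}$ with domain $H_\gamma(0,T;L^2(\Omega))$. Notion of solution: $u$ belongs to $L^2(0,T;H^2(\Omega)\cap H_0^1(\Omega))$ with $u-a\in H_\alpha(0,T;L^2(\Omega))$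 for every $T>0$, and the equation holds in $L^2(0,T;L^2(\Omega))$ for every $T>0$; similarly for $v$. It is known that, for initial values in $H_0^1(\Omega)$, spatial factors in $L^2(\Omega)$ and temporal factors in $L^\infty(0,\infty)$, there is exactly one such solution, and that it has a representative continuous from $[0,\infty)$ to $L^2(\Omega)$ taking the prescribed initial value at $t=0$; this representative is used in the pointwise-in-time observation. *)

(* Defs.v *)
From HB Require Import structures.
From mathcomp Require Import all_boot all_order all_algebra.
From mathcomp Require Import all_classical all_reals all_analysis.

Set Implicit Arguments.
Unset Strict Implicit.
Unset Printing Implicit Defensive.

Import Order.TTheory GRing.Theory Num.Theory.
Import numFieldNormedType.Exports.

Local Open Scope classical_set_scope.
Local Open Scope ring_scope.

(* ['rV[R]_n] carries the sigma-algebra generated by the coordinates, i.e. the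
   Borel sigma-algebra of R^n. *)
Section measurable_rV.
Context {R : realType} (n : nat).

Let coors : 'I_n -> 'rV[R]_n -> measurableTypeR R := fun i v => v ord0 i.

Let rV_set0 : g_sigma_preimage coors set0.
Proof. exact: sigma_algebra0. Qed.

Let rV_setC A : g_sigma_preimage coors A -> g_sigma_preimage coors (~` A).
Proof. exact: sigma_algebraC. Qed.

Let rV_bigcup (F : _^nat) : (forall i, g_sigma_preimage coors (F i)) ->
  g_sigma_preimage coors (\bigcup_i (F i)).
Proof. exact: sigma_algebra_bigcup. Qed.

HB.instance Definition _ := @isMeasurable.Build
  (measure_tuple_display default_measure_display)
  'rV[R]_n (g_sigma_preimage coors) rV_set0 rV_setC rV_bigcup.

Lemma measurable_coor (i : 'I_n) :
  measurable_fun [set: 'rV[R]_n] (fun v => v ord0 i : measurableTypeR R).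
Proof.
move=> _ Y mY; rewrite setTI; apply: sub_sigma_algebra => /=.
rewrite -bigcup_seq/=; exists i => /=; first by rewrite mem_index_enum.
by exists Y => //; rewrite setTI.
Qed.

Lemma measurable_fun_rV d (T : measurableType d) (f : T -> 'rV[R]_n) :
  (forall i, measurable_fun [set: T] (fun x => f x ord0 i : measurableTypeR R)) ->
  measurable_fun [set: T] f.
Proof.
move=> mf; suff : g_sigma_preimage (fun i => coors i \o f) `<=` measurable.
  by rewrite g_sigma_preimage_comp => sub _ A mA; apply: sub; exists A.
apply: smallest_sub; first exact: sigma_algebra_measurable.
rewrite -bigcup_seq => A [i _] [B mB <-].
exact: mf.
Qed.

End measurable_rV.

Section lebesgue_rV.
Context {R : realType}.

Section step.
Variable n : nat.

Definition consrV (x : measurableTypeR R * 'rV[R]_n) : 'rV[R]_n.+1 :=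
  row_mx (const_mx x.1 : 'rV_1) x.2.

Definition unconsrV (v : 'rV[R]_n.+1) : measurableTypeR R * 'rV[R]_n :=
  (v ord0 ord0, @rsubmx _ 1 1 n v).

Lemma consrVK : cancel consrV unconsrV.
Proof.
case=> x v; rewrite /unconsrV /consrV /=; congr pair; last exact: row_mxKr.
transitivity (row_mx (const_mx x : 'rV_1) v ord0 (lshift n ord0)).
  by congr (row_mx _ _ _ _); exact: val_inj.
by rewrite row_mxEl mxE.
Qed.

Lemma measurable_consrV : measurable_fun setT consrV.
Proof.
apply: measurable_fun_rV => i; rewrite /consrV.
rewrite -(@splitK 1 n i); case: (fintype.split _) => j /=.
- rewrite [X in measurable_fun _ X](_ : _ = fst); first exact: measurable_fst.
  by apply/funext => x; rewrite (@row_mxEl _ 1 1 n) mxE.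
- rewrite [X in measurable_fun _ X](_ : _ = (fun v : 'rV[R]_n => v ord0 j) \o snd).
    exact: (measurableT_comp (measurable_coor j) measurable_snd).
  by apply/funext => x; rewrite (@row_mxEr _ 1 1 n).
Qed.

Lemma measurable_unconsrV : measurable_fun setT unconsrV.
Proof.
apply: measurable_fun_pair; first exact: measurable_coor.
apply: measurable_fun_rV => i; under eq_fun do rewrite mxE.
exact: measurable_coor.
Qed.

Variable m : {sigma_finite_measure set 'rV[R]_n -> \bar R}.

Definition lebesgue_step : set 'rV[R]_n.+1 -> \bar R :=
  pushforward (@lebesgue_measure R \x m)%E consrV.

HB.instance Definition _ := Measure.copy lebesgue_step
  (@measure_function.measure_function_pushforward__canonical__measure_function_Measure
     _ _ _ _ _ (@lebesgue_measure R \x m)%E _ measurable_consrV).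

Lemma lebesgue_step_sigma_finite : sigma_finite setT lebesgue_step.
Proof.
have /sigma_finiteP[F [TF ndF mF]] := sigma_finiteT (@lebesgue_measure R).
have /sigma_finiteP[G [TG ndG mG]] := sigma_finiteT m.
exists (fun k => unconsrV @^-1` (F k `*` G k)).
  rewrite -preimage_bigcup -[LHS](preimage_setT unconsrV); congr (_ @^-1` _).
  rewrite -setXTT TF TG predeqE => -[x y]; split.
    move=> [/= [i _ Fix] [k _ Gky]]; exists (maxn i k) => //; split.
    - by move: x Fix; exact/subsetPset/ndF/leq_maxl.
    - by move: y Gky; exact/subsetPset/ndG/leq_maxr.
  by move=> [i _ []/= ? ?]; split; exists i.
move=> k; have [mFk Fkoo] := mF k; have [mGk Gkoo] := mG k.
have mFG : measurable (F k `*` G k) by exact: measurableX.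
split.
  by rewrite -[X in measurable X]setTI; exact: measurable_unconsrV.
rewrite /lebesgue_step /pushforward -comp_preimage.
rewrite (_ : unconsrV \o consrV = id); last by apply/funext => x; exact: consrVK.
by rewrite preimage_id product_measure1E// lte_mul_pinfty// ge0_fin_numE.
Qed.

HB.instance Definition _ := Measure_isSigmaFinite.Build _ _ _
  lebesgue_step lebesgue_step_sigma_finite.

End step.

Fixpoint lebesgue_rV (n : nat) : {sigma_finite_measure set 'rV[R]_n -> \bar R} :=
  match n with
  | 0 => dirac (0 : 'rV[R]_0)
  | k.+1 => lebesgue_step (lebesgue_rV k)
  end.

End lebesgue_rV.

Section smooth.
Context {R : realType} {N : nat}.
Implicit Types (V Omega : set 'rV[R]_N) (f : 'rV[R]_N -> R).

Definition partial (i : 'I_N) f : 'rV[R]_N -> R :=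
  fun x => 'D_(delta_mx ord0 i) f x.

(* C^k on V, for V open *)
Fixpoint Ck (k : nat) V f : Prop :=
  (forall x, V x -> {for x, continuous f}) /\
  match k with
  | 0 => True
  | j.+1 => forall i : 'I_N,
      (forall x, V x -> derivable f x (delta_mx ord0 i)) /\ Ck j V (partial i f)
  end.

Definition smooth V f := forall k, Ck k V f.

(* C^1 up to the boundary: f and its partial derivatives extend continuously
   from Omega to its closure. *)
Definition C1_closure Omega f :=
  [/\ {within closure Omega, continuous f}, Ck 1 Omega f &
      forall i : 'I_N, exists g : 'rV[R]_N -> R,
        {within closure Omega, continuous g} /\
        (forall x, Omega x -> g x = partial i f x)].

(* Near each boundary point, Omega is a strict sublevel set of a smooth function
   with nonvanishing gradient. *)
Definition smooth_boundary Omega :=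
  forall x0, closure Omega x0 -> ~ Omega x0 ->
    exists (V : set 'rV[R]_N) (rho : 'rV[R]_N -> R),
      [/\ open V, V x0, smooth V rho, exists i, partial i rho x0 != 0 &
          forall x, V x -> (Omega x <-> rho x < 0)].

Definition smooth_bounded_domain Omega :=
  [/\ Omega !=set0, open Omega, connected Omega, bounded_set Omega &
      smooth_boundary Omega].

Definition test_function Omega (phi : 'rV[R]_N -> R) :=
  let supp := closure [set x | phi x != 0] in
  [/\ smooth setT phi, compact supp & supp `<=` Omega].

End smooth.

(* Elements of L^p(D, mu) are represented by functions on the whole space, of
   which only the values a.e. in D matter; f \_ D is the extension by 0. *)
Definition memL d (T : measurableType d) (R : realType)
    (mu : {measure set T -> \bar R}) (p : \bar R) (D : set T) (f : T -> R) :=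
  f \_ D \in Lfun mu p.

Section sobolev.
Context {R : realType} {N : nat}.
Variable Omega : set 'rV[R]_N.
Local Notation fct := ('rV[R]_N -> R).
Local Notation mu := (@lebesgue_rV R N).
Implicit Types f g w : fct.

Definition L2 f := memL mu 2%:E Omega f.

Definition inner f g : R := (\int[mu]_(x in Omega) (f x * g x))%R.

Definition norm2 f : R := fine ('N[mu]_2%:E [EFin \o (f \_ Omega)]).

Definition weak_partial (i : 'I_N) f g :=
  L2 g /\ forall phi, test_function Omega phi ->
    inner f (partial i phi) = - inner g phi.

(* Unique up to equality a.e. in Omega; 0 if there is no weak derivative in
   L^2(Omega). *)
Definition wpartial (i : 'I_N) f : fct := xget (cst 0) (weak_partial i f).

Definition H1 f := L2 f /\ forall i, exists g, weak_partial i f g.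

Definition H1norm f : R :=
  Num.sqrt (norm2 f ^+ 2 + \sum_i norm2 (wpartial i f) ^+ 2).

Definition H10 f := H1 f /\
  forall e : R, 0 < e -> exists2 phi, test_function Omega phi & H1norm (f \- phi) < e.

Definition H2 f := H1 f /\ forall i, H1 (wpartial i f).

Definition H2norm f : R :=
  Num.sqrt (norm2 f ^+ 2 + \sum_i norm2 (wpartial i f) ^+ 2
            + \sum_i \sum_j norm2 (wpartial j (wpartial i f)) ^+ 2).

Definition H2H10 w := H2 w /\ H10 w.

Definition elliptic_coefficients (a : 'I_N -> 'I_N -> fct) (c : fct) :=
  [/\ forall i j, C1_closure Omega (a i j) /\
                  (forall x, closure Omega x -> a i j x = a j i x),
      C1_closure Omega c,
      forall x, closure Omega x -> c x <= 0 &
      exists2 kappa : R, 0 < kappa &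
        forall x, closure Omega x -> forall zeta : 'rV[R]_N,
          kappa * (\sum_i zeta ord0 i ^+ 2) <=
          \sum_i \sum_j a i j x * zeta ord0 i * zeta ord0 j].

(* The graph of w |-> - sum_ij d_i (a_ij d_j w) - c w with domain H^2 \cap H^1_0;
   G i is the weak derivative d_i (sum_j a_ij d_j w). *)
Definition elliptic (a : 'I_N -> 'I_N -> fct) (c : fct) w h :=
  H2H10 w /\ exists G : 'I_N -> fct,
    (forall i, weak_partial i (fun x => \sum_j a i j x * wpartial j w x) (G i)) /\
    h = (fun x => - (\sum_i G i x) - c x * w x) %[ae mu in Omega].

(* The preimage is unique up to equality a.e. in Omega. *)
Definition elliptic_inv a c h : fct := xget (cst 0) [set w | elliptic a c w h].

End sobolev.

(* Bochner spaces and integrals for functions of time valued in a subspace E of V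
   with seminorm nrm. The quotient of E by the kernel of nrm is the Banach space
   of the text-book definitions; nrm need not be meaningful outside E. *)
Section bochner.
Context {R : realType} {V : lmodType R}.
Variables (E : set V) (nrm : V -> R).
Local Notation mu := (@lebesgue_measure R).

(* t |-> sum_k 1_(A_k)(t) v_k *)
Record step_map := StepMap {
  step_size : nat;
  step_set : 'I_step_size -> set (measurableTypeR R);
  step_val : 'I_step_size -> V }.

Definition step_wf (s : step_map) := forall k : 'I_(step_size s),
  [/\ measurable (step_set k), (mu (step_set k) < +oo)%E & E (step_val k)].

Definition step_eval (s : step_map) (t : R) : V :=
  \sum_(k < step_size s) (\1_(step_set k) t : R) *: step_val k.

Definition step_integral (D : set R) (s : step_map) : V :=
  \sum_(k < step_size s) fine (mu (step_set k `&` D)) *: step_val k.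

Definition step_approx (D : set R) (w : R -> V) (s : nat -> step_map) :=
  (forall n, step_wf (s n)) /\
  {ae mu, forall t, D t ->
     E (w t) /\ (nrm (w t - step_eval (s n) t) @[n --> \oo] --> (0 : R))}.

Definition bochner_L2 (D : set R) (w : R -> V) :=
  (exists s, step_approx D w s) /\
  ('N[mu]_2%:E [EFin \o ((nrm \o w) \_ D)] < +oo)%E.

(* I is the Bochner integral of w on D. *)
Definition bochner_integral (D : set R) (w : R -> V) (I : V) :=
  E I /\ exists s, [/\ step_approx D w s,
    (\int[mu]_(t in D) (nrm (w t - step_eval (s n) t))%:E @[n --> \oo] --> 0)%E &
    nrm (I - step_integral D (s n)) @[n --> \oo] --> (0 : R)].

End bochner.

Definition Gamma {R : realType} (x : R) : R :=
  (\int[@lebesgue_measure R]_(t in `]0, +oo[) (t `^ (x - 1) * expR (- t)))%R.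

Section fractional.
Context {R : realType} {N : nat}.
Variable Omega : set 'rV[R]_N.
Local Notation fct := ('rV[R]_N -> R).
Local Notation mu := (@lebesgue_measure R).

(* z = J^gamma w in L^2(Omega) at time t *)
Definition frac_integral (gamma : R) (w : R -> fct) (t : R) (z : fct) :=
  bochner_integral (L2 Omega) (norm2 Omega) `]0, t[
    (fun s => ((Gamma gamma)^-1 * (t - s) `^ (gamma - 1)) *: w s) z.

(* z is in H_gamma(0,T; L^2(Omega)), the range of J^gamma on L^2(0,T; L^2(Omega)),
   and w = d_t^gamma z. *)
Definition frac_derivative (gamma T : R) (z w : R -> fct) :=
  bochner_L2 (L2 Omega) (norm2 Omega) `]0, T[ w /\
  {ae mu, forall t, `]0, T[%classic t -> frac_integral gamma w t (z t)}.

(* u is the solution of d_t^alpha (u - u0) + A u = m(t) f(x), A being the elliptic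
   operator with coefficients a and c; u itself is the representative continuous
   from [0, +oo[ to L^2(Omega) with value u0 at 0. *)
Definition is_solution (a : 'I_N -> 'I_N -> fct) (c : fct)
    (alpha : R) (u0 : fct) (m : R -> R) (f : fct) (u : R -> fct) :=
  [/\ forall T : R, 0 < T ->
        bochner_L2 (H2H10 Omega) (H2norm Omega) `]0, T[ u /\
        exists w Au : R -> fct,
          [/\ frac_derivative alpha T (fun t => u t - u0) w,
              {ae mu, forall t, `]0, T[%classic t -> elliptic Omega a c (u t) (Au t)} &
              {ae mu, forall t, `]0, T[%classic t ->
                 w t + Au t = m t *: f %[ae @lebesgue_rV R N in Omega]}],
      forall t : R, 0 <= t -> L2 Omega (u t) /\
        (norm2 Omega (u s - u t) @[s --> within `[0, +oo[ (nbhs t)] --> (0 : R)) &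
      u 0 = u0 %[ae @lebesgue_rV R N in Omega]].

End fractional.

(* Main.v *)
(** Let L denote the Laplace transform at real p. As p tends to 0+,
      L[(u, psi)](p) = p^(alpha - 1) (A^-1 a, psi) + O(p^(2 alpha - 1) + 1),
    and similarly for v; comparing the two expansions gives both equalities.

    The expansion is obtained without spectral theory. A test function phi that
    almost minimises the energy of p^alpha + A solves (p^alpha + A) phi = psi in
    the weak sense up to a small error, with a bound on its L^2 norm independent
    of p. Pairing the equation for u with phi, and the equation A w0 = a with phi,
    turns L[(u, psi)] into the leading term, up to L[mu] (f, phi), the term in
    p^(2 alpha - 1), and an error controlled by L[B(u, u)], B being the bilinear
    form of A. This last transform is finite: the kernel |t - s|^(alpha - 1) is
    positive definite, so the fractional derivative contributes a nonnegative term
    to the energy balance, whence the integral of B(u, u) over ]0, T[ is at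
    most K T. *)

Require Import Defs.
From mathcomp Require Import all_boot all_order all_algebra.
From mathcomp Require Import all_classical all_reals all_analysis.
From mathcomp Require Import measurable_realfun.
From mathcomp Require Import ring lra.
Set Implicit Arguments.
Unset Strict Implicit.
Unset Printing Implicit Defensive.
Import Order.TTheory GRing.Theory Num.Theory.
Import numFieldNormedType.Exports.
Local Open Scope classical_set_scope.
Local Open Scope ring_scope.

(** Write [m] for the source factor, [lam = p^alpha], [A w0 = a]. For a test function [phi] the
    transformed equation reads [lam L[(u, phi)] + L[B(u, phi)] = p^(alpha-1) (a, phi) + L[m] (f,
    phi)]. If [phi] solves [(lam + A) phi = psi] weakly, the left side is [L[(u, psi)]], and [(a,
    phi) = B(w0, phi) = (w0, psi) - lam (w0, phi)]: the product [p^(alpha-1) lam] is the origin of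
    the exponent [2 alpha - 1]. The error of an approximate [phi] is made small after [p] has been
    fixed, so its bound may depend on [p] in any way; this is why mere finiteness of [L[B(u, u)]] at
    each [p] suffices. In the comparison, [alpha - 1] lies below both [2 alpha - 1] and 0, so that
    multiplying by [p^(1-alpha)] isolates the coefficient. The recurring obstacle is that [u], its
    fractional derivative and the equation are known only at almost every time, and that [inner] is
    linear only on square integrable functions. Hence the passage to representatives that are
    measurable on the whole line before Fubini's theorem is applied. *)

Import HBNNSimple.

(* The integral of a nonnegative function is a supremum over the simple functions
   below it, so measurability plays no role here nor in [ae_eq_integralW]; both
   are applied to representatives that are only a.e. equal to measurable ones. *)
Lemma ge0_ae_le_integralW d (T : measurableType d) (R : realType)
    (mu : {measure set T -> \bar R}) (D : set T) (f g : T -> \bar R) :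
  (forall x, D x -> (0 <= f x)%E) -> (forall x, D x -> (0 <= g x)%E) ->
  {ae mu, forall x, D x -> (f x <= g x)%E} ->
  (\int[mu]_(x in D) f x <= \int[mu]_(x in D) g x)%E.
Proof.
move=> f0 g0 [N [mN N0 sN]].
rewrite ge0_integralE// ge0_integralE//.
apply: ge_ereal_sup => _ [h hf <-].
have mNC : measurable (~` N) by exact: measurableC.
(* Cutting [h] down to 0 on the exceptional null set keeps its integral and puts it below [g]
   everywhere. *)
rewrite (_ : sintegral mu h = sintegral mu (proj_nnsfun h mNC)).
  apply: ereal_sup_ubound => /=; exists (proj_nnsfun h mNC) => // x.
  have -> : proj_nnsfun h mNC x = h x * \1_(~` N) x by [].
  rewrite indicE; case: (pselect (N x)) => Nx.
    rewrite memNset ?mulr0; last by move=> /(_ Nx).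
    by rewrite /patch; case: ifPn => // /set_mem; exact: g0.
  rewrite mem_set// mulr1 (le_trans (hf x))// /patch; case: ifPn => // /set_mem Dx.
  by apply: contrapT => H; apply: Nx; apply: sN => /= /(_ Dx).
rewrite -!integralT_nnsfun.
rewrite (@ae_eq_integral _ _ _ mu setT (EFin \o proj_nnsfun h mNC) (EFin \o h))//.
- exact/measurable_EFinP.
- exact/measurable_EFinP.
- exists N; split => // x /= H; apply: contrapT => Nx; apply: H => _.
  by congr EFin; rewrite -[RHS]/(h x * \1_(~` N) x) indicE mem_set// mulr1.
Qed.

Lemma ae_eq_integralW d (T : measurableType d) (R : realType)
    (mu : {measure set T -> \bar R}) (D : set T) (f g : T -> \bar R) :
  f = g %[ae mu in D] -> (\int[mu]_(x in D) f x = \int[mu]_(x in D) g x)%E.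
Proof.
move=> [N [mN N0 sN]]; rewrite integralE [RHS]integralE.
have ae h1 h2 : (forall x, 0 <= h1 x)%E -> (forall x, 0 <= h2 x)%E ->
    (forall x, f x = g x -> h1 x = h2 x) ->
    (\int[mu]_(x in D) h1 x = \int[mu]_(x in D) h2 x)%E.
  move=> h10 h20 h12; apply/eqP; rewrite eq_le; apply/andP; split;
    apply: ge0_ae_le_integralW => //; exists N; split => // x /= H; apply: sN => /=;
    by apply: contra_not H => H Dx; rewrite h12 ?H.
by congr (_ - _)%E; apply: ae => // x fg; rewrite ?funeposE ?funenegE fg.
Qed.

(** The discriminant criterion is kept abstract because it serves several quadratic forms: [inner],
    [bform], [energy], and the perturbed functional of [approximate_solution], where [a] is the
    defect of minimality. *)
Lemma quadratic_ge0_CauchySchwarz (R : realFieldType) (a b c : R) :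
  0 <= a -> 0 <= c -> (forall t, 0 <= a + (b *+ 2) * t + c * t ^+ 2) -> b ^+ 2 <= a * c.
Proof.
move=> a0 c0 H; have [c0'|c_gt0] := eqVneq c 0.
  have [->|b0] := eqVneq b 0; first by rewrite expr0n/= mulr_ge0.
  (* For [c = 0] the polynomial is affine and takes the value -1 at this point. *)
  have := H (- (a + 1) / (b *+ 2)); rewrite c0' mul0r addr0.
  by rewrite mulrCA divff ?mulrn_eq0// mulr1 opprD addrA subrr add0r oppr_ge0 ler10.
(* The point [- b / c] is the minimum of the parabola. *)
have := H (- b / c); have c1 : 0 < c by rewrite lt_def c_gt0.
rewrite (_ : _ + _ = a - b ^+ 2 / c); first by rewrite subr_ge0 ler_pdivrMr.
by field.
Qed.

(** * Inner product and norm of L^2(Omega) *)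

Section L2_theory.
Context {R : realType} {N : nat} (Omega : set 'rV[R]_N).
Hypothesis mO : measurable Omega.
Local Notation mu := (@lebesgue_rV R N).
Local Notation L2 := (L2 Omega).
Local Notation inner := (inner Omega).
Local Notation norm2 := (norm2 Omega).
Implicit Types f g h : 'rV[R]_N -> R.

Lemma L2_measurable f : L2 f -> measurable_fun Omega f.
Proof.
move=> /sub_Lfun_mfun; rewrite inE => mf; apply/measurable_restrictT => //.
Qed.

Lemma L2_integrable f g : L2 f -> L2 g ->
  mu.-integrable Omega (EFin \o (fun x => f x * g x)).
Proof.
move=> Lf Lg; have /Lfun1_integrable := Lfun2_mul_Lfun1 Lf Lg.
move=> I; apply/integrable_mkcond => //; move: I.
congr (_.-integrable _ _); apply/funext => x /=; rewrite /patch.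
by case: ifPn; rewrite ?mul0r.
Qed.

Lemma L2_intro f : measurable_fun Omega f ->
  mu.-integrable Omega (EFin \o (fun x => f x ^+ 2)) -> L2 f.
Proof.
move=> mf /(integrable_mkcond _ mO) If.
rewrite /Defs.L2 /memL inE/=; apply/andP; split; rewrite inE/=.
  by apply/(measurable_restrictT f mO).
rewrite /finite_norm unlock /= poweR_lty//.
move/integrableP: If => [_]; apply: le_lt_trans.
rewrite le_eqVlt; apply/orP; left; apply/eqP; apply: eq_integral => x _ /=.
rewrite !patchE /=; case: ifPn => _; rewrite /= ?normr0 ?powR0// powR_mulrn//.
by rewrite normrX.
Qed.

Lemma L2D f g : L2 f -> L2 g -> L2 (fun x => f x + g x).
Proof.
move=> Lf Lg; have := Lfun_submod_closed mu (_ : (1 <= 2%:E)%E).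
move=> /(_ _)[|_ /(_ 1 _ _ Lf Lg)]; first by rewrite lee_fin ler1n.
rewrite scale1r /Defs.L2 /memL => H.
rewrite (_ : _ \_ _ = f \_ Omega + g \_ Omega)//; apply/funext => x.
by rewrite fctE !patchE; case: ifPn; rewrite ?addr0.
Qed.

Lemma L2Z (c : R) f : L2 f -> L2 (fun x => c * f x).
Proof.
move=> Lf; have := Lfun_submod_closed mu (_ : (1 <= 2%:E)%E).
move=> /(_ _)[|L0 /(_ c _ _ Lf L0)]; first by rewrite lee_fin ler1n.
rewrite addr0 /Defs.L2 /memL => H.
rewrite (_ : _ \_ _ = c *: f \_ Omega)//; apply/funext => x.
by rewrite scalrfctE !patchE; case: ifPn; rewrite ?scaler0.
Qed.

Lemma L20 : L2 (cst 0).
Proof.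
have := Lfun_submod_closed mu (_ : (1 <= 2%:E)%E).
move=> /(_ _)[|+ _]; first by rewrite lee_fin ler1n.
rewrite /Defs.L2 /memL => H; rewrite (_ : _ \_ _ = 0)//; apply/funext => x.
by rewrite patchE; case: ifPn.
Qed.

Lemma innerC f g : inner f g = inner g f.
Proof. by apply: eq_Rintegral => x _; rewrite mulrC. Qed.

Lemma innerDl f g h : L2 f -> L2 g -> L2 h ->
  inner (fun x => f x + g x) h = inner f h + inner g h.
Proof.
move=> Lf Lg Lh; rewrite /Defs.inner -RintegralD//; [|exact: L2_integrable..].
by apply: eq_Rintegral => x _; rewrite mulrDl.
Qed.

Lemma innerZl (c : R) f h : L2 f -> L2 h ->
  inner (fun x => c * f x) h = c * inner f h.
Proof.
move=> Lf Lh; rewrite /Defs.inner -RintegralZl//; last exact: L2_integrable.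
by apply: eq_Rintegral => x _; rewrite mulrA.
Qed.

Lemma inner_ge0 f : 0 <= inner f f.
Proof. by apply: Rintegral_ge0 => x _; rewrite -expr2 sqr_ge0. Qed.

Lemma inner_ae f f' g g' :
  f = f' %[ae mu in Omega] -> g = g' %[ae mu in Omega] -> inner f g = inner f' g'.
Proof.
move=> ff gg; rewrite /Defs.inner /Rintegral; congr fine; apply: ae_eq_integralW.
by apply: filterS2 ff gg => x fx gx Ox; rewrite fx ?gx.
Qed.

Lemma norm2_ge0 f : 0 <= norm2 f.
Proof. by rewrite /Defs.norm2 fine_ge0// Lnorm_ge0. Qed.

Lemma norm2_inner f : L2 f -> norm2 f = Num.sqrt (inner f f).
Proof.
move=> Lf; rewrite /Defs.norm2 unlock /=.
rewrite (_ : integral _ _ _ = (inner f f)%:E); last first.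
  rewrite /Defs.inner /Rintegral fineK; last exact/integrable_fin_num/L2_integrable.
  rewrite integral_mkcond; apply: eq_integral => x _; rewrite /= !patchE.
  by case: ifPn => _; rewrite ?normr0 ?powR0// powR_mulrn// -normrX ger0_norm ?sqr_ge0.
by rewrite poweR_EFin /= powR12_sqrt ?inner_ge0.
Qed.

Lemma norm2_sqr f : L2 f -> norm2 f ^+ 2 = inner f f.
Proof. by move=> Lf; rewrite norm2_inner// sqr_sqrtr// inner_ge0. Qed.

Lemma inner_CauchySchwarz f g : L2 f -> L2 g -> `|inner f g| <= norm2 f * norm2 g.
Proof.
move=> Lf Lg; rewrite -ler_sqr ?nnegrE ?mulr_ge0 ?norm2_ge0// real_normK ?num_real//.
rewrite exprMn !norm2_sqr//; apply: quadratic_ge0_CauchySchwarz;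
  rewrite ?inner_ge0// => t.
have := inner_ge0 (fun x => f x + t * g x).
have Ltg := L2Z t Lg.
rewrite innerDl// ?L2D// ![inner _ (fun _ => _ + _)]innerC !innerDl// ?L2D//.
rewrite ![inner (fun _ => t * _) _]innerZl// ![inner _ (fun _ => t * _)]innerC.
rewrite ![inner (fun _ => t * _) _]innerZl// (innerC g f) => H.
by apply: le_trans H _; lra.
Qed.

End L2_theory.

(** * Borel measurability and the divergence theorem on R^N *)

Section rV_topology.
Context {R : realType}.

Lemma rV_norm_coord n (v : 'rV[R]_n) i : `|v ord0 i| <= `|v|.
Proof.
have /mapP[j Hj ->] : `|v ord0 i| \in [seq `|v x.1 x.2| | x : 'I_1 * 'I_n].
  by apply/mapP; exists (ord0, i) => //=; rewrite mem_enum.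
by rewrite [leRHS]/Num.Def.normr /= mx_normrE; apply/bigmax_geP; right => /=; exists j.
Qed.

Lemma rV_norm_lt n (v : 'rV[R]_n) (M : R) : 0 < M ->
  (forall i, `|v ord0 i| < M) -> `|v| < M.
Proof.
move=> M0 H; rewrite [ltLHS]/Num.Def.normr /= mx_normrE; apply/bigmax_ltP; split => // -[i j] _.
by rewrite ord1; exact: H.
Qed.

Definition ocube n (q : 'rV[R]_n) (r : R) : set 'rV[R]_n :=
  [set v | forall i, `|v ord0 i - q ord0 i| < r].

Definition ccube n (q : 'rV[R]_n) (r : R) : set 'rV[R]_n :=
  [set v | forall i, `|v ord0 i - q ord0 i| <= r].

Lemma measurable_ocube n (q : 'rV[R]_n) r : measurable (ocube q r).
Proof.
rewrite (_ : ocube q r = \bigcap_(i in [set: 'I_n])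
   ((fun v : 'rV[R]_n => v ord0 i) @^-1`
      [set x : R | `|x - q ord0 i| < r])); last first.
  by apply/seteqP; split => v /=; [move=> H i _; exact: H|move=> H i; exact: H].
apply: fin_bigcap_measurable => // i _; rewrite -[X in measurable X]setTI.
apply: measurable_coor => //; apply: open_measurable.
rewrite (_ : mkset _ = ball (q ord0 i : R) r); first exact: ball_open.
by apply/seteqP; split => x /=; rewrite /ball/= distrC.
Qed.

(** Rational centres and radii [1/(k+1)], coded by [pickle], give countably many cubes. Keeping the
    closed cubes inside [U] is what later makes bumps on these cubes test functions. *)
Lemma open_bigcup_ocube n (U : set 'rV[R]_n) : open U ->
  exists (P : set nat) (q : nat -> 'rV[R]_n) (r : nat -> R),
    U = \bigcup_(k in P) ocube (q k) (r k) /\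
    forall k, P k -> 0 < r k /\ ccube (q k) (r k) `<=` U.
Proof.
move=> oU; pose I := ('rV[rat]_n * nat)%type.
pose q (z : I) : 'rV[R]_n := \row_i ratr (z.1 ord0 i).
pose r (z : I) : R := z.2.+1%:R^-1.
pose un k : I := odflt (0, 0%N) (@unpickle I k).
exists [set k | ccube (q (un k)) (r (un k)) `<=` U], (q \o un), (r \o un).
split; last by move=> k Pk; split => //=; rewrite invr_gt0.
apply/seteqP; split => [v Uv|v [k Pk Bv]]; last first.
  by apply: Pk => i; exact/ltW/Bv.
have /nbhs_ballP[e /= e0 eU] : nbhs v U by exact: open_nbhs_nbhs.
have e20 : 0 < e / 2 by rewrite divr_gt0.
(* The centre will be within [1/(k+1)] of [v], so the points of the cube are within [2/(k+1) < e] of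
   [v]. *)
have [k ke] : exists k, k.+1%:R^-1 < e / 2.
  have [k /ltW] := @ltr_add_invr R 0 (e / 2) e20.
  rewrite add0r => H; exists k.+1; apply: lt_le_trans H.
  by rewrite ltf_pV2 ?posrE// ltr_nat.
have : forall i, exists p : rat, `|v ord0 i - ratr p| < k.+1%:R^-1.
  move=> i; have [p] := @rat_in_itvoo R (v ord0 i - k.+1%:R^-1) (v ord0 i + k.+1%:R^-1)
    ltac:(by rewrite ltrBlDr -addrA ltrDl addr_gt0).
  rewrite in_itv/= => /andP[q1 q2]; exists p; rewrite distrC ltr_distl.
  by rewrite q1 q2.
move/choice => [p pv].
have uK : un (pickle ((\row_i p i, k) : I)) = (\row_i p i, k) by rewrite /un pickleK.
exists (pickle ((\row_i p i, k) : I)) => /=; rewrite uK; last first.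
  by move=> i /=; rewrite !mxE.
move=> w Bw; apply: eU; rewrite -ball_normE /=; apply: rV_norm_lt => // i.
have := Bw i; have := pv i; rewrite /= !mxE /r/= => b1 b2.
rewrite (_ : v ord0 i - _ = (v ord0 i - ratr (p i)) - (w ord0 i - ratr (p i))); last lra.
apply: le_lt_trans (ler_normB _ _) _; move: b1 b2 ke.
by move: (k.+1%:R^-1 : R) => d; lra.
Qed.

Lemma open_measurable_rV n (U : set 'rV[R]_n) : open U -> measurable U.
Proof.
move=> /open_bigcup_ocube[P [q [r [-> _]]]].
by apply: bigcup_measurable => k _; exact: measurable_ocube.
Qed.

Lemma open_continuous_measurable_rV n (U : set 'rV[R]_n) (f : 'rV[R]_n -> R) :
  open U -> (forall x, U x -> {for x, continuous f}) -> measurable_fun U f.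
Proof.
move=> oU cf; apply: (measurability _ (RGenOpens.measurableE R)).
move=> _ [_ [a [b ->] <-]]; apply: open_measurable_rV.
rewrite openE => x [Ux fx]; apply: filterI; first exact: open_nbhs_nbhs.
by apply: (cf x Ux); apply: open_nbhs_nbhs; split => //; exact: interval_open.
Qed.

Lemma continuous_measurable_rV n (f : 'rV[R]_n -> R) :
  continuous f -> measurable_fun setT f.
Proof.
move=> cf; apply: open_continuous_measurable_rV; first exact: openT.
by move=> x _; exact: cf.
Qed.

Lemma cvg_rV (T : topologicalType) n (F : T -> 'rV[R]_n) (x : T) :
  (forall i, {for x, continuous (fun t => F t ord0 i)}) -> {for x, continuous F}.
Proof.
move=> cF A [P HP PA].
have : \forall t \near x, forall k, P ord0 k (F t ord0 k).
  by apply: filter_forall => k; apply: (cF k); exact: (HP ord0 k).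
by apply: filterS => t Ht; apply: PA => i j; rewrite ord1.
Qed.

Lemma continuous_coord n (i : 'I_n) : continuous (fun v : 'rV[R]_n => v ord0 i).
Proof. exact: coord_continuous. Qed.

End rV_topology.

Section lebesgue_rV_theory.
Context {R : realType}.
Local Notation mu := (@lebesgue_rV R).
Local Notation leb := (@lebesgue_measure R).

Lemma integrable_consrV n (f : 'rV[R]_n.+1 -> \bar R) :
  (mu n.+1).-integrable setT f ->
  (leb \x mu n)%E.-integrable setT (f \o (@consrV R n)).
Proof.
move=> /integrableP[mf If]; apply/integrableP; split.
  exact: (measurableT_comp mf (@measurable_consrV R n)).
move: If; apply: le_lt_trans.
rewrite -(@ge0_integral_pushforward _ _ _ _ _ (@consrV R n) _ (leb \x mu n)%E setT (abse \o f))//.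
- exact: measurable_consrV.
- exact: measurableT_comp.
- by move=> y _; exact: abse_ge0.
Qed.

Lemma integral_consrV n (f : 'rV[R]_n.+1 -> \bar R) :
  (mu n.+1).-integrable setT f ->
  (\int[mu n.+1]_x f x = \int[leb]_s \int[mu n]_v f (consrV (s, v)))%E.
Proof.
move=> If; have /integrableP[mf _] := If.
transitivity (\int[pushforward (leb \x mu n) (@consrV R n)]_x f x)%E; first by [].
rewrite integral_pushforward//; [|exact: measurable_consrV|].
  by rewrite -integral12_prod_meas1//; exact: integrable_consrV.
by rewrite preimage_setT; exact: integrable_consrV.
Qed.

Lemma integral_consrV_swap n (f : 'rV[R]_n.+1 -> \bar R) :
  (mu n.+1).-integrable setT f ->
  (\int[mu n.+1]_x f x = \int[mu n]_v \int[leb]_s f (consrV (s, v)))%E.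
Proof.
move=> If; rewrite integral_consrV//.
by rewrite (@Fubini _ _ _ _ _ leb (mu n) (f \o (@consrV R n)))//; exact: integrable_consrV.
Qed.

Definition cube n (M : R) : set 'rV[R]_n := [set v | forall i, `|v ord0 i| <= M].

Lemma consrV0 n (z : R * 'rV[R]_n) : consrV z ord0 ord0 = z.1.
Proof. by have /(congr1 fst) := consrVK z. Qed.

Lemma consrVS n (z : R * 'rV[R]_n) i : consrV z ord0 (lift ord0 i) = z.2 ord0 i.
Proof.
have H := congr1 (fun w : R * 'rV[R]_n => w.2 ord0 i) (consrVK z).
by rewrite /= mxE in H; rewrite -H; congr (consrV z _ _); exact: val_inj.
Qed.

Lemma cubeS n M (z : R * 'rV[R]_n) : cube M (consrV z) <-> `|z.1| <= M /\ cube M z.2.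
Proof.
split=> [H|[H0 H] i].
  split; first by have := H ord0; rewrite consrV0.
  by move=> i; have := H (lift ord0 i); rewrite consrVS.
by case: (unliftP ord0 i) => [j ->|->]; rewrite ?consrVS// consrV0.
Qed.

Lemma measurable_cube n M : measurable (@cube n M).
Proof.
rewrite (_ : cube M = \bigcap_(i in [set: 'I_n])
     ((fun v : 'rV[R]_n => v ord0 i) @^-1` [set x : R | `|x| <= M])); last first.
  by apply/seteqP; split => v /=; [move=> H i _; exact: H|move=> H i; exact: H].
apply: fin_bigcap_measurable => // i _; rewrite -[X in measurable X]setTI.
apply: measurable_coor => //.
rewrite (_ : mkset _ = `[- M, M]%classic)//.
by apply/seteqP; split => x /=; rewrite in_itv/= ler_norml.
Qed.

Lemma lebesgue_cube_lty n M : (mu n (@cube n M) < +oo)%E.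
Proof.
elim: n => [|n IH]; first by rewrite /= diracE ltry.
rewrite -[mu n.+1 _]/((leb \x mu n)%E ((@consrV R n) @^-1` cube M)).
rewrite (_ : _ @^-1` _ = `[- M, M]%classic `*` cube M); last first.
  apply/seteqP; split => z /=; rewrite in_itv/= -ler_norml.
    by move/cubeS.
  by move=> H; apply/cubeS.
rewrite product_measure1E//; last exact: measurable_cube.
have H : (leb `[(- M)%R, M]%classic < +oo)%E.
  by rewrite lebesgue_measure_itv/=; case: ifP; rewrite ?ltry.
by apply: lte_mul_pinfty => //; rewrite ge0_fin_numE.
Qed.

Lemma bounded_set_cube n (A : set 'rV[R]_n) :
  bounded_set A -> exists2 M, 0 < M & A `<=` cube M.
Proof.
move=> [M [Mr HM]]; exists (`|M| + 1); first by rewrite ltr_pwDr.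
move=> v Av i; apply: le_trans (rV_norm_coord _ _) _.
by apply: (HM (`|M| + 1)) => //; rewrite (le_lt_trans (ler_norm _))// ltrDl.
Qed.

Lemma bounded_measure_lty n (A : set 'rV[R]_n) :
  measurable A -> bounded_set A -> (mu n A < +oo)%E.
Proof.
move=> mA /bounded_set_cube[M M0 AM]; apply: le_lt_trans (lebesgue_cube_lty n M).
by apply: le_measure => //; rewrite inE//; exact: measurable_cube.
Qed.

End lebesgue_rV_theory.

Section derive_line.
Context {R : realType}.

(** Equality of the difference quotients as functions of [h] transfers both derivability and the
    value of the derivative, with no appeal to a chain rule. *)
Lemma derive_line_quotient n (f : 'rV[R]_n -> R) w y s :
  (fun h : R => h^-1 *: (((fun s => f (s *: w + y)) \o shift s) (h *: 1) - f (s *: w + y))) =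
  (fun h => h^-1 *: ((f \o shift (s *: w + y)) (h *: w) - f (s *: w + y))).
Proof.
by apply/funext => h /=; rewrite [h *: 1]mulr1 addrA scalerDl.
Qed.

Lemma derivable_line n (f : 'rV[R]_n -> R) w y (s : R) :
  derivable f (s *: w + y) w <-> derivable (fun s : R => f (s *: w + y)) s 1.
Proof. by rewrite /derivable derive_line_quotient. Qed.

Lemma derive_line n (f : 'rV[R]_n -> R) w y (s : R) :
  'D_1 (fun s : R => f (s *: w + y)) s = 'D_w f (s *: w + y).
Proof. by rewrite /derive derive_line_quotient. Qed.

Lemma consrV_line n s (v : 'rV[R]_n) :
  consrV (s, v) = s *: (delta_mx ord0 ord0) + consrV (0, v).
Proof.
apply/rowP => i; rewrite [RHS]mxE [X in _ = X + _]mxE [X in _ = _ * X + _]mxE.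
case: (unliftP ord0 i) => [j ->|->].
  by rewrite !consrVS eqxx /= mulr0 add0r.
by rewrite !consrV0 eqxx /= mulr1 addr0.
Qed.

Lemma consrV_lift n s (v : 'rV[R]_n) (h : R) j :
  consrV (s, h *: delta_mx ord0 j + v) =
  h *: (delta_mx ord0 (lift ord0 j)) + consrV (s, v).
Proof.
apply/rowP => i; rewrite [RHS]mxE [X in _ = X + _]mxE [X in _ = _ * X + _]mxE.
case: (unliftP ord0 i) => [k ->|->].
  by rewrite !consrVS !mxE/= (inj_eq lift_inj).
by rewrite !consrV0 /= mulr0 add0r.
Qed.

Lemma derive_consrV_lift_quotient n (f : 'rV[R]_n.+1 -> R) s v j :
  (fun h : R => h^-1 *: (((fun v => f (consrV (s, v))) \o shift v) (h *: delta_mx ord0 j)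
     - f (consrV (s, v)))) =
  (fun h : R => h^-1 *: ((f \o shift (consrV (s, v))) (h *: delta_mx ord0 (lift ord0 j))
     - f (consrV (s, v)))).
Proof. by apply/funext => h /=; rewrite consrV_lift. Qed.

Lemma derivable_consrV_lift n (f : 'rV[R]_n.+1 -> R) s v j :
  derivable f (consrV (s, v)) (delta_mx ord0 (lift ord0 j)) ->
  derivable (fun v => f (consrV (s, v))) v (delta_mx ord0 j).
Proof.
by rewrite /derivable derive_consrV_lift_quotient.
Qed.

Lemma partial_consrV_lift n (f : 'rV[R]_n.+1 -> R) s v j :
  partial j (fun v => f (consrV (s, v))) v = partial (lift ord0 j) f (consrV (s, v)).
Proof.
by rewrite /partial /derive derive_consrV_lift_quotient.
Qed.

Lemma continuous_consrV_r n s : continuous (fun v : 'rV[R]_n => consrV (s, v)).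
Proof.
move=> v; apply: cvg_rV => i; case: (unliftP ord0 i) => [k ->|->].
  rewrite (_ : (fun t => _) = (fun t : 'rV[R]_n => t ord0 k)).
    exact: continuous_coord.
  by apply/funext => t; rewrite consrVS.
rewrite (_ : (fun t => _) = cst s); first exact: cst_continuous.
by apply/funext => t; rewrite consrV0.
Qed.

Lemma continuous_consrV_l n (v : 'rV[R]_n) : continuous (fun s => consrV (s, v)).
Proof.
move=> s; apply: cvg_rV => i; case: (unliftP ord0 i) => [k ->|->].
  rewrite (_ : (fun t => _) = cst (v ord0 k)); first exact: cst_continuous.
  by apply/funext => t; rewrite consrVS.
rewrite (_ : (fun t => _) = id); first exact: cvg_id.
by apply/funext => t; rewrite consrV0.
Qed.

End derive_line.

Section divergence.
Context {R : realType}.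
Local Notation mu := (@lebesgue_rV R).
Local Notation leb := (@lebesgue_measure R).

Lemma derive_eq0_near n (F : 'rV[R]_n -> R) x w :
  (\forall y \near x, F y = 0) -> 'D_w F x = 0.
Proof.
move=> F0; rewrite (@near_eq_derive _ _ _ F (cst 0) x w)//.
exact: derive_cst.
Qed.

Lemma continuous_compact_bounded n (F : 'rV[R]_n -> R) (K : set 'rV[R]_n) :
  compact K -> continuous F -> exists2 M, 0 < M & forall x, K x -> `|F x| <= M.
Proof.
move=> cK cF; have /compact_bounded[M [Mr HM]] : compact (F @` K).
  by apply: continuous_compact => //; exact: continuous_subspaceT.
exists (`|M| + 1); first by rewrite ltr_pwDr.
move=> x Kx; apply: (HM (`|M| + 1)); last by exists x.
by rewrite (le_lt_trans (ler_norm _))// ltrDl.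
Qed.

Lemma compact_ccube n (q : 'rV[R]_n) r : compact (ccube q r).
Proof.
rewrite (_ : ccube q r = [set v : 'rV[R]_n | forall i, `[q ord0 i - r, q ord0 i + r]%classic (v ord0 i)]).
  by apply: (@rV_compact _ _ (fun i => `[q ord0 i - r, q ord0 i + r]%classic)) => i;
    exact: segment_compact.
by apply/seteqP; split => v /= H i; have := H i; rewrite /= in_itv/= ler_distl.
Qed.

Lemma cube_ccube n M : @cube R n M = ccube 0 M.
Proof. by apply/seteqP; split => v H i; have := H i; rewrite /= mxE subr0. Qed.

Lemma continuous_cube_integrable n (F : 'rV[R]_n -> R) M :
  continuous F -> (forall x, ~ cube M x -> F x = 0) ->
  (mu n).-integrable setT (EFin \o F).
Proof.
move=> cF F0; have mF := continuous_measurable_rV cF.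
rewrite (_ : EFin \o F = (EFin \o F) \_ (cube M)); last first.
  by apply/funext => x /=; rewrite patchE; case: ifPn => // /negP; rewrite inE => /F0 ->.
apply/(integrable_mkcond _ (measurable_cube _)).
apply: measurable_bounded_integrable.
- exact: measurable_cube.
- exact: lebesgue_cube_lty.
- exact: measurable_funTS.
have [|B B0 HB] := @continuous_compact_bounded n F (cube M) _ cF.
  by rewrite cube_ccube; exact: compact_ccube.
exists B; split; first exact: num_real.
by move=> C BC x /= Kx; apply: le_trans (HB _ Kx) (ltW BC).
Qed.

Lemma partial_eq0 n (F : 'rV[R]_n -> R) i M :
  (forall x, ~ cube M x -> F x = 0) -> forall x, ~ cube M x -> partial i F x = 0.
Proof.
move=> F0 x xM; apply: derive_eq0_near.
have cM : closed (@cube R n M).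
  by apply: compact_closed; [exact: norm_hausdorff|rewrite cube_ccube; exact: compact_ccube].
have : \forall y \near x, (~` cube M) y.
  by apply: open_nbhs_nbhs; split => //; exact: closed_openC.
by apply: filterS => y; exact: F0.
Qed.

(** Induction on the dimension. For a later coordinate, freeze the first one and apply the induction
    hypothesis to the slice; for the first coordinate, integrate along lines first and use the
    fundamental theorem of calculus. *)
Lemma integral_partial_eq0 n (F : 'rV[R]_n -> R) (i : 'I_n) M :
  (forall x, derivable F x (delta_mx ord0 i)) ->
  continuous F -> continuous (partial i F) ->
  (forall x, ~ cube M x -> F x = 0) ->
  (\int[mu n]_x (partial i F x)%:E = 0)%E.
Proof.
elim: n F i => [F [] //|n IH F i dF cF cpF F0].
have pF0 := partial_eq0 i F0.
have iF := continuous_cube_integrable cpF pF0.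
case: (unliftP ord0 i) => [j ij|i0].
  rewrite (integral_consrV iF) /=.
  rewrite (_ : (fun s => _) = cst 0%E); first exact: integral0.
  apply/funext => s /=.
  rewrite -(IH (fun v => F (consrV (s, v))) j).
  - by apply: eq_integral => v _; rewrite ij -partial_consrV_lift.
  - by move=> v; apply: derivable_consrV_lift; rewrite -ij.
  - move=> v; apply: (@continuous_comp _ _ _ (fun v : 'rV[R]_n => consrV (s, v)) F).
      exact: continuous_consrV_r.
    exact: cF.
  - rewrite (_ : partial j _ = partial i F \o (fun v => consrV (s, v))).
      move=> v; apply: continuous_comp; first exact: continuous_consrV_r.
      exact: cpF.
    by apply/funext => v /=; rewrite partial_consrV_lift ij.
  - by move=> v vM; apply: F0 => /cubeS[].
rewrite (integral_consrV_swap iF) /=.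
rewrite (_ : (fun v => _) = cst 0%E); first exact: integral0.
apply/funext => v /=.
pose h (s : R) := F (consrV (s, v)).
have hE : h = (fun s => F (s *: delta_mx ord0 ord0 + consrV (0, v))).
  by apply/funext => s; rewrite /h consrV_line.
have dh s : 'D_1 h s = partial i F (consrV (s, v)).
  by rewrite hE derive_line -consrV_line i0.
have ddh s : derivable h s 1.
  rewrite hE; apply/derivable_line; rewrite -consrV_line.
  by have := dF (consrV (s, v)); rewrite i0.
have ch : continuous h.
  move=> s; apply: (@continuous_comp _ _ _ (fun s : R => consrV (s, v)) F).
    exact: continuous_consrV_l.
  exact: cF.
have cdh : continuous (fun s => partial i F (consrV (s, v))).
  move=> s; apply: (@continuous_comp _ _ _ (fun s : R => consrV (s, v)) (partial i F)).
    exact: continuous_consrV_l.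
  exact: cpF.
(* Beyond [|s| = K] the line has left the cube, so [h] vanishes at both endpoints of [[-K, K]]. *)
pose K := `|M| + 1.
have h0 s : K <= `|s| -> h s = 0 /\ partial i F (consrV (s, v)) = 0.
  move=> Ks; have : ~ cube M (consrV (s, v)).
    move=> /cubeS[/= sM _]; have := le_trans Ks (le_trans sM (ler_norm M)).
    by rewrite /K gerDl ler10.
  by move=> H; split; [exact: F0|exact: pF0].
have K0 : 0 < K by rewrite /K ltr_wpDl.
transitivity (\int[leb]_(s in `[(- K)%R, K]%classic) (partial i F (consrV (s, v)))%:E)%E.
  rewrite [RHS]integral_mkcond; apply: eq_integral => s _; rewrite patchE.
  case: ifPn => // /negP; rewrite inE /= in_itv/= -ler_norml => /negP.
  by rewrite -ltNge => /ltW /h0[_ ->].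
rewrite (@continuous_FTC2 _ _ h).
- by rewrite (h0 K _).1 ?(h0 (- K) _).1 ?subee// ?normrN ger0_norm// ltW.
- by rewrite gtrN.
- exact: continuous_subspaceT.
- split => [s _||]; first exact: ddh.
  + by apply: cvg_at_right_filter; exact: ch.
  + by apply: cvg_at_left_filter; exact: ch.
- by move=> s _; rewrite derive1E dh.
Qed.

End divergence.

(** * Smooth functions and the lemma of du Bois-Reymond *)

Section smooth_theory.
Context {R : realType} {n : nat}.
Implicit Types f g : 'rV[R]_n -> R.
Local Notation Ck := (fun k f => Ck k [set: 'rV[R]_n] f).
Local Notation e_ i := (delta_mx ord0 i : 'rV[R]_n).

Lemma CkS k f : Ck k.+1 f -> Ck k f.
Proof.
elim: k f => [|k IH] f [cf H]; first by split.
split => // i; have [df pf] := H i; split => //.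
exact: IH.
Qed.

Lemma Ck0 k f : Ck k f -> continuous f.
Proof. by case: k => [|k] [cf _] x; exact: cf. Qed.

Lemma Ck_derivable k f : Ck k.+1 f -> forall i x, derivable f x (e_ i).
Proof. by move=> [_ H] i x; have [+ _] := H i; exact. Qed.

Lemma Ck_partial k f : Ck k.+1 f -> forall i, Ck k (partial i f).
Proof. by move=> [_ H] i; have [] := H i. Qed.

Lemma Ck_intro k f (df : 'I_n -> 'rV[R]_n -> R) : continuous f ->
  (forall i x, is_derive x (e_ i) f (df i x)) ->
  (forall i, Ck k (df i)) -> Ck k.+1 f.
Proof.
move=> cf H Cdf; split=> [x _|i]; first exact: cf.
split=> [x _|]; first by have [] := H i x.
rewrite (_ : partial i f = df i)//; apply/funext => x.
by have [_ <-] := H i x.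
Qed.

Lemma Ck_cst k (c : R) : Ck k (cst c).
Proof.
elim: k c => [|k IH] c; first by split => // x _; exact: cst_continuous.
by apply: (@Ck_intro _ _ (fun=> cst 0)) => [|i]; [exact: cst_continuous|exact: IH].
Qed.

Lemma CkD k f g : Ck k f -> Ck k g -> Ck k (f + g).
Proof.
elim: k f g => [|k IH] f g Cf Cg.
  by split=> // x _; apply: continuousD; [exact: (Ck0 Cf)|exact: (Ck0 Cg)].
apply: (@Ck_intro _ _ (fun i => partial i f + partial i g)) => [x|i x|i].
- by apply: continuousD; [exact: (Ck0 Cf)|exact: (Ck0 Cg)].
- have df : derivable f x (e_ i) by exact: (Ck_derivable Cf).
  have dg : derivable g x (e_ i) by exact: (Ck_derivable Cg).
  by apply: is_deriveD; apply/derivableP.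
- by apply: IH; exact: Ck_partial.
Qed.

Lemma CkM k f g : Ck k f -> Ck k g -> Ck k (f * g).
Proof.
elim: k f g => [|k IH] f g Cf Cg.
  by split=> // x _; apply: continuousM; [exact: (Ck0 Cf)|exact: (Ck0 Cg)].
apply: (@Ck_intro _ _ (fun i => f * partial i g + g * partial i f)) => [x|i x|i].
- by apply: continuousM; [exact: (Ck0 Cf)|exact: (Ck0 Cg)].
- have df : derivable f x (e_ i) by exact: (Ck_derivable Cf).
  have dg : derivable g x (e_ i) by exact: (Ck_derivable Cg).
  exact: is_deriveM (derivableP df) (derivableP dg).
- by apply: CkD; apply: IH; [exact: (CkS Cf)|exact: (Ck_partial Cg)|
    exact: (CkS Cg)|exact: (Ck_partial Cf)].
Qed.

Lemma is_derive_coord i j (x : 'rV[R]_n) :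
  is_derive x (e_ j) (fun v : 'rV[R]_n => v ord0 i) (i == j)%:R.
Proof.
have E : (fun h : R => h^-1 *: (((fun v : 'rV[R]_n => v ord0 i) \o shift x) (h *: e_ j) - x ord0 i))
   @ 0^' --> ((i == j)%:R : R).
  apply: cvg_near_cst; near=> h.
  rewrite /= !mxE eqxx /= addrK scalerA mulVf ?scale1r//.
  by near: h; exact: nbhs_dnbhs_neq.
split; first by apply/cvg_ex; eexists; exact: E.
exact/cvg_lim.
Unshelve. all: by end_near. Qed.

Lemma Ck_coord k i : Ck k (fun v => v ord0 i).
Proof.
case: k => [|k]; first by split => // x _; exact: continuous_coord.
apply: (@Ck_intro _ _ (fun j => cst (i == j)%:R)) => [|j x|j].
- exact: continuous_coord.
- exact: is_derive_coord.
- exact: Ck_cst.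
Qed.

Lemma smooth_partial i f : smooth setT f -> smooth setT (partial i f).
Proof. by move=> sf k; exact: Ck_partial (sf k.+1) i. Qed.

Variable Omega : set 'rV[R]_n.
Local Notation tf := (test_function Omega).

Lemma test_functionD f g : tf f -> tf g -> tf (f + g).
Proof.
move=> [sf cf Of] [sg cg Og].
have sub : closure [set x | (f + g) x != 0] `<=`
    closure [set x | f x != 0] `|` closure [set x | g x != 0].
  rewrite -closureU; apply: closureS => x /=; rewrite fctE => fg.
  by apply/orP; rewrite -negb_and; apply: contra_neqN fg => /andP[/eqP -> /eqP ->]; rewrite addr0.
split.
- by move=> k; exact: CkD.
- apply: subclosed_compact sub; first exact: closed_closure.
  exact: compactU.
- by move=> x /sub [/Of|/Og].
Qed.

Lemma test_functionM f g : smooth setT f -> tf g -> tf (f * g).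
Proof.
move=> sf [sg cg Og].
have sub : closure [set x | (f * g) x != 0] `<=` closure [set x | g x != 0].
  apply: closureS => x /=; rewrite fctE; apply: contra_neq => ->.
  by rewrite mulr0.
split.
- by move=> k; exact: CkM.
- by apply: subclosed_compact cg sub; exact: closed_closure.
- by move=> x /sub /Og.
Qed.

Lemma test_functionZ (c : R) f : tf f -> tf (fun x => c * f x).
Proof. by move=> tf; apply: (@test_functionM (cst c)) => // k; exact: Ck_cst. Qed.

Lemma test_function0 : tf (cst 0).
Proof.
have E : [set x : 'rV[R]_n | (cst 0 : 'rV[R]_n -> R) x != 0] = set0.
  by apply/seteqP; split => x //=; rewrite eqxx.
by split; [move=> k; exact: Ck_cst|rewrite E closure0; exact: compact0|rewrite E closure0].
Qed.

Lemma test_function_cube f : tf f ->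
  exists M, forall x, ~ cube M x -> f x = 0.
Proof.
move=> [_ /compact_bounded/bounded_set_cube[M M0 sM] _]; exists M => x xM.
by apply/eqP; apply: contrapT => /negP fx; apply/xM/sM/subset_closure.
Qed.

Lemma test_function_out f : tf f -> forall x, ~ Omega x -> f x = 0.
Proof.
move=> [_ _ sO] x xO.
by apply/eqP; apply: contrapT => /negP fx; apply/xO/sO/subset_closure.
Qed.

Lemma test_function_partial i f : tf f -> tf (partial i f).
Proof.
move=> [sf cf Of].
have sub : closure [set x | partial i f x != 0] `<=` closure [set x | f x != 0].
  have /closure_id -> := @closed_closure _ [set x | f x != 0].
  apply: closureS => x /= pf; apply: contrapT => xf; move/eqP: pf; apply; apply: derive_eq0_near.
  have : \forall y \near x, (~` closure [set x | f x != 0]) y.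
    by apply: open_nbhs_nbhs; split => //; apply/closed_openC/closed_closure.
  by apply: filterS => y yf; apply/eqP; apply: contrapT => /negP fy; apply/yf/subset_closure.
split.
- exact: smooth_partial.
- by apply: subclosed_compact cf sub; exact: closed_closure.
- by move=> x /sub /Of.
Qed.

End smooth_theory.

(** * Smooth bumps supported in boxes *)

Section bump.
Context {R : realType}.
Variable c : R.
Hypothesis c0 : 0 < c.

(** The factor [x^-m] makes the family closed under differentiation, see [is_derive_bump], so that
    smoothness is an induction on the order for all [m] at once. As [c] tends to 0, [bump c 0] tends
    to the indicator of the positive half-line. *)
Definition bump (m : nat) (x : R) : R :=
  if 0 < x then x^-1 ^+ m * expR (- (c / x)) else 0.

Lemma bump_le m : exists2 K, 0 <= K & forall x, `|bump m x| <= K * `|x|.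
Proof.
(* Raise [z <= e^z] at [z = c / (x (m+1))] to the power [m+1]: then
   [e^(-c/x) <= ((m+1) x / c)^(m+1)], one factor [x] more than needed to absorb [x^-m]. *)
pose K := (m.+1%:R / c) ^+ m.+1; exists K; first by rewrite exprn_ge0// divr_ge0// ltW.
move=> x; rewrite /bump; case: ifPn => [x0|_]; last first.
  by rewrite normr0 mulr_ge0// exprn_ge0// divr_ge0// ltW.
have xV : 0 < x^-1 by rewrite invr_gt0.
rewrite ger0_norm ?mulr_ge0 ?expR_ge0 ?exprn_ge0 ?(ltW xV)// gtr0_norm//.
rewrite expRN ler_pdivrMr ?expR_gt0//.
have m0 : (0 : R) < m.+1%:R by [].
have Hz : c / x / m.+1%:R <= expR (c / x / m.+1%:R).
  by apply: le_trans (expR_ge1Dx _); rewrite lerDr.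
have z0 : 0 <= c / x / m.+1%:R by rewrite !divr_ge0// ltW.
have : (c / x / m.+1%:R) ^+ m.+1 <= expR (c / x).
  have -> : expR (c / x) = expR (c / x / m.+1%:R) ^+ m.+1.
    by rewrite -expRM_natl; congr expR; rewrite [RHS]mulrC divfK// gt_eqF.
  by rewrite lerXn2r ?nnegrE ?expR_ge0.
move=> H; apply: (@le_trans _ _ (K * x * (c / x / m.+1%:R) ^+ m.+1)); last first.
  by rewrite ler_wpM2l// mulr_ge0 ?(ltW x0)// exprn_ge0// divr_ge0// ltW.
rewrite /K mulrAC -exprMn (_ : m.+1%:R / c * (c / x / m.+1%:R) = x^-1).
  by rewrite exprSr -mulrA mulVf ?mulr1// gt_eqF.
by field; rewrite !gt_eqF.
Qed.

Lemma is_derive_bump m (x : R) :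
  is_derive x 1 (bump m) (c * bump m.+2 x - m%:R * bump m.+1 x).
Proof.
have [x0|x0|x0] := ltgtP x 0.
- rewrite (_ : _ - _ = 0); last first.
    by rewrite /bump !ifN ?mulr0 ?subrr// -leNgt ltW.
  apply: (@near_eq_is_derive _ _ _ (cst 0)).
    near=> y; rewrite /bump ifN// -leNgt; near: y.
    by apply: filterS (lt_nbhsl x0) => y /ltW.
- pose G (y : R) := y^-1 ^+ m * expR (- (c / y)).
  apply: (@near_eq_is_derive _ _ _ G).
    near=> y; rewrite /bump ifT//; near: y; exact: lt_nbhsr.
  have xn0 : x != 0 by rewrite gt_eqF.
  have dV : is_derive x 1 (fun y : R => y^-1) (- x ^- 2 *: 1).
    by apply: is_deriveV.
  have d1 := is_deriveX m dV.
  have d2 : is_derive x 1 (fun y : R => - (c / y)) (c * x ^- 2).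
    have := is_deriveN (is_deriveZ c dV).
    rewrite (_ : - (c \*: _) = (fun y : R => - (c / y))) // => d.
    apply: is_derive_eq d _; rewrite /GRing.scale /=; ring.
  have d3 : is_derive x 1 (fun y : R => expR (- (c / y))) (expR (- (c / x)) * (c * x ^- 2)).
    exact: (@is_derive1_comp _ expR _ _ _ _ (is_derive_expR _) d2).
  have := is_deriveM d1 d3.
  rewrite (_ : _ * _ = G); last by apply/funext => y; rewrite /G !fctE.
  move=> d; apply: is_derive_eq d _.
  rewrite /bump !ifT// /GRing.scale /= fctE.
  case: (m) => [|p]; rewrite /= ?exprS ?expr0; field => //.
- rewrite {x}x0 (_ : _ - _ = 0); last by rewrite /bump ltxx !mulr0 subrr.
  have E : (fun h : R => h^-1 *: ((bump m \o shift 0) (h *: 1) - bump m 0)) @ 0^' --> (0 : R).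
    (* At 0 the difference quotient of [bump m] is [bump m.+1] itself, which tends to 0 by
       [bump_le]. *)
    rewrite (_ : (fun h => _) = bump m.+1).
      have [K K0 HK] := bump_le m.+1.
      apply: cvg_within_filter; apply/cvgr0Pnorm_le => e e0.
      have eK : 0 < e / (K + 1) by rewrite divr_gt0// ltr_wpDl.
      near=> h; apply: (le_trans (HK h)).
      have : `|h| <= e / (K + 1).
        near: h; apply: filterS (nbhsx_ballx (0 : R) _ eK) => h.
        by rewrite -ball_normE /= sub0r normrN => /ltW.
      rewrite ler_pdivlMr ?ltr_wpDl// => H; apply: le_trans H.
      by rewrite mulrC ler_wpM2l// lerDl.
    apply/funext => h; rewrite /= addr0 /GRing.scale /= mulr1 {2}/bump ltxx subr0 /bump.
    by case: ifPn; rewrite ?mulr0// exprS mulrA.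
  split; first by apply/cvg_ex; eexists; exact: E.
  exact/cvg_lim.
Unshelve. all: by end_near. Qed.

End bump.

Section bump_rV.
Context {R : realType} {n : nat}.
Implicit Types (i : 'I_n).
Local Notation mu := (@lebesgue_rV R n).
Local Notation e_ i := (delta_mx ord0 i : 'rV[R]_n).

Lemma continuous_bump (c : R) m : 0 < c -> continuous (bump c m).
Proof.
move=> c0 x; have [d _] := is_derive_bump c0 m x.
exact/differentiable_continuous/derivable1_diffP.
Qed.

Lemma continuous_affine_coord (s a : R) i : continuous (fun v : 'rV[R]_n => s * v ord0 i + a).
Proof.
by move=> v; exact: (cvgD (cvgM (cvg_cst s) (@continuous_coord R n i v)) (cvg_cst a)).
Qed.

Lemma Ck_bump k (c : R) m (s a : R) i : 0 < c ->
  Ck k [set: 'rV[R]_n] (fun v => bump c m (s * v ord0 i + a)).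
Proof.
move=> c0; elim: k m => [|k IH] m.
  split => // x _; apply: (@continuous_comp _ _ _ (fun v : 'rV[R]_n => s * v ord0 i + a)).
    exact: continuous_affine_coord.
  exact: continuous_bump.
apply: (@Ck_intro _ _ _ _ (fun j =>
    cst ((i == j)%:R * s) * (cst c * (fun v : 'rV[R]_n => bump c m.+2 (s * v ord0 i + a))
           + cst (- m%:R) * (fun v : 'rV[R]_n => bump c m.+1 (s * v ord0 i + a))))) => [x|j x|j].
- apply: (@continuous_comp _ _ _ (fun v : 'rV[R]_n => s * v ord0 i + a)).
    exact: continuous_affine_coord.
  exact: continuous_bump.
- set L := fun v : 'rV[R]_n => s * v ord0 i + a.
  have dline : is_derive (0 : R) 1 (fun t : R => bump c m (L (t *: e_ j + x)))
     ((c * bump c m.+2 (L x) - m%:R * bump c m.+1 (L x)) * ((i == j)%:R * s)).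
    have -> : (fun t : R => bump c m (L (t *: e_ j + x))) =
              bump c m \o (fun t : R => (i == j)%:R * s * t + L x).
      apply/funext => t; rewrite /L /= !mxE eqxx /=; congr (bump _ _ _).
      by case: eqP => _; ring.
    apply: is_derive1_comp.
      by rewrite mulr0 add0r; exact: is_derive_bump.
    have H : is_derive (0 : R) 1 (fun t : R => (i == j)%:R * s *: t + L x) ((i == j)%:R * s *: 1 + 0).
      by apply: is_deriveD.
    by apply: is_derive_eq H _; rewrite addr0 /GRing.scale /= mulr1.
  have dx : derivable (fun v => bump c m (L v)) (0 *: e_ j + x) (e_ j).
    by apply/derivable_line; have [] := dline.
  have vx : 'D_(e_ j) (fun v => bump c m (L v)) (0 *: e_ j + x) =
      (c * bump c m.+2 (L x) - m%:R * bump c m.+1 (L x)) * ((i == j)%:R * s).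
    by rewrite -derive_line; have [_] := dline.
  rewrite scale0r add0r in dx vx; split => //.
  rewrite vx !fctE /=; ring.
- apply: CkM; first exact: Ck_cst.
  by apply: CkD; apply: CkM; first [exact: Ck_cst|exact: IH].
Qed.

(** A triple [(i, s, d)] stands for the half-space [0 < s v_i + d]. With boxes as lists of
    half-spaces, intersection is concatenation and the bump of a box is a product over its list. *)
Definition affine_ineq : Type := 'I_n * R * R.

Definition box (L : seq affine_ineq) : set 'rV[R]_n :=
  [set v | all (fun l => 0 < l.1.2 * v ord0 l.1.1 + l.2) L].

Definition boxbump (c : R) (L : seq affine_ineq) (v : 'rV[R]_n) : R :=
  \prod_(l <- L) bump c 0 (l.1.2 * v ord0 l.1.1 + l.2).

Lemma box_cat L1 L2 : box (L1 ++ L2) = box L1 `&` box L2.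
Proof.
by apply/seteqP; split => v; rewrite /box/= all_cat => /andP.
Qed.

Lemma smooth_boxbump c L : 0 < c -> smooth setT (boxbump c L).
Proof.
move=> c0 k; elim: L => [|l L IH].
  rewrite (_ : boxbump c [::] = cst 1); first exact: Ck_cst.
  by apply/funext => v; rewrite /boxbump big_nil.
rewrite (_ : boxbump c _ = (fun v : 'rV[R]_n => bump c 0 (l.1.2 * v ord0 l.1.1 + l.2)) * boxbump c L).
  by apply: CkM => //; exact: Ck_bump.
by apply/funext => v; rewrite /boxbump big_cons.
Qed.

Lemma bump_ge0 (c : R) x : 0 <= bump c 0 x.
Proof. by rewrite /bump; case: ifP; rewrite ?expr0 ?mul1r ?expR_ge0. Qed.

Lemma bump_le1 (c : R) x : 0 < c -> bump c 0 x <= 1.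
Proof.
rewrite /bump => c0; case: ifP => // x0; rewrite expr0 mul1r.
by rewrite -expR0 ler_expR oppr_le0 divr_ge0// ltW.
Qed.

Lemma boxbump_ge0 c L v : 0 <= boxbump c L v.
Proof. by apply: prodr_ge0 => l _; exact: bump_ge0. Qed.

Lemma boxbump_le1 c L v : 0 < c -> boxbump c L v <= 1.
Proof.
move=> c0; rewrite /boxbump; apply: (@le_trans _ _ (\prod_(l <- L) 1)); last by rewrite big1.
by apply: ler_prod => l _; rewrite bump_ge0 bump_le1.
Qed.

Lemma boxbump_out c L v : ~ box L v -> boxbump c L v = 0.
Proof.
rewrite /box /= => /negP; rewrite -has_predC => /hasP[l lL /= Hl].
apply/eqP; rewrite prodf_seq_eq0; apply/hasP; exists l => //=.
by rewrite /bump ifN.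
Qed.

Lemma boxbump_cvg L v : boxbump k.+1%:R^-1 L v @[k --> \oo] --> (\1_(box L) v : R).
Proof.
rewrite indicE; case: (pselect (box L v)) => bv; last first.
  rewrite memNset//; apply: cvg_near_cst; apply: nearW => k.
  by rewrite boxbump_out.
rewrite mem_set//= (_ : 1%:R = \prod_(l <- L) (1 : R)); last by rewrite big1.
move: bv; rewrite /box /boxbump/=; elim: L => [_|l L IH /= /andP[l0 HL]].
  by under eq_fun do rewrite big_nil; rewrite big_nil; exact: cvg_cst.
under eq_fun do rewrite big_cons; rewrite big_cons.
apply: cvgM; last exact: IH.
move: (_ + _) l0 => x x0.
rewrite (_ : (fun k => _) = (fun k : nat => expR (- (k.+1%:R^-1 / x)))); last first.
  by apply/funext => k; rewrite /bump x0 expr0 mul1r.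
rewrite -[X in _ --> X]expR0; apply: continuous_cvg; first exact: continuous_expR.
rewrite -oppr0; apply: cvgN; rewrite -(mul0r x^-1).
by apply: cvgM; [exact: cvg_harmonic|exact: cvg_cst].
Qed.

(** The preimage of an open interval under a coordinate is the box of two half-spaces. Boxes are
    stable under intersection by [box_cat], so they can serve as the pi-system of a Dynkin
    argument. *)
Lemma box_measurable_generated : measurable = <<s range box >> :> set (set 'rV[R]_n).
Proof.
apply/seteqP; split.
  apply: smallest_sub; first exact: smallest_sigma_algebra.
  rewrite -bigcup_seq => A [i _] [B mB <-]; rewrite setTI.
  have {}mB : (@RGenOpens.G R).-sigma.-measurable B by rewrite -RGenOpens.measurableE.
  have : <<s @RGenOpens.G R >> B by exact: mB.
  move: B {mB}; apply: smallest_sub.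
    split => [|B sB|F sF].
    - by rewrite preimage_set0; apply: sigma_algebra0; exact: smallest_sigma_algebra.
    - rewrite setTD preimage_setC -setTD.
      by apply: (@sigma_algebraCD _ setT) => //; exact: smallest_sigma_algebra.
    - by rewrite preimage_bigcup; apply: sigma_algebra_bigcup.
  move=> _ [x [y ->]]; apply: sub_sigma_algebra => /=.
  exists [:: (i, 1, - x); (i, - 1, y)] => //.
  apply/seteqP; split => v; rewrite /box /= in_itv/= andbT mul1r mulN1r subr_gt0 addrC subr_gt0.
    by [].
  by [].
apply: smallest_sub; first exact: sigma_algebra_measurable.
move=> _ [L _ <-]; elim: L => [|l L IH].
  by rewrite (_ : box _ = setT)//; apply/seteqP; split.
rewrite -cat1s box_cat; apply: measurableI => //.
have -> : box [:: l] = (fun v : 'rV[R]_n => l.1.2 * v ord0 l.1.1 + l.2) @^-1` `]0, +oo[%classic.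
  by apply/seteqP; split => v; rewrite /box /= in_itv/= !andbT.
rewrite -[X in measurable X]setTI; apply: continuous_measurable_rV => //.
exact: continuous_affine_coord.
Qed.

End bump_rV.

Section du_Bois_Reymond.
Context {R : realType} {n : nat}.
Local Notation mu := (@lebesgue_rV R n).
Variable Omega : set 'rV[R]_n.
Hypotheses (oO : open Omega) (bO : bounded_set Omega).

Let mO : measurable Omega. Proof. exact: open_measurable_rV. Qed.

Let fO : (mu Omega < +oo)%E. Proof. exact: bounded_measure_lty. Qed.

(** Constants are integrable on the bounded set [Omega], and [|g| <= 1 + g^2]. *)
Lemma L2_integrable1 (g : 'rV[R]_n -> R) : L2 Omega g -> mu.-integrable Omega (EFin \o g).
Proof.
move=> Lg; have I2 := L2_integrable mO Lg Lg.
have I1 : mu.-integrable Omega (EFin \o cst 1).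
  apply: measurable_bounded_integrable => //; exists 1; split; first exact: num_real.
  by move=> C C1 x _ /=; rewrite normr1 ltW.
apply: (@le_integrable _ _ _ _ _ mO _ _ _ _ (integrableD mO I1 I2)).
  by apply/measurable_EFinP; exact: (L2_measurable mO Lg).
move=> x _ /=; rewrite !lee_fin -expr2 [leRHS]ger0_norm ?addr_ge0 ?sqr_ge0//.
rewrite -real_normK ?num_real//; move: (`|g x|) => z.
have := sqr_ge0 (z - 1); rewrite sqrrB1; nra.
Qed.

Lemma L2_bounded (f : 'rV[R]_n -> R) (M : R) : measurable_fun Omega f ->
  (forall x, Omega x -> `|f x| <= M) -> L2 Omega f.
Proof.
move=> mf fM; apply: L2_intro => //; apply: measurable_bounded_integrable => //.
  exact: measurable_funX.
exists (M ^+ 2); split; first exact: num_real.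
move=> C MC x /= Ox; apply: le_trans (ltW MC); rewrite normrX.
by rewrite lerXn2r ?nnegrE// ?fM// (le_trans _ (fM _ Ox)).
Qed.

Lemma continuous_L2 (f : 'rV[R]_n -> R) : continuous f -> L2 Omega f.
Proof.
move=> cf; have [q _ Oq] := bounded_set_cube bO.
have [M M0 HM] := continuous_compact_bounded (@compact_ccube _ _ 0 q) cf.
apply: (@L2_bounded _ M).
  by apply: measurable_funTS; exact: continuous_measurable_rV.
by move=> x /(Oq) xq; apply: HM; rewrite -cube_ccube.
Qed.

Lemma smooth_L2 (f : 'rV[R]_n -> R) : smooth setT f -> L2 Omega f.
Proof. by move=> sf; apply: continuous_L2; exact: (Ck0 (sf 0%N)). Qed.

Lemma test_function_L2 (f : 'rV[R]_n -> R) : test_function Omega f -> L2 Omega f.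
Proof. by case=> /smooth_L2. Qed.

Definition ocube_ineqs (q : 'rV[R]_n) (r : R) : seq (@affine_ineq R n) :=
  [seq (i, 1, r - q ord0 i) | i <- enum 'I_n] ++ [seq (i, - 1, r + q ord0 i) | i <- enum 'I_n].

Lemma box_ocube q r : box (ocube_ineqs q r) = ocube q r.
Proof.
rewrite box_cat; apply/seteqP; split => v.
  move=> [/= /allP H1 /allP H2] i; rewrite ltr_distl.
  have := H1 (i, 1, r - q ord0 i) (map_f _ (mem_enum _ i)).
  have := H2 (i, - 1, r + q ord0 i) (map_f _ (mem_enum _ i)).
  by rewrite /= => h1 h2; apply/andP; split; lra.
move=> H; split; apply/allP => _ /mapP[i _ ->] /=;
  have := H i; rewrite ltr_distl => /andP[h1 h2]; lra.
Qed.

(** The inequalities of the cube confine the support; [L] stays free, so that every box intersected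
    with the cube is reached by test functions. *)
Lemma test_function_boxbump c q r L : 0 < c -> ccube q r `<=` Omega ->
  test_function Omega (boxbump c (ocube_ineqs q r ++ L)).
Proof.
move=> c0 qO.
have ccl : closed (ccube q r) by apply: compact_closed; [exact: norm_hausdorff|exact: compact_ccube].
have sub : closure [set x | boxbump c (ocube_ineqs q r ++ L) x != 0] `<=` ccube q r.
  have /closure_id -> := ccl; apply: closureS => x /= bx.
  have : box (ocube_ineqs q r ++ L) x.
    by apply: contrapT => /(boxbump_out c) E; move/eqP: bx; rewrite E.
  by rewrite box_cat box_ocube => -[H _] i; exact: ltW.
split.
- exact: smooth_boxbump.
- by apply: subclosed_compact sub; [exact: closed_closure|exact: compact_ccube].
- exact: subset_trans sub qO.
Qed.

(** It suffices to work on one of the countably many cubes [Q] that cover [Omega]. Bumps of [Q] cut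
    by a box are test functions that converge boundedly to an indicator, so [g] has integral 0 over
    every such set, hence over every measurable subset of [Q]. *)
Theorem du_Bois_Reymond (g : 'rV[R]_n -> R) : L2 Omega g ->
  (forall phi, test_function Omega phi -> inner Omega g phi = 0) ->
  g = cst 0 %[ae mu in Omega].
Proof.
move=> Lg g0; have Ig := L2_integrable1 Lg.
have mg : measurable_fun Omega (EFin \o g) by have /integrableP[] := Ig.
have [P [q [r [OE HP]]]] := open_bigcup_ocube oO.
have sub k : P k -> ocube (q k) (r k) `<=` Omega.
  by move=> Pk x xq; have [_] := HP k Pk; apply => i; exact/ltW/xq.
suff H k : P k -> ae_eq mu (ocube (q k) (r k)) (EFin \o g) (cst 0%E).
  have : {ae mu, forall x, forall k, P k -> ocube (q k) (r k) x -> g x = 0}.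
    apply: ae_foralln => k; case: (pselect (P k)) => Pk; last by apply: nearW => x /Pk.
    by apply: filterS (H k Pk) => x Hx _ /Hx [].
  apply: filterS => x Hx; rewrite {1}OE => -[k Pk] xk.
  exact: Hx k Pk xk.
move=> Pk; set Q := ocube (q k) (r k).
have mQ : measurable Q by exact: measurable_ocube.
have QO : Q `<=` Omega by exact: sub.
have IgQ : mu.-integrable Q (EFin \o g) by exact: integrableS Ig.
have base L : (\int[mu]_(x in Q `&` box L) (g x)%:E = 0)%E.
  have mL : measurable (box L) by rewrite box_measurable_generated; apply: sub_sigma_algebra; exists L.
  pose F (j : nat) (x : 'rV[R]_n) := (g x * boxbump j.+1%:R^-1 (ocube_ineqs (q k) (r k) ++ L) x)%:E.
  have mb j : measurable_fun Omega (boxbump j.+1%:R^-1 (ocube_ineqs (q k) (r k) ++ L)).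
    apply: measurable_funTS; apply: continuous_measurable_rV.
    by apply: (@Ck0 _ _ 0); apply: smooth_boxbump.
  (* The bumps take values in [[0, 1]], so [|g|] dominates. *)
  have [] := @dominated_convergence _ _ _ mu Omega mO F
    (fun x => (g x * \1_(Q `&` box L) x)%:E) (fun x => `|g x|%:E).
  - move=> j; apply/measurable_EFinP; apply: measurable_funM => //.
    exact/measurable_EFinP.
  - apply/measurable_EFinP; apply: measurable_funM; first exact/measurable_EFinP.
    exact/measurable_funTS/measurable_indic/measurableI.
  - apply: nearW => x Ox; apply: cvg_EFin; first exact: nearW.
    apply: cvgM; first exact: cvg_cst.
    by rewrite /Q -box_ocube -box_cat; exact: boxbump_cvg.
  - exact: integrable_norm.
  - apply: nearW => x j Ox; rewrite /F lee_fin normrM ler_piMr// ger0_norm ?boxbump_ge0//.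
    by apply: boxbump_le1; rewrite invr_gt0.
  move=> _ _ C.
  have F0 : (fun j => \int[mu]_(x in Omega) F j x)%E = cst 0%E.
    apply/funext => j /=; have /g0 : test_function Omega (boxbump j.+1%:R^-1 (ocube_ineqs (q k) (r k) ++ L)).
      by apply: test_function_boxbump; [rewrite invr_gt0|have [] := HP k Pk].
    move=> E; have := congr1 EFin E; rewrite /inner /Rintegral fineK//.
    apply: integrable_fin_num => //; apply: L2_integrable => //.
    by apply: smooth_L2; apply: smooth_boxbump; rewrite invr_gt0.
  rewrite F0 in C; have := cvg_unique _ C (cvg_cst 0%E) => <-//.
  rewrite [LHS]integral_mkcond [RHS]integral_mkcond; apply: eq_integral => x _.
  rewrite !patchE indicE; case: ifPn => Hx.
    by rewrite mem_set ?mulr1//; move: Hx; rewrite inE => -[/QO].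
  by rewrite mulr0; case: ifP.
have all0 A : measurable A -> (\int[mu]_(x in Q `&` A) (g x)%:E = 0)%E.
  rewrite box_measurable_generated.
  have bQ B : measurable B -> mu.-integrable (Q `&` B) (EFin \o g).
    by move=> mB; apply: integrableS IgQ => //; exact: measurableI.
  (* Complements are handled inside [Q], whose own integral is the case of the empty list of
     half-spaces. *)
  apply: (@dynkin_induction _ _ (range box) (fun A => (\int[mu]_(x in Q `&` A) (g x)%:E = 0)%E)).
  - exact: box_measurable_generated.
  - by move=> _ _ [L1 _ <-] [L2 _ <-]; exists (L1 ++ L2) => //; rewrite box_cat.
  - by have := base [::]; rewrite (_ : box [::] = setT)//; apply/seteqP; split.
  - by move=> _ [L _ <-].
  - move=> B mB B0; have : (\int[mu]_(x in Q) (g x)%:E = 0)%E.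
      by have := base [::]; rewrite (_ : box [::] = setT) ?setIT//; apply/seteqP; split.
    rewrite -{1}(setIT Q) -(setUv B) setIUr integral_setU//=.
    + by rewrite B0 add0e.
    + exact: measurableI.
    + by apply: measurableI => //; exact: measurableC.
    + by rewrite -setIUr setUv setIT; have /integrableP[] := IgQ.
    + by apply/disj_setPS => x [[_ ?] [_]].
  - move=> F mF tF F0; rewrite setI_bigcupr integral_bigcup//.
    + by apply: eseries0 => j _ _; rewrite F0.
    + by apply: trivIset_setIl.
    + by move=> j; exact: measurableI.
    + by rewrite -setI_bigcupr; apply: bQ; exact: bigcup_measurable.
apply: integral_ae_eq => // E EQ mE.
by rewrite integral0 -(all0 E mE); congr (integral _ _ _); rewrite setIidr.
Qed.

End du_Bois_Reymond.

(** * Weak derivatives *)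

(** Replaces passages to the limit: in the density arguments below all errors are collected into one
    multiple of [e]. *)
Lemma ler_small (R : realFieldType) (x K : R) : 0 <= K ->
  (forall e, 0 < e -> x <= K * e) -> x <= 0.
Proof.
move=> K0 H; rewrite leNgt; apply/negP => x0.
have K1 : 0 < K + 1 by rewrite ltr_wpDl.
have := H (x / (K + 1) / 2); rewrite divr_gt0 ?divr_gt0// => /(_ isT).
rewrite -[X in X <= _](divfK (lt0r_neq0 K1) x) => /le_trans => H1.
have : K * (x / (K + 1) / 2) <= (K + 1) * (x / (K + 1) / 2).
  by rewrite ler_wpM2r ?lerDl// divr_ge0// divr_ge0 ?ltW.
move/H1; move: (x / (K + 1)) (divr_gt0 x0 K1) => y y0.
nra.
Qed.

Section sobolev_theory.
Context {R : realType} {N : nat} (Omega : set 'rV[R]_N).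
Hypotheses (oO : open Omega) (bO : bounded_set Omega).
Local Notation fct := ('rV[R]_N -> R).
Local Notation mu := (@lebesgue_rV R N).
Local Notation L2 := (L2 Omega).
Local Notation inner := (inner Omega).
Local Notation norm2 := (norm2 Omega).
Local Notation tf := (test_function Omega).
Local Notation H1 := (H1 Omega).
Local Notation H10 := (H10 Omega).
Local Notation H1norm := (H1norm Omega).
Local Notation wpartial := (wpartial Omega).
Local Notation weak_partial := (weak_partial Omega).
Implicit Types f g h : fct.

Let mO : measurable Omega. Proof. exact: open_measurable_rV. Qed.
Let fO : (mu Omega < +oo)%E. Proof. exact: bounded_measure_lty. Qed.

Lemma ae_eq_sym f g : f = g %[ae mu in Omega] -> g = f %[ae mu in Omega].
Proof. by apply: filterS => x H Ox; rewrite H. Qed.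

Lemma innerDr f g h : L2 f -> L2 g -> L2 h ->
  inner h (fun x => f x + g x) = inner h f + inner h g.
Proof. by move=> *; rewrite innerC innerDl// !(innerC _ h). Qed.

Lemma innerZr (c : R) f h : L2 f -> L2 h -> inner h (fun x => c * f x) = c * inner h f.
Proof. by move=> *; rewrite innerC innerZl// (innerC _ h). Qed.

Lemma L2_lin (c : R) f g : L2 f -> L2 g -> L2 (c *: f + g).
Proof. by move=> Lf Lg; apply: (L2D _ Lg); exact: L2Z. Qed.

Lemma subr_scaleN1 f g : f - g = -1 *: g + f.
Proof. by rewrite scaleN1r addrC. Qed.

Lemma L2B f g : L2 f -> L2 g -> L2 (f - g).
Proof. by move=> Lf Lg; rewrite subr_scaleN1; exact: L2_lin. Qed.

Lemma inner_linl (c : R) f g h : L2 f -> L2 g -> L2 h ->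
  inner (c *: f + g) h = c * inner f h + inner g h.
Proof.
by move=> Lf Lg Lh; rewrite (innerDl mO (L2Z c Lf) Lg Lh) innerZl.
Qed.

Lemma inner_linr (c : R) f g h : L2 f -> L2 g -> L2 h ->
  inner h (c *: f + g) = c * inner h f + inner h g.
Proof. by move=> *; rewrite innerC inner_linl// !(innerC _ h). Qed.

Lemma innerBl f g h : L2 f -> L2 g -> L2 h -> inner (f - g) h = inner f h - inner g h.
Proof.
by move=> *; rewrite subr_scaleN1 inner_linl// mulN1r addrC.
Qed.

Lemma inner0l h : inner (cst 0) h = 0.
Proof.
rewrite /Defs.inner (_ : (fun x => _) = cst 0); last by apply/funext => x; rewrite mul0r.
by rewrite /Rintegral integral0.
Qed.

Lemma L2_sum (I : Type) (s : seq I) (F : I -> fct) :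
  (forall i, L2 (F i)) -> L2 (fun x => \sum_(i <- s) F i x).
Proof.
move=> LF; elim: s => [|i s IH].
  by under eq_fun do rewrite big_nil; exact: L20.
by under eq_fun do rewrite big_cons; exact: L2D.
Qed.

Lemma inner_suml (I : Type) (s : seq I) (F : I -> fct) g :
  (forall i, L2 (F i)) -> L2 g ->
  inner (fun x => \sum_(i <- s) F i x) g = \sum_(i <- s) inner (F i) g.
Proof.
move=> LF Lg; elim: s => [|i s IH].
  by rewrite big_nil; under eq_fun do rewrite big_nil; exact: inner0l.
by rewrite big_cons -IH -innerDl//; [under eq_fun do rewrite big_cons|exact: L2_sum].
Qed.

Lemma norm2D f g : L2 f -> L2 g -> norm2 (f + g) <= norm2 f + norm2 g.
Proof.
move=> Lf Lg; have Lfg : L2 (f + g) by exact: L2D.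
rewrite -ler_sqr ?nnegrE ?addr_ge0 ?norm2_ge0// norm2_sqr//.
rewrite (innerDl mO Lf Lg Lfg) !(innerDr Lf Lg)// sqrrD !norm2_sqr//.
have /(le_trans (ler_norm _)) := inner_CauchySchwarz mO Lf Lg.
rewrite (innerC _ g f); lra.
Qed.

Lemma norm2Z c f : L2 f -> norm2 (c *: f) = `|c| * norm2 f.
Proof.
move=> Lf; have Lcf : L2 (c *: f) by exact: L2Z.
apply/eqP; rewrite -(@eqrXn2 _ 2) ?mulr_ge0 ?norm2_ge0//.
rewrite exprMn !norm2_sqr// real_normK ?num_real//.
rewrite (@innerZl _ _ _ mO c f _ Lf Lcf) (@innerZr c f _ Lf Lf).
by rewrite mulrA expr2.
Qed.

Lemma norm2N f : L2 f -> norm2 (- f) = norm2 f.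
Proof. by move=> Lf; rewrite -scaleN1r norm2Z// normrN1 mul1r. Qed.

Lemma norm2B f g : L2 f -> L2 g -> norm2 (f - g) <= norm2 f + norm2 g.
Proof.
move=> Lf Lg; rewrite -(norm2N Lg); apply: norm2D => //.
by rewrite -scaleN1r; exact: L2Z.
Qed.

Lemma norm2_sqrD f g : L2 f -> L2 g ->
  norm2 (f + g) ^+ 2 <= 2 * norm2 f ^+ 2 + 2 * norm2 g ^+ 2.
Proof.
move=> Lf Lg; apply: (@le_trans _ _ ((norm2 f + norm2 g) ^+ 2)).
  by rewrite lerXn2r ?nnegrE ?addr_ge0 ?norm2_ge0// norm2D.
have := sqr_ge0 (norm2 f - norm2 g); rewrite sqrrB sqrrD; lra.
Qed.

Lemma norm2_ae f g : f = g %[ae mu in Omega] -> norm2 f = norm2 g.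
Proof.
move=> fg; rewrite /Defs.norm2 unlock /=.
have -> // : (\int[mu]_x `|(f \_ Omega x)%:E| `^ 2 = \int[mu]_x `|(g \_ Omega x)%:E| `^ 2)%E.
apply: ae_eq_integralW; apply: filterS fg => x H _ /=.
by rewrite !patchE; case: ifPn => //; rewrite inE => /H ->.
Qed.

Lemma L2_mul_bounded f h M : measurable_fun Omega h -> 0 <= M ->
  (forall x, Omega x -> `|h x| <= M) -> L2 f ->
  L2 (fun x => h x * f x) /\ norm2 (fun x => h x * f x) <= M * norm2 f.
Proof.
move=> mh M0 hM Lf.
have mf := L2_measurable mO Lf.
have If := L2_integrable mO Lf Lf.
have IMf : mu.-integrable Omega (EFin \o (fun x => M ^+ 2 * (f x * f x))).
  by have := integrableZl mO (M ^+ 2) If; congr (_.-integrable _ _); apply/funext.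
have ineq x : Omega x -> (h x * f x) ^+ 2 <= M ^+ 2 * (f x * f x).
  move=> Ox; rewrite exprMn -!expr2 ler_wpM2r ?sqr_ge0//.
  by rewrite -[h x ^+ 2]real_normK ?num_real// lerXn2r ?nnegrE// hM.
have Lhf : L2 (fun x => h x * f x).
  apply: L2_intro => //; first exact: measurable_funM.
  apply: (le_integrable mO _ _ IMf).
    by apply/measurable_EFinP; apply: measurable_funX; exact: measurable_funM.
  move=> x Ox /=; rewrite lee_fin !ger0_norm ?sqr_ge0//; first exact: ineq.
  by rewrite mulr_ge0 ?sqr_ge0// -expr2 sqr_ge0.
split=> //; rewrite -ler_sqr ?nnegrE ?mulr_ge0 ?norm2_ge0// norm2_sqr//.
rewrite exprMn norm2_sqr// /Defs.inner -RintegralZl//.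
by apply: le_Rintegral => //; exact: L2_integrable.
Qed.

Lemma weak_partial_unique i f g g' : weak_partial i f g -> weak_partial i f g' ->
  g = g' %[ae mu in Omega].
Proof.
move=> [Lg Hg] [Lg' Hg'].
have : g - g' = cst 0 %[ae mu in Omega].
  apply: du_Bois_Reymond => //; first exact: L2B.
  move=> phi tphi; have Lphi := test_function_L2 oO bO tphi.
  rewrite innerBl//; apply/eqP; rewrite subr_eq0 -(inj_eq oppr_inj) -Hg// -Hg'//.
move=> H; apply: filterS H => x H Ox.
by apply/eqP; rewrite -subr_eq0; apply/eqP; exact: H.
Qed.

Lemma wpartial_eq i f g : weak_partial i f g -> wpartial i f = g %[ae mu in Omega].
Proof.
move=> fg; apply: (@weak_partial_unique i f) => //.
by rewrite /Defs.wpartial; apply: xgetPex; exists g.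
Qed.

Lemma H1_wpartial i f : H1 f -> weak_partial i f (wpartial i f).
Proof. by move=> [_ /(_ i) fg]; exact: xgetPex. Qed.

Lemma H1_L2 f : H1 f -> L2 f. Proof. by case. Qed.

Lemma wpartial_L2 i f : H1 f -> L2 (wpartial i f).
Proof. by move=> /(H1_wpartial i)[]. Qed.

Lemma weak_partial_lin i (c : R) f1 f2 g1 g2 : L2 f1 -> L2 f2 ->
  weak_partial i f1 g1 -> weak_partial i f2 g2 ->
  weak_partial i (c *: f1 + f2) (c *: g1 + g2).
Proof.
move=> L1 L2' [Lg1 H1'] [Lg2 H2']; split; first exact: L2_lin.
move=> phi tphi; have Lphi := test_function_L2 oO bO tphi.
have Ldphi := test_function_L2 oO bO (test_function_partial i tphi).
by rewrite !inner_linl// H1'// H2'// mulrN opprD.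
Qed.

Lemma H1_lin (c : R) f g : H1 f -> H1 g -> H1 (c *: f + g).
Proof.
move=> Hf Hg; split; first by apply: L2_lin; exact: H1_L2.
move=> i; exists (c *: wpartial i f + wpartial i g).
by apply: weak_partial_lin; (exact: H1_L2 || exact: H1_wpartial).
Qed.

Lemma wpartial_lin i (c : R) f g : H1 f -> H1 g ->
  wpartial i (c *: f + g) = c *: wpartial i f + wpartial i g %[ae mu in Omega].
Proof.
move=> Hf Hg; apply: wpartial_eq.
by apply: weak_partial_lin; (exact: H1_L2 || exact: H1_wpartial).
Qed.

(** The product with a test function is again a test function, so its partial derivative has
    integral 0; the Leibniz rule then is the integration by parts. *)
Lemma test_function_weak_partial i f : tf f -> weak_partial i f (partial i f).
Proof.
move=> tff; have tdf := test_function_partial i tff.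
split; first exact: test_function_L2.
move=> phi tphi; have tdphi := test_function_partial i tphi.
have Lf := test_function_L2 oO bO tff; have Ldf := test_function_L2 oO bO tdf.
have Lphi := test_function_L2 oO bO tphi; have Ldphi := test_function_L2 oO bO tdphi.
apply/eqP; rewrite -subr_eq0 opprK /Defs.inner -RintegralD//; [|exact: L2_integrable..].
have [sf _ _] := tff; have [sphi _ _] := tphi.
have tfM : tf (f * phi) by exact: test_functionM.
have [sM _ _] := tfM.
have pE : partial i (f * phi) = fun x => f x * partial i phi x + partial i f x * phi x.
  apply/funext => x; rewrite /partial deriveM.
  - by rewrite /GRing.scale/= [in X in _ + X]mulrC.
  - exact: (Ck_derivable (sf 1%N)).
  - exact: (Ck_derivable (sphi 1%N)).
have [M HM] := test_function_cube tfM.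
have := @integral_partial_eq0 _ _ (f * phi) i M.
rewrite pE => E; rewrite /Rintegral (_ : integral _ _ _ = 0%E)//.
rewrite -E.
- rewrite integral_mkcond; apply: eq_integral => x _; rewrite patchE.
  case: ifPn => // /negP; rewrite inE => Ox.
  by rewrite (test_function_out tff)// (test_function_out tphi)// mul0r mulr0 addr0.
- by move=> x; exact: (Ck_derivable (sM 1%N)).
- exact: (Ck0 (sM 0%N)).
- by rewrite -pE; exact: (Ck0 (smooth_partial i sM 0%N)).
- exact: HM.
Qed.

Lemma test_function_H1 f : tf f -> H1 f.
Proof.
move=> tff; split; first exact: test_function_L2.
by move=> i; exists (partial i f); exact: test_function_weak_partial.
Qed.

Lemma wpartial_test i f : tf f -> wpartial i f = partial i f %[ae mu in Omega].
Proof. by move=> tff; apply: wpartial_eq; exact: test_function_weak_partial. Qed.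

Lemma H1norm_sqr f : H1norm f ^+ 2 = norm2 f ^+ 2 + \sum_i norm2 (wpartial i f) ^+ 2.
Proof.
rewrite sqr_sqrtr// addr_ge0 ?sqr_ge0//.
by apply: sumr_ge0 => i _; exact: sqr_ge0.
Qed.

Lemma H1norm_ge0 f : 0 <= H1norm f. Proof. exact: sqrtr_ge0. Qed.

Lemma norm2_le_H1norm f : norm2 f <= H1norm f.
Proof.
rewrite -ler_sqr ?nnegrE ?norm2_ge0 ?H1norm_ge0// H1norm_sqr lerDl.
by apply: sumr_ge0 => i _; exact: sqr_ge0.
Qed.

Lemma wpartial_le_H1norm i f : norm2 (wpartial i f) <= H1norm f.
Proof.
rewrite -ler_sqr ?nnegrE ?norm2_ge0 ?H1norm_ge0// H1norm_sqr (bigD1 i)//=.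
rewrite addrCA lerDl addr_ge0 ?sqr_ge0//.
by apply: sumr_ge0 => j _; exact: sqr_ge0.
Qed.

Lemma H1norm_le_H2norm f : H1norm f <= H2norm Omega f.
Proof.
rewrite /H2norm -/(Defs.H1norm _ _) ler_wsqrtr// lerDl.
by apply: sumr_ge0 => i _; apply: sumr_ge0 => j _; exact: sqr_ge0.
Qed.

(** A triangle inequality for the squares, with the loss of a factor 2 that density arguments do not
    see. *)
Lemma H1norm_linD (c : R) f g : H1 f -> H1 g ->
  H1norm (c *: f + g) ^+ 2 <= 2 * c ^+ 2 * H1norm f ^+ 2 + 2 * H1norm g ^+ 2.
Proof.
move=> Hf Hg; rewrite (H1norm_sqr (c *: f + g)) (H1norm_sqr f) (H1norm_sqr g).
have aux f' g' : L2 f' -> L2 g' ->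
    norm2 (c *: f' + g') ^+ 2 <= 2 * c ^+ 2 * norm2 f' ^+ 2 + 2 * norm2 g' ^+ 2.
  move=> Lf Lg; have Lcf : L2 (c *: f') by exact: L2Z.
  apply: le_trans (norm2_sqrD Lcf Lg) _.
  by rewrite norm2Z// exprMn real_normK ?num_real// mulrA.
have := aux f g (H1_L2 Hf) (H1_L2 Hg).
have : \sum_i norm2 (wpartial i (c *: f + g)) ^+ 2 <=
    \sum_i (2 * c ^+ 2 * norm2 (wpartial i f) ^+ 2 + 2 * norm2 (wpartial i g) ^+ 2).
  apply: ler_sum => i _; rewrite (norm2_ae (wpartial_lin i c Hf Hg)).
  by apply: aux; exact: wpartial_L2.
rewrite big_split /= -!mulr_sumr.
move: (\sum_i _) (\sum_i _) (\sum_i _) => x y z.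
move: (norm2 _ ^+ 2) (norm2 _ ^+ 2) (norm2 _ ^+ 2) => x' y' z'.
move: (c ^+ 2) => c2; lra.
Qed.

Lemma H10_H1 f : H10 f -> H1 f. Proof. by case. Qed.

Lemma H10_approx f e : H10 f -> 0 < e -> exists2 phi, tf phi & H1norm (f - phi) < e.
Proof. by move=> [_ H] /H. Qed.

Lemma test_function_H10 f : tf f -> H10 f.
Proof.
move=> tff; split; first exact: test_function_H1.
move=> e e0; exists f => //; have -> : f \- f = cst 0 by apply/funext => x /=; rewrite subrr.
have H0 := test_function_H1 (test_function0 Omega).
have E : 0 *: cst 0 + cst 0 = cst 0 :> fct by rewrite scale0r add0r.
have := H1norm_linD 0 H0 H0; rewrite E expr0n/= mulr0 mul0r add0r.
have c0 : norm2 (cst 0) = 0.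
  by rewrite norm2_inner ?inner0l ?sqrtr0//; exact: L20.
rewrite /Defs.H1norm c0 (_ : \sum_i _ = 0) ?expr0n/= ?addr0 ?sqrtr0//.
apply: big1 => i _; rewrite (norm2_ae (wpartial_test i (test_function0 Omega))).
rewrite (_ : partial i (cst 0) = cst 0) ?c0 ?expr0n//.
by apply/funext => x; exact: derive_cst.
Qed.

Lemma H10_lin (c : R) f g : H10 f -> H10 g -> H10 (c *: f + g).
Proof.
move=> Hf Hg; have H1f := H10_H1 Hf; have H1g := H10_H1 Hg.
split; first exact: H1_lin.
(* Then [c^2 d^2 <= (e/2)^2], and [H1norm_linD] bounds the square of the error by something below
   [2 (e/2)^2 + 2 (e/2)^2 = e^2]. *)
move=> e e0; pose d := e / (2 * (`|c| + 1)).
have c1 : 0 < `|c| + 1 by rewrite ltr_wpDl.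
have d0 : 0 < d by rewrite divr_gt0// mulr_gt0.
have [phi tphi Hphi] := H10_approx Hf d0.
have e20 : 0 < e / 2 by rewrite divr_gt0.
have [psi tpsi Hpsi] := H10_approx Hg e20.
exists (c *: phi + psi).
  by apply: test_functionD => //; exact: test_functionZ.
have -> : (c *: f + g) \- (c *: phi + psi) = c *: (f - phi) + (g - psi).
  by apply/funext => x /=; rewrite !fctE; rewrite /GRing.scale/=; ring.
have HB f' phi' : H1 f' -> tf phi' -> H1 (f' - phi').
  by move=> Hf' /test_function_H1 Hp; rewrite subr_scaleN1; exact: H1_lin.
rewrite -ltr_sqr ?nnegrE ?H1norm_ge0 ?(ltW e0)//.
apply: le_lt_trans (H1norm_linD _ (HB _ _ H1f tphi) (HB _ _ H1g tpsi)) _.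
have h1 : H1norm (f - phi) ^+ 2 < d ^+ 2 by rewrite ltrXn2r ?nnegrE ?H1norm_ge0// ltW.
have h2 : H1norm (g - psi) ^+ 2 < (e / 2) ^+ 2 by rewrite ltrXn2r ?nnegrE ?H1norm_ge0// ltW.
have h3 : c ^+ 2 * d ^+ 2 <= (e / 2) ^+ 2.
  rewrite -exprMn -real_normK ?num_real// lerXn2r ?nnegrE ?(ltW e20)//.
  rewrite normrM (gtr0_norm d0) /d invfM mulrCA [in leRHS]mulrC mulrA mulrCA.
  by rewrite ler_wpM2l ?invr_ge0// ler_pdivrMr// ler_wpM2l ?(ltW e0)// lerDl.
have h4 : c ^+ 2 * H1norm (f - phi) ^+ 2 <= c ^+ 2 * d ^+ 2.
  by rewrite ler_wpM2l ?sqr_ge0// ltW.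
rewrite -mulrA; have -> : e ^+ 2 = 4 * (e / 2) ^+ 2 by field.
lra.
Qed.

Lemma H10B f g : H10 f -> H10 g -> H10 (f - g).
Proof. by move=> Hf Hg; rewrite subr_scaleN1; exact: H10_lin. Qed.

Lemma H1B f g : H1 f -> H1 g -> H1 (f - g).
Proof. by move=> Hf Hg; rewrite subr_scaleN1; exact: H1_lin. Qed.

End sobolev_theory.

(** * The bilinear form of an elliptic operator *)

#[local] Opaque Defs.wpartial Defs.norm2.

Section elliptic_theory.
Context {R : realType} {N : nat} (Omega : set 'rV[R]_N).
Hypotheses (oO : open Omega) (bO : bounded_set Omega) (N_gt0 : (0 < N)%N).
Local Notation fct := ('rV[R]_N -> R).
Local Notation mu := (@lebesgue_rV R N).
Local Notation L2 := (L2 Omega).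
Local Notation inner := (inner Omega).
Local Notation norm2 := (norm2 Omega).
Local Notation tf := (test_function Omega).
Local Notation H1 := (H1 Omega).
Local Notation H10 := (H10 Omega).
Local Notation H1norm := (H1norm Omega).
Local Notation wpartial := (wpartial Omega).
Local Notation weak_partial := (weak_partial Omega).
Implicit Types f g h : fct.

Let mO : measurable Omega. Proof. exact: open_measurable_rV. Qed.

Lemma bounded_compact_closure : compact (closure Omega).
Proof.
have [M M0 OM] := bounded_set_cube bO.
apply: (@subclosed_compact _ _ (@cube R N M)).
- exact: closed_closure.
- by rewrite cube_ccube; exact: compact_ccube.
- have cM : closed (@cube R N M).
    by apply: compact_closed; [exact: norm_hausdorff|rewrite cube_ccube; exact: compact_ccube].
  by have /closure_id -> := cM; exact: closureS.
Qed.

Lemma C1_closure_bounded f : C1_closure Omega f ->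
  measurable_fun Omega f /\ exists2 M, 0 <= M & forall x, closure Omega x -> `|f x| <= M.
Proof.
move=> [cf [cOf _] _]; split; first exact: open_continuous_measurable_rV.
have /compact_bounded[M [Mr HM]] : compact (f @` closure Omega).
  by apply: continuous_compact => //; exact: bounded_compact_closure.
exists (`|M| + 1); first by rewrite addr_ge0.
move=> x Kx; apply: (HM (`|M| + 1)); last by exists x.
by rewrite (le_lt_trans (ler_norm _))// ltrDl.
Qed.

(* [phi^2 = d_i (x_i phi) phi - x_i (d_i phi) phi]; integrate by parts. *)
Lemma poincare_test (i : 'I_N) : exists2 M, 0 <= M &
  forall phi, tf phi -> norm2 phi <= M * norm2 (wpartial i phi).
Proof.
have [M M0 OM] := bounded_set_cube bO; exists (2 * M); first by rewrite mulr_ge0// ltW.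
move=> phi tphi; rewrite (norm2_ae (wpartial_test oO bO i tphi)).
have tdphi := test_function_partial i tphi.
have Lphi := test_function_L2 oO bO tphi; have Ldphi := test_function_L2 oO bO tdphi.
pose X : fct := fun x => x ord0 i.
have sX : smooth setT X by move=> k; exact: Ck_coord.
have tXphi : tf (X * phi) by exact: test_functionM.
have LXphi := test_function_L2 oO bO tXphi.
have bX x : Omega x -> `|X x| <= M by move=> /OM; exact.
have mX : measurable_fun Omega X.
  by apply: measurable_funTS; apply: continuous_measurable_rV; exact: continuous_coord.
have [LXdphi nXdphi] := L2_mul_bounded oO mX (ltW M0) bX Ldphi.
have [_ nXphi] := L2_mul_bounded oO mX (ltW M0) bX Lphi.
have [_ /(_ _ tXphi)] := test_function_weak_partial oO bO i tphi.
have [sphi _ _] := tphi.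
have -> : partial i (X * phi) = 1 *: (fun x => X x * partial i phi x) + phi.
  apply/funext => x; rewrite /partial deriveM.
  - have -> : 'D_(delta_mx ord0 i) X x = 1.
      by have [_ ->] := is_derive_coord i i x; rewrite eqxx.
    by rewrite scale1r !fctE /GRing.scale/= mulr1.
  - exact: (Ck_derivable (sX 1%N)).
  - exact: (Ck_derivable (sphi 1%N)).
rewrite inner_linr// mul1r => E.
have H : norm2 phi ^+ 2 <= 2 * M * norm2 (partial i phi) * norm2 phi.
  rewrite norm2_sqr//; move: E.
  have := inner_CauchySchwarz mO Lphi LXdphi; have := inner_CauchySchwarz mO Ldphi LXphi.
  rewrite !ler_norml => /andP[a1 _] /andP[a2 _] E.
  have b1 : norm2 (partial i phi) * norm2 (X * phi) <= norm2 (partial i phi) * (M * norm2 phi).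
    by rewrite ler_wpM2l ?norm2_ge0.
  have b2 : norm2 phi * norm2 (fun x => X x * partial i phi x) <=
      norm2 phi * (M * norm2 (partial i phi)).
    by rewrite ler_wpM2l ?norm2_ge0.
  move: a1 a2 E b1 b2; move: (inner _ _) (inner _ _) (inner _ _) => x y z.
  move: (norm2 (X * phi)) (norm2 (fun x => _)) (norm2 phi) (norm2 _) => p q r s; lra.
have [->|n0] := eqVneq (norm2 phi) 0; first by rewrite !mulr_ge0 ?norm2_ge0// ltW.
have n1 : 0 < norm2 phi by rewrite lt_def n0 norm2_ge0.
by rewrite -(ler_pM2r n1) -expr2.
Qed.

Lemma poincare : exists2 C, 0 < C & forall f, H10 f ->
  norm2 f ^+ 2 <= C * \sum_i norm2 (wpartial i f) ^+ 2.
Proof.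
pose i := Ordinal N_gt0.
have [M M0 HM] := poincare_test i.
(* The summand 1 makes the constant positive, since [M] may vanish. *)
exists (M ^+ 2 + 1) => [|f Hf]; first by rewrite ltr_wpDl ?sqr_ge0.
have H1f := H10_H1 Hf.
have le1 : norm2 f <= M * norm2 (wpartial i f).
  (* Approximating [f] by a test function within [e] costs [e] on the left and [M e] on the
     right. *)
  rewrite -subr_le0; apply: (@ler_small _ _ (M + 1)); first by rewrite addr_ge0.
  move=> e e0; have [phi tphi Hphi] := H10_approx Hf e0.
  have Hp := test_function_H1 oO bO tphi.
  have H1fp : H1 (f - phi) by exact: H1B.
  have h1 : norm2 f <= norm2 phi + norm2 (f - phi).
    have := norm2D oO (H1_L2 Hp) (H1_L2 H1fp).
    by rewrite addrC subrK.
  have h2 : norm2 (wpartial i phi) <= norm2 (wpartial i f) + norm2 (wpartial i (f - phi)).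
    have E : phi = -1 *: (f - phi) + f by rewrite scaleN1r opprB subrK.
    have wL := wpartial_L2 i H1fp.
    rewrite [in leLHS]E (norm2_ae (wpartial_lin oO bO i _ H1fp H1f)).
    rewrite addrC; apply: le_trans (norm2D oO (wpartial_L2 i H1f) (L2Z _ wL)) _.
    by rewrite norm2Z// normrN1 mul1r.
  have := norm2_le_H1norm Omega (f - phi); have := wpartial_le_H1norm Omega i (f - phi).
  have := HM _ tphi => h3 h4 h5.
  have h6 : M * norm2 (wpartial i phi) <= M * (norm2 (wpartial i f) + e).
    by rewrite ler_wpM2l// (le_trans h2)// lerD2l (le_trans h4)// ltW.
  rewrite mulrDr in h6; rewrite lerBlDr mulrDl mul1r.
  apply: le_trans h1 _; have := le_trans h3 h6; have := le_trans h5 (ltW Hphi).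
  move: (norm2 _) (norm2 _) (M * e) (M * _) => *; lra.
apply: (@le_trans _ _ ((M * norm2 (wpartial i f)) ^+ 2)).
  by rewrite lerXn2r ?nnegrE ?mulr_ge0 ?norm2_ge0.
rewrite exprMn; apply: ler_pM; rewrite ?sqr_ge0 ?lerDl//.
by rewrite (bigD1 i)//= lerDl; apply: sumr_ge0 => j _; exact: sqr_ge0.
Qed.

Section form.
Variables (a : 'I_N -> 'I_N -> fct) (c : fct).
Hypothesis ac : elliptic_coefficients Omega a c.

(** What integration by parts makes of [(A f, g)] when there is no boundary term. As [c <= 0], both
    parts are nonnegative on the diagonal. *)
Definition bform f g : R :=
  \sum_i \sum_j inner (fun x => a i j x * wpartial j f x) (wpartial i g)
  - inner (fun x => c x * f x) g.

Let ma i j : measurable_fun Omega (a i j).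
Proof. by have [/(_ i j)[/C1_closure_bounded[]]] := ac. Qed.

Let mc : measurable_fun Omega c.
Proof. by have [_ /C1_closure_bounded[]] := ac. Qed.

Let sub_closure x : Omega x -> closure Omega x.
Proof. exact: subset_closure. Qed.

Lemma coefficients_bounded : exists2 M, 0 <= M &
  (forall i j x, Omega x -> `|a i j x| <= M) /\ (forall x, Omega x -> `|c x| <= M).
Proof.
have [Ha Hc _ _] := ac.
have /choice[Ma HMa] : forall ij : 'I_N * 'I_N, exists M, 0 <= M /\
    forall x, closure Omega x -> `|a ij.1 ij.2 x| <= M.
  by move=> [i j]; have [/C1_closure_bounded[_ [M M0 HM]] _] := Ha i j; exists M.
have [_ [Mc Mc0 HMc]] := C1_closure_bounded Hc.
exists (Mc + \sum_ij Ma ij).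
  by rewrite addr_ge0// sumr_ge0// => ij _; have [] := HMa ij.
split=> [i j x Ox|x Ox].
  have [_ /(_ x (sub_closure Ox)) /= h] := HMa (i, j).
  apply: (le_trans h); rewrite (bigD1 (i, j))//= addrCA lerDl addr_ge0// sumr_ge0//.
  by move=> ij _; have [] := HMa ij.
apply: (le_trans (HMc x (sub_closure Ox))); rewrite lerDl sumr_ge0//.
by move=> ij _; have [] := HMa ij.
Qed.

Lemma L2_aw i j f : L2 f -> L2 (fun x => a i j x * f x).
Proof.
move=> Lf; have [M M0 [HM _]] := coefficients_bounded.
by have [] := L2_mul_bounded oO (ma i j) M0 (HM i j) Lf.
Qed.

Lemma L2_cw f : L2 f -> L2 (fun x => c x * f x).
Proof.
move=> Lf; have [M M0 [_ HM]] := coefficients_bounded.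
by have [] := L2_mul_bounded oO mc M0 HM Lf.
Qed.

Lemma bform_sym f g : H1 f -> H1 g -> bform f g = bform g f.
Proof.
move=> Hf Hg; have [Ha _ _ _] := ac; rewrite /bform [in RHS]exchange_big /=.
apply: (f_equal2 (fun x y => x - y)).
  apply: eq_bigr => i _; apply: eq_bigr => j _.
  rewrite /Defs.inner; apply: eq_Rintegral => x; rewrite inE => Ox.
  have [_ ->] := Ha j i; last exact: sub_closure.
  by move: (wpartial _ _ _) (wpartial _ _ _) => y z; rewrite mulrAC.
rewrite /Defs.inner; apply: eq_Rintegral => x _.
by move: (f x) (g x) => y z; rewrite mulrAC.
Qed.

Lemma bform_linl (k : R) f1 f2 g : H1 f1 -> H1 f2 -> H1 g ->
  bform (k *: f1 + f2) g = k * bform f1 g + bform f2 g.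
Proof.
move=> H1f H2f Hg; rewrite /bform mulrBr.
have -> : inner (fun x => c x * (k *: f1 + f2) x) g =
    k * inner (fun x => c x * f1 x) g + inner (fun x => c x * f2 x) g.
  rewrite -inner_linl//; [|exact/L2_cw/H1_L2..|exact: H1_L2].
  by apply: eq_Rintegral => x _; rewrite !fctE /GRing.scale/=; ring.
rewrite opprD addrACA; congr (_ + _).
rewrite mulr_sumr -big_split; apply: eq_bigr => i _ /=.
rewrite mulr_sumr -big_split; apply: eq_bigr => j _ /=.
rewrite -inner_linl//; [|exact/L2_aw/wpartial_L2..|exact: wpartial_L2].
apply: inner_ae; last exact: nearW.
apply: filterS (wpartial_lin oO bO j k H1f H2f) => x /[swap] Ox /(_ Ox) ->.
by rewrite !fctE /GRing.scale/=; ring.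
Qed.

Lemma bform_linr (k : R) f1 f2 g : H1 f1 -> H1 f2 -> H1 g ->
  bform g (k *: f1 + f2) = k * bform g f1 + bform g f2.
Proof.
move=> H1f H2f Hg; have Hl : H1 (k *: f1 + f2) by exact: H1_lin.
by rewrite bform_sym// bform_linl// !(bform_sym Hg).
Qed.

Lemma bform_lower : exists2 kappa, 0 < kappa & forall f, H1 f ->
  kappa * \sum_i norm2 (wpartial i f) ^+ 2 <= bform f f.
Proof.
have [_ _ c0 [kappa kappa0 Hk]] := ac; exists kappa => // f Hf.
have Lw i := wpartial_L2 i Hf.
rewrite /bform -subr_ge0.
have I1 : mu.-integrable Omega (EFin \o (fun x => \sum_i \sum_j
    (a i j x * wpartial j f x) * wpartial i f x)).
  rewrite (_ : EFin \o _ = (fun x => \sum_i \sum_j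
    ((a i j x * wpartial j f x) * wpartial i f x)%:E)%E); last first.
    by apply/funext => x /=; rewrite -sumEFin; apply: eq_bigr => i _; rewrite -sumEFin.
  apply: integrable_sum => // i _; apply: integrable_sum => // j _.
  by apply: L2_integrable => //; exact: L2_aw.
have I2 : mu.-integrable Omega (EFin \o (fun x => (c x * f x) * f x)).
  by apply: L2_integrable => //; [exact/L2_cw/H1_L2|exact: H1_L2].
have I3 : mu.-integrable Omega (EFin \o (fun x => \sum_i wpartial i f x * wpartial i f x)).
  rewrite (_ : EFin \o _ = (fun x => \sum_i (wpartial i f x * wpartial i f x)%:E)%E); last first.
    by apply/funext => x /=; rewrite -sumEFin.
  by apply: integrable_sum => // i _; exact: L2_integrable.
have Rsum (I : Type) (s : seq I) (F : I -> fct) :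
    (forall i, mu.-integrable Omega (EFin \o F i)) ->
    \sum_(i <- s) \int[mu]_(x in Omega) F i x = \int[mu]_(x in Omega) \sum_(i <- s) F i x.
  move=> IF; elim: s => [|i s IH].
    by rewrite big_nil; under eq_Rintegral do rewrite big_nil; rewrite /Rintegral integral0.
  rewrite big_cons IH -RintegralD//; first by apply: eq_Rintegral => x _; rewrite big_cons.
  rewrite (_ : EFin \o _ = (fun x => \sum_(i <- s) (F i x)%:E)%E); last first.
    by apply/funext => x /=; rewrite -sumEFin.
  by apply: integrable_sum => // k _; exact: IF.
have -> : \sum_i norm2 (wpartial i f) ^+ 2 =
    \int[mu]_(x in Omega) \sum_i wpartial i f x * wpartial i f x.
  rewrite -Rsum; last by move=> i; exact: L2_integrable.
  by apply: eq_bigr => i _; rewrite norm2_sqr.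
have -> : \sum_i \sum_j inner (fun x => a i j x * wpartial j f x) (wpartial i f) =
    \int[mu]_(x in Omega) \sum_i \sum_j (a i j x * wpartial j f x) * wpartial i f x.
  rewrite -Rsum; last first.
    move=> i; rewrite (_ : EFin \o _ = (fun x => \sum_j
      ((a i j x * wpartial j f x) * wpartial i f x)%:E)%E); last first.
      by apply/funext => x /=; rewrite -sumEFin.
    by apply: integrable_sum => // j _; apply: L2_integrable => //; exact: L2_aw.
  apply: eq_bigr => i _; rewrite -Rsum// => j.
  by apply: L2_integrable => //; exact: L2_aw.
rewrite subr_ge0 -RintegralZl// -RintegralB//.
apply: le_Rintegral => //.
- by have := integrableZl mO kappa I3; congr (_.-integrable _ _); apply/funext.
- by have := integrableB mO I1 I2; congr (_.-integrable _ _); apply/funext.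
move=> x Ox; have := Hk x (sub_closure Ox) (\row_i wpartial i f x).
under eq_bigr do rewrite mxE expr2.
under [in X in _ <= X -> _]eq_bigr do under eq_bigr do rewrite !mxE mulrAC.
move/le_trans; apply; rewrite lerBrDr gerDl -mulrA -expr2.
by rewrite mulr_le0_ge0 ?sqr_ge0// c0//; exact: sub_closure.
Qed.

Lemma bform_ge0 f : H1 f -> 0 <= bform f f.
Proof.
move=> Hf; have [k k0 /(_ f Hf)] := bform_lower; apply: le_trans.
by rewrite mulr_ge0 ?(ltW k0)// sumr_ge0// => i _; rewrite sqr_ge0.
Qed.

(** Ellipticity bounds the gradient by the form, and Poincare's inequality bounds the function by
    the gradient. This constant drives all later estimates in place of a first eigenvalue. *)
Lemma bform_coercive : exists2 C, 0 < C & forall f, H10 f -> norm2 f ^+ 2 <= C * bform f f.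
Proof.
have [k k0 Hk] := bform_lower; have [C C0 HC] := poincare.
exists (C / k) => [|f Hf]; first exact: divr_gt0.
apply: le_trans (HC f Hf) _; rewrite -mulrA ler_pM2l// mulrC ler_pdivlMr// mulrC.
exact/Hk/H10_H1.
Qed.

Lemma bform_bounded : exists2 C, 0 <= C & forall f, H1 f -> bform f f <= C * H1norm f ^+ 2.
Proof.
have [M M0 [HMa HMc]] := coefficients_bounded.
exists (\sum_(i < N) \sum_(j < N) M + M).
  by rewrite addr_ge0// sumr_ge0// => i _; rewrite sumr_ge0.
move=> f Hf; rewrite /bform mulrDl; apply: lerD.
  rewrite mulr_suml; apply: ler_sum => i _; rewrite mulr_suml; apply: ler_sum => j _.
  have Lw := wpartial_L2 j Hf; have Lw' := wpartial_L2 i Hf.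
  apply: (le_trans (ler_norm _)); apply: le_trans (inner_CauchySchwarz mO (L2_aw i j Lw) Lw') _.
  have [_ h] := L2_mul_bounded oO (ma i j) M0 (HMa i j) Lw.
  rewrite expr2 mulrA; apply: ler_pM; rewrite ?norm2_ge0 ?wpartial_le_H1norm//.
  by apply: (le_trans h); rewrite ler_wpM2l// wpartial_le_H1norm.
rewrite -[leLHS]add0r -[leLHS]addrC; rewrite addr0.
apply: (le_trans (ler_norm _)); rewrite normrN.
apply: le_trans (inner_CauchySchwarz mO (L2_cw (H1_L2 Hf)) (H1_L2 Hf)) _.
have [_ h] := L2_mul_bounded oO mc M0 HMc (H1_L2 Hf).
rewrite expr2 mulrA; apply: ler_pM; rewrite ?norm2_ge0 ?norm2_le_H1norm//.
by apply: (le_trans h); rewrite ler_wpM2l// norm2_le_H1norm.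
Qed.

Lemma bform_quad (t : R) f g : H1 f -> H1 g ->
  bform (t *: g + f) (t *: g + f) = bform f f + (bform f g *+ 2) * t + bform g g * t ^+ 2.
Proof.
move=> Hf Hg; have Hl : H1 (t *: g + f) by exact: H1_lin.
rewrite bform_linl// !bform_linr// (bform_sym Hg Hf); ring.
Qed.

Lemma bform_CauchySchwarz f g : H1 f -> H1 g -> bform f g ^+ 2 <= bform f f * bform g g.
Proof.
move=> Hf Hg; apply: quadratic_ge0_CauchySchwarz; rewrite ?bform_ge0// => t.
by rewrite -bform_quad//; apply: bform_ge0; exact: H1_lin.
Qed.

(** By Cauchy-Schwarz for the form, the bound on the diagonal is enough. *)
Lemma bform_H1norm : exists2 C, 0 <= C & forall f g, H1 f -> H1 g ->
  `|bform f g| <= C * H1norm f * H1norm g.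
Proof.
have [C C0 HC] := bform_bounded; exists C => // f g Hf Hg.
rewrite -ler_sqr ?nnegrE ?mulr_ge0 ?H1norm_ge0// real_normK ?num_real//.
apply: le_trans (bform_CauchySchwarz Hf Hg) _.
have -> : (C * H1norm f * H1norm g) ^+ 2 = (C * H1norm f ^+ 2) * (C * H1norm g ^+ 2).
  by move: (H1norm f) (H1norm g) => x y; ring.
by apply: ler_pM; rewrite ?bform_ge0 ?HC.
Qed.

(** For test functions this is the definition of the weak derivatives [G i]. Both sides are
    continuous in [H1norm], which extends it to the closure of the test functions. *)
Lemma elliptic_green w h eta : elliptic Omega a c w h -> H10 eta ->
  inner h eta = bform w eta.
Proof.
move=> [[[H1w _] H10w] [G [HG hE]]] Heta.
(* [h] is given by this formula only almost everywhere; [h'] is a representative visibly in L^2. *)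
pose h' : fct := -1 *: (fun x => \sum_i G i x) - (fun x => c x * w x).
have LG i : L2 (G i) by have [] := HG i.
have LsG : L2 (fun x => \sum_i G i x) by exact: L2_sum.
have Lc : L2 (fun x => c x * w x) by exact/L2_cw/H1_L2.
have Lh' : L2 h'.
  by apply: L2B => //; exact: L2Z.
have hh' : h = h' %[ae mu in Omega].
  by apply: filterS hE => x H Ox; rewrite H// /h' scaleN1r.
have green phi : tf phi -> inner h' phi = bform w phi.
  move=> tphi; have Lphi := test_function_L2 oO bO tphi.
  rewrite /h' innerBl//; last exact: L2Z.
  rewrite (@innerZl _ _ _ mO (-1) _ _ LsG Lphi) mulN1r /bform; congr (_ - _).
  rewrite inner_suml// -sumrN; apply: eq_bigr => i _.
  have [_ /(_ phi tphi) E] := HG i; rewrite -E.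
  rewrite inner_suml//; last 2 first.
  - by move=> j; exact/L2_aw/wpartial_L2.
  - exact: (test_function_L2 oO bO (test_function_partial i tphi)).
  apply: eq_bigr => j _; apply: inner_ae; first exact: nearW.
  exact/ae_eq_sym/wpartial_test.
rewrite (inner_ae hh' (_ : eta = eta %[ae mu in Omega])); last exact: nearW.
have [C C0 HC] := bform_H1norm.
have H1eta := H10_H1 Heta.
apply/eqP; rewrite -subr_eq0 -normr_le0.
apply: (@ler_small _ _ (norm2 h' + C * H1norm w)).
  by rewrite addr_ge0 ?norm2_ge0// mulr_ge0 ?H1norm_ge0.
move=> e e0; have [phi tphi Hphi] := H10_approx Heta e0.
have Hp := test_function_H1 oO bO tphi.
have Hd : H1 (eta - phi) by exact: H1B.
have E : eta = 1 *: (eta - phi) + phi by rewrite scale1r subrK.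
have -> : inner h' eta - bform w eta = inner h' (eta - phi) - bform w (eta - phi).
  have -> : inner h' eta = inner h' (eta - phi) + inner h' phi.
    by rewrite {1}E inner_linr ?mul1r//; exact: H1_L2.
  have -> : bform w eta = bform w (eta - phi) + bform w phi.
    by rewrite {1}E bform_linr ?mul1r.
  by rewrite (green phi tphi) opprD addrACA subrr addr0.
apply: (le_trans (ler_normB _ _)); rewrite mulrDl; apply: lerD.
  apply: le_trans (inner_CauchySchwarz mO Lh' (H1_L2 Hd)) _.
  by rewrite ler_wpM2l ?norm2_ge0// (le_trans (norm2_le_H1norm _ _))// ltW.
apply: (le_trans (HC _ _ H1w Hd)).
by rewrite ler_wpM2l ?mulr_ge0 ?H1norm_ge0// ltW.
Qed.

Definition energy (lambda : R) f : R := lambda * inner f f + bform f f.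

Lemma energy_ge0 lambda f : 0 <= lambda -> H1 f -> 0 <= energy lambda f.
Proof. by move=> l0 Hf; rewrite addr_ge0 ?bform_ge0// mulr_ge0 ?inner_ge0. Qed.

Lemma inner_quad (t : R) f g : L2 f -> L2 g ->
  inner (t *: g + f) (t *: g + f) = inner f f + (inner f g *+ 2) * t + inner g g * t ^+ 2.
Proof.
move=> Hf Hg; have Hl : L2 (t *: g + f) by exact: L2_lin.
rewrite inner_linl// !inner_linr// (innerC _ g f); ring.
Qed.

Lemma energy_quad lambda (t : R) f g : H1 f -> H1 g ->
  energy lambda (t *: g + f) = energy lambda f +
    ((lambda * inner f g + bform f g) *+ 2) * t + energy lambda g * t ^+ 2.
Proof.
move=> Hf Hg; rewrite /energy bform_quad// inner_quad//; [ring|exact: H1_L2..].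
Qed.

(* An almost minimiser of the energy functional solves the equation
   [(lambda + A) phi = psi] weakly up to a small error; no minimiser, hence no
   completeness of H^1_0, is needed. *)
Lemma approximate_solution psi : L2 psi -> exists2 C, 0 <= C &
  forall lambda delta, 0 <= lambda -> 0 < delta -> exists phi,
    [/\ tf phi, norm2 phi <= C &
        forall eta, H10 eta ->
          (lambda * inner phi eta + bform phi eta - inner psi eta) ^+ 2 <=
          delta * energy lambda eta].
Proof.
move=> Lpsi; have [K K0 HK] := bform_coercive.
(* With [n = norm2 phi], near-minimality gives [J phi <= J 0 + eps <= 1], while coercivity gives
   [n^2 / (2 K) - norm2 psi * n <= J phi]; together they keep [n] below this constant. Only the
   coercivity of [bform] enters, so [lambda] does not occur in it. *)
exists (2 * K * norm2 psi + 2 * K + 1).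
  by rewrite !addr_ge0 ?mulr_ge0 ?norm2_ge0// ltW.
move=> lambda delta l0 d0.
pose J f := energy lambda f / 2 - inner psi f.
have Jlow f : H10 f -> norm2 f ^+ 2 / (2 * K) - norm2 psi * norm2 f <= J f.
  move=> Hf; have Hf1 := H10_H1 Hf; rewrite /J; apply: lerB.
    rewrite ler_pdivrMr ?mulr_gt0//.
    have -> : energy lambda f / 2 * (2 * K) = K * energy lambda f by field.
    apply: le_trans (HK _ Hf) _; rewrite ler_wpM2l ?(ltW K0)//.
    by rewrite /energy lerDr mulr_ge0 ?inner_ge0.
  exact: le_trans (ler_norm _) (inner_CauchySchwarz mO Lpsi (H1_L2 Hf1)).
pose S := [set J phi | phi in tf].
have S0 : S (J (cst 0)) by exists (cst 0) => //; exact: test_function0.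
have Slb : has_lbound S.
  exists (- (K * norm2 psi ^+ 2 / 2)) => _ [phi tphi <-].
  apply: le_trans (Jlow _ (test_function_H10 oO bO tphi)).
  rewrite -subr_ge0.
  (* Completing the square in the lower bound of [J]. *)
  rewrite (_ : _ - _ = (norm2 phi - K * norm2 psi) ^+ 2 / (2 * K)); last by field; rewrite gt_eqF.
  by rewrite divr_ge0 ?sqr_ge0// mulr_ge0// ltW.
(* The 1 serves the bound on [norm2 phi], and [delta / 2] the bound on the residual. *)
pose eps := Num.min 1 (delta / 2).
have e0 : 0 < eps by rewrite lt_min ltr01 divr_gt0.
have [_ [phi tphi <-] Jphi] := inf_adherent e0 (conj (ex_intro _ _ S0) Slb).
have Hp := test_function_H1 oO bO tphi.
have Jmin xi : tf xi -> J phi - eps <= J xi.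
  move=> txi; rewrite lerBlDr; apply: le_trans (ltW Jphi) _; rewrite lerD2r.
  by apply: ge_inf => //; exists xi.
have J0 : J (cst 0) = 0.
  have H0 := test_function_H1 oO bO (test_function0 Omega).
  rewrite /J /energy inner0l mulr0 add0r innerC inner0l subr0.
  have := bform_linl (-1) H0 H0 H0; rewrite scaleN1r addNr => ->.
  by rewrite mulN1r addNr mul0r.
have test eta : tf eta ->
    (lambda * inner phi eta + bform phi eta - inner psi eta) ^+ 2 <= delta * energy lambda eta.
  move=> teta; have He := test_function_H1 oO bO teta.
  set L := _ - _.
  (* Since [J (phi + t eta) >= J phi - eps] for all [t], the polynomial
     [eps + L t + (energy lambda eta / 2) t^2] is nonnegative; this is its discriminant
     inequality. *)
  have : (L / 2) ^+ 2 <= eps * (energy lambda eta / 2).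
    apply: quadratic_ge0_CauchySchwarz; first exact: ltW.
      by rewrite divr_ge0 ?energy_ge0.
    move=> t; have ttest : tf (t *: eta + phi).
      by apply: test_functionD => //; exact: test_functionZ.
    have := Jmin _ ttest; rewrite /J energy_quad// inner_linr//; [|exact: H1_L2..].
    rewrite /L; move: (inner _ _) (inner _ _) (inner _ _) (bform _ _) (energy _ _) (energy _ _).
    move=> x y z p q r; lra.
  rewrite expr_div_n => H.
  have E0 := energy_ge0 l0 He.
  have : eps * energy lambda eta <= delta / 2 * energy lambda eta.
    by rewrite ler_wpM2r// ge_min lexx orbT.
  move: H; rewrite mulrA; move: (L ^+ 2) (eps * _) (delta) => x y d.
  by rewrite (_ : d / 2 * _ = d * energy lambda eta / 2); [lra|ring].
exists phi; split=> //.
- have := Jlow _ (test_function_H10 oO bO tphi).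
  have := Jmin _ (test_function0 Omega); rewrite J0 => h1 h2.
  have e1 : eps <= 1 by rewrite ge_min lexx.
  have {h1 h2 e1} : norm2 phi ^+ 2 / (2 * K) - norm2 psi * norm2 phi <= 1.
    by apply: (le_trans h2); move: h1 e1; rewrite subr_le0; exact: le_trans.
  rewrite lerBlDr ler_pdivrMr ?mulr_gt0//.
  have := norm2_ge0 Omega phi; have := norm2_ge0 Omega psi.
  move: (norm2 phi) (norm2 psi) => n m m0 n0 H.
  rewrite leNgt; apply/negP => H2.
  have n1 : 1 < n by apply: le_lt_trans H2; rewrite lerDr addr_ge0 ?mulr_ge0// ltW.
  have : n * (2 * K * m + 2 * K + 1) < n ^+ 2.
    by rewrite expr2 ltr_pM2l// (lt_trans _ n1).
  have : 2 * K <= 2 * K * n by rewrite ler_peMr ?mulr_ge0 ?ltW.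
  rewrite (_ : n * _ = m * n * (2 * K) + 2 * K * n + n); last ring.
  by rewrite mulrDl mul1r in H; move: H n1; lra.
- move=> eta Heta; have He := H10_H1 Heta.
  set s := Num.sqrt delta.
  set L := fun eta => lambda * inner phi eta + bform phi eta - inner psi eta.
  have Llin (k : R) f g : H1 f -> H1 g -> L (k *: f + g) = k * L f + L g.
    move=> Hf Hg; rewrite /L bform_linr// !inner_linr//; try exact: H1_L2.
    by ring.
  have [C C0 HC] := bform_H1norm.
  pose CL := lambda * norm2 phi + C * H1norm phi + norm2 psi.
  have LC f : H1 f -> `|L f| <= CL * H1norm f.
    move=> Hf; rewrite /L; apply: (le_trans (ler_normB _ _)); rewrite /CL mulrDl.
    have a1 := inner_CauchySchwarz mO (H1_L2 Hp) (H1_L2 Hf).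
    have a2 := inner_CauchySchwarz mO Lpsi (H1_L2 Hf).
    have n1 := norm2_le_H1norm Omega f.
    apply: lerD; last by apply: (le_trans a2); rewrite ler_wpM2l ?norm2_ge0.
    apply: (le_trans (ler_normD _ _)); rewrite mulrDl; apply: lerD; last exact: HC.
    rewrite normrM (ger0_norm l0) -mulrA ler_wpM2l// (le_trans a1)//.
    by rewrite ler_wpM2l ?norm2_ge0.
  pose CE := lambda + C.
  have EC f : H1 f -> energy lambda f <= CE * H1norm f ^+ 2.
    move=> Hf; rewrite /energy mulrDl; apply: lerD.
      rewrite ler_wpM2l// -norm2_sqr//; last exact: H1_L2.
      by rewrite lerXn2r ?nnegrE ?norm2_ge0 ?H1norm_ge0// norm2_le_H1norm.
    by have := le_trans (ler_norm _) (HC f f Hf Hf); rewrite -mulrA expr2.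
  have ECS f g : H1 f -> H1 g ->
      (lambda * inner f g + bform f g) ^+ 2 <= energy lambda f * energy lambda g.
    move=> Hf Hg; apply: quadratic_ge0_CauchySchwarz; rewrite ?energy_ge0// => t.
    by rewrite -energy_quad//; apply: energy_ge0 => //; exact: H1_lin.
  have Etri f g : H1 f -> H1 g -> Num.sqrt (energy lambda (1 *: g + f)) <=
      Num.sqrt (energy lambda f) + Num.sqrt (energy lambda g).
    move=> Hf Hg; have E1 := energy_ge0 l0 Hf; have E2 := energy_ge0 l0 Hg.
    have E3 : 0 <= energy lambda (1 *: g + f) by apply: energy_ge0 => //; exact: H1_lin.
    rewrite -ler_sqr ?nnegrE ?addr_ge0 ?sqrtr_ge0// sqrrD !sqr_sqrtr//.
    rewrite energy_quad// expr1n !mulr1 -addrA -[in leRHS]addrA lerD2l lerD2r.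
    rewrite lerMn2r /= -sqrtrM//; apply: (le_trans (ler_norm _)).
    by rewrite -sqrtr_sqr ler_wsqrtr// ECS.
  (* Without the squares both sides obey triangle inequalities, the right one in the energy norm by
     [Etri], so the estimate passes from test functions to their closure. *)
  suff : `|L eta| <= s * Num.sqrt (energy lambda eta).
    move=> H; rewrite -[X in X <= _]real_normK ?num_real//.
    have -> : delta * energy lambda eta = (s * Num.sqrt (energy lambda eta)) ^+ 2.
      by rewrite exprMn !sqr_sqrtr ?(ltW d0) ?energy_ge0.
    by rewrite lerXn2r ?nnegrE ?mulr_ge0 ?sqrtr_ge0.
  rewrite -subr_le0; apply: (@ler_small _ _ (s * Num.sqrt CE + CL)).
    rewrite addr_ge0 ?mulr_ge0 ?sqrtr_ge0// /CL !addr_ge0 ?norm2_ge0 ?mulr_ge0 ?norm2_ge0//.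
    exact: H1norm_ge0.
  move=> e e_gt0; have [xi txi Hxi] := H10_approx Heta e_gt0.
  have Hx := test_function_H1 oO bO txi; have Hd : H1 (eta - xi) by exact: H1B.
  have E : eta = 1 *: (eta - xi) + xi by rewrite scale1r subrK.
  have h1 : `|L eta| <= `|L (eta - xi)| + `|L xi|.
    by rewrite {1}E Llin// mul1r; exact: ler_normD.
  have h2 : `|L xi| <= s * Num.sqrt (energy lambda xi).
    rewrite -sqrtr_sqr -sqrtrM ?(ltW d0)// ler_wsqrtr//; exact: test.
  have E' : xi = 1 *: (-1 *: (eta - xi)) + eta by rewrite scale1r scaleN1r opprB subrK.
  have Hnd : H1 (-1 *: (eta - xi)).
    rewrite scaleN1r opprB; exact: H1B.
  have En : energy lambda (-1 *: (eta - xi)) = energy lambda (eta - xi).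
    have H0 := test_function_H1 oO bO (test_function0 Omega).
    rewrite /energy; have -> : bform (-1 *: (eta - xi)) (-1 *: (eta - xi)) = bform (eta - xi) (eta - xi).
      have := bform_quad (-1) H0 Hd; rewrite addr0 => ->.
      have -> : bform (cst 0) (cst 0) = 0.
        have := bform_linl (-1) H0 H0 H0; rewrite scaleN1r addNr => ->.
        by rewrite mulN1r addNr.
      have -> : bform (cst 0) (eta - xi) = 0.
        have := bform_linl (-1) H0 H0 Hd; rewrite scaleN1r addNr => ->.
        by rewrite mulN1r addNr.
      by ring.
    congr (_ * _ + _); rewrite /Defs.inner; apply: eq_Rintegral => x _.
    by rewrite !fctE /GRing.scale/=; ring.
  have h3 : Num.sqrt (energy lambda xi) <= Num.sqrt (energy lambda eta) + Num.sqrt CE * e.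
    rewrite {1}E'; apply: (le_trans (Etri _ _ He Hnd)); rewrite lerD2l En.
    apply: (@le_trans _ _ (Num.sqrt (CE * H1norm (eta - xi) ^+ 2))).
      by rewrite ler_wsqrtr// EC.
    rewrite sqrtrM ?addr_ge0// sqrtr_sqr ger0_norm ?H1norm_ge0// ler_wpM2l ?sqrtr_ge0//.
    exact: ltW.
  have h4 : `|L (eta - xi)| <= CL * e.
    apply: (le_trans (LC _ Hd)); rewrite ler_wpM2l// ?(ltW Hxi)//.
    by rewrite /CL !addr_ge0 ?norm2_ge0 ?mulr_ge0 ?norm2_ge0 ?H1norm_ge0.
  have h5 : s * Num.sqrt (energy lambda xi) <= s * (Num.sqrt (energy lambda eta) + Num.sqrt CE * e).
    by rewrite ler_wpM2l ?sqrtr_ge0.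
  move: h1 h2 h4 h5; rewrite mulrDr mulrA (mulrDl (s * Num.sqrt CE)).
  move: `|L eta| `|L xi| `|L _| (CL * e) (s * Num.sqrt CE * e).
  move: (s * _) (s * _) => *; lra.
Qed.

End form.
End elliptic_theory.

(** * Power kernels and their Laplace transforms *)

Section one_dimensional.
Context {R : realType}.
Local Notation leb := (@lebesgue_measure R).

Lemma measurable_affine (c d : R) : measurable_fun [set: R] (fun x : R => c * x + d).
Proof.
apply: measurable_funD; last exact: measurable_cst.
by apply: measurable_funM; [exact: measurable_cst|exact: measurable_id].
Qed.

(** By uniqueness of Lebesgue measure it is enough to compare on half-open intervals. A negative [c]
    exchanges the endpoints and the side on which the interval is closed. *)
Lemma lebesgue_affine (c d : R) (A : set R) : c != 0 -> measurable A ->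
  leb A = (`|c|%:E * leb ((fun x => (c * x + d)%R) @^-1` A))%E.
Proof.
move=> c0 mA.
pose nc : {nonneg R} := NngNum (normr_ge0 c).
pose ph := pushforward leb (fun x : R => c * x + d).
pose phm : {measure set (measurableTypeR R) -> \bar R} :=
  @measure_function.measure_function_pushforward__canonical__measure_function_Measure
     _ _ (measurableTypeR R) (measurableTypeR R) _ leb _ (measurable_affine c d).
pose m := mscale nc phm.
rewrite (@lebesgue_measure_unique _ m _ A mA)//.
move=> X /ocitvP[->|[[a b] /= ab ->]]; first by rewrite !measure0.
rewrite /m /mscale /= /phm /= /pushforward.
rewrite lebesgue_measure_itv/= lte_fin ab.
have [c_gt0|c_lt0|/eqP] := ltgtP 0 c; last by rewrite eq_sym (negbTE c0).
  rewrite (_ : _ @^-1` _ = `](a - d) / c, (b - d) / c]%classic); last first.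
    apply/seteqP; split => x /=; rewrite !in_itv/= ltr_pdivrMr// ler_pdivlMr// mulrC;
      by rewrite ltrBlDr lerBrDr.
  rewrite lebesgue_measure_itv/= lte_fin ltr_pM2r ?invr_gt0// ltrD2r ab.
  by rewrite -!EFinB -EFinM gtr0_norm//; congr EFin; field.
rewrite (_ : _ @^-1` _ = `[(b - d) / c, (a - d) / c[%classic); last first.
  apply/seteqP; split => x /=; rewrite !in_itv/= ltr_ndivlMr// ler_ndivrMr// mulrC;
    by rewrite ltrBlDr lerBrDr andbC.
rewrite lebesgue_measure_itv/= lte_fin ltr_nM2r ?invr_lt0// ltrD2r ab.
by rewrite -!EFinB -EFinM ltr0_norm//; congr EFin; field.
Qed.

Lemma ge0_integral_affine (c d : R) (f : R -> \bar R) : c != 0 ->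
  measurable_fun setT f -> (forall x, 0 <= f x)%E ->
  (\int[leb]_x f x = `|c|%:E * \int[leb]_x f (c * x + d)%R)%E.
Proof.
move=> c0 mf f0.
pose nc : {nonneg R} := NngNum (normr_ge0 c).
pose phm : {measure set (measurableTypeR R) -> \bar R} :=
  @measure_function.measure_function_pushforward__canonical__measure_function_Measure
     _ _ (measurableTypeR R) (measurableTypeR R) _ leb _ (measurable_affine c d).
transitivity (\int[mscale nc phm]_x f x)%E.
  apply: eq_measure_integral => A mA _.
  exact: (lebesgue_affine d c0 mA).
rewrite ge0_integral_mscale//; congr (_ * _)%E.
rewrite (@ge0_integral_pushforward _ _ (measurableTypeR R) (measurableTypeR R) _ (fun x : R => c * x + d) _ leb setT f)//.
exact: measurable_affine.
Qed.

Lemma ge0_integral_bigcup_le (F : nat -> set R) (f : R -> \bar R) (K : \bar R) :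
  (forall n, measurable (F n)) -> nondecreasing_seq F ->
  measurable_fun (\bigcup_n F n) f -> (forall x, (\bigcup_n F n) x -> 0 <= f x)%E ->
  (forall n, \int[leb]_(x in F n) f x <= K)%E ->
  (\int[leb]_(x in \bigcup_n F n) f x <= K)%E.
Proof.
move=> mF ndF mf f0 H.
have mfn n : measurable_fun (F n) f.
  apply: measurable_funS mf; first exact: bigcup_measurable.
  exact: bigcup_sup.
have f0n n x : F n x -> (0 <= f x)%E by move=> Fx; apply: f0; exists n.
have C : (\int[leb]_(x in F i) f x)%E @[i --> \oo] -->
    (\int[leb]_(x in \bigcup_n F n) f x)%E.
  exact: ge0_nondecreasing_set_cvg_integral.
rewrite -(cvg_lim _ C)//; apply: lime_le; last exact: nearW.
by apply/cvg_ex; eexists; exact: C.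
Qed.

Lemma integral_powR (q a b : R) : q != 0 -> 0 < a -> a < b ->
  (\int[leb]_(x in `[a, b]) (x `^ (q - 1))%:E = ((b `^ q - a `^ q) / q)%:E)%E.
Proof.
move=> q0 a0 ab.
have pos x : x \in `[a, b] -> 0 < x by rewrite in_itv/= => /andP[ax _]; exact: lt_le_trans ax.
have dq (r x : R) : 0 < x -> derivable (@powR R ^~ r) x 1.
  by move=> x0; apply: derivable_powR; rewrite in_itv/= x0.
have cq (r x : R) : 0 < x -> {for x, continuous (@powR R ^~ r)}.
  by move=> x0; apply/differentiable_continuous/derivable1_diffP/dq.
rewrite (@continuous_FTC2 _ _ (fun x => q^-1 * x `^ q))//.
- by rewrite -EFinB; congr EFin; ring.
- apply: continuous_in_subspaceT => x; rewrite inE/= => /pos; exact: cq.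
- split.
  + move=> x xab; apply: derivableM; first exact: derivable_cst.
    by apply: dq; apply: pos; exact: subset_itv_oo_cc xab.
  + apply: cvgM; first exact: cvg_cst.
    by apply: cvg_at_right_filter; apply: cq.
  + apply: cvgM; first exact: cvg_cst.
    by apply: cvg_at_left_filter; apply: cq; exact: lt_trans ab.
- move=> x xab; have x0 : 0 < x by apply: pos; exact: subset_itv_oo_cc xab.
  rewrite derive1Ml; last exact: dq.
  by rewrite powR_derive1 ?in_itv/= ?x0// mulrA mulVf// mul1r.
Qed.

Lemma integral_powR_01 (q : R) : 0 < q ->
  (\int[leb]_(x in `]0%R, 1%R]) (x `^ (q - 1))%:E <= (q^-1)%:E)%E.
Proof.
(* [n.+2] rather than [n.+1] keeps the endpoints distinct, as [integral_powR] requires. *)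
move=> q0; pose F (n : nat) := `[n.+2%:R^-1, 1%R]%classic : set R.
have FE : `]0, 1]%classic = \bigcup_n F n :> set R.
  apply/seteqP; split => x /=; rewrite in_itv/=; last first.
    move=> [n _]; rewrite /F /= in_itv/= => /andP[nx ->]; rewrite andbT.
    by apply: lt_le_trans nx.
  move=> /andP[x0 x1]; have [n] := @ltr_add_invr R 0 x x0; rewrite add0r => nx.
  exists n => //; rewrite /F /= in_itv/= x1 andbT (le_trans _ (ltW nx))//.
  by rewrite lef_pV2 ?posrE// ler_nat.
rewrite FE; apply: ge0_integral_bigcup_le.
- by move=> n; exact: measurable_itv.
- move=> m n mn; apply/subsetPset => x; rewrite /F/= !in_itv/= => /andP[mx ->].
  by rewrite andbT (le_trans _ mx)// lef_pV2 ?posrE// ler_nat !ltnS.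
- apply: measurable_funTS; apply/measurable_EFinP; exact: measurable_powR.
- by move=> x _; rewrite lee_fin powR_ge0.
- move=> n; rewrite /F integral_powR ?gt_eqF//; last by rewrite invf_lt1// ltr1n.
  by rewrite lee_fin powR1 ler_piMl ?invr_ge0 ?(ltW q0)// gerBl powR_ge0.
Qed.

Lemma integral_powR_1y (q : R) : 0 < q ->
  (\int[leb]_(x in `[1%R, +oo[) (x `^ (- q - 1))%:E <= (q^-1)%:E)%E.
Proof.
move=> q0; pose F (n : nat) := `[1%R, n.+2%:R]%classic : set R.
have FE : `[1, +oo[%classic = \bigcup_n F n :> set R.
  apply/seteqP; split => x /=; rewrite in_itv/= ?andbT; last first.
    by move=> [n _]; rewrite /F /= in_itv/= => /andP[].
  move=> x1; exists (Num.truncn x) => //; rewrite /F/= in_itv/= x1/=.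
  have : x < (Num.truncn x).+1%:R by exact: truncnS_gt.
  by move/ltW/le_trans; apply; rewrite ler_nat.
rewrite FE; apply: ge0_integral_bigcup_le.
- by move=> n; exact: measurable_itv.
- move=> m n mn; apply/subsetPset => x; rewrite /F/= !in_itv/= => /andP[-> mx]/=.
  by rewrite (le_trans mx)// ler_nat !ltnS.
- apply: measurable_funTS; apply/measurable_EFinP; exact: measurable_powR.
- by move=> x _; rewrite lee_fin powR_ge0.
- move=> n; rewrite /F integral_powR ?oppr_eq0 ?gt_eqF// ?ltr1n//.
  rewrite lee_fin powR1 invrN mulrN -mulNr opprB.
  by rewrite ler_piMl ?invr_ge0 ?(ltW q0)// gerBl powR_ge0.
Qed.

Lemma integral_expRN_0y (p : R) : 0 < p ->
  (\int[leb]_(x in `[0%R, +oo[) (expR (- (p * x)))%:E <= (p^-1)%:E)%E.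
Proof.
move=> p0; pose F (n : nat) := `[0%R, n.+1%:R]%classic : set R.
have FE : `[0, +oo[%classic = \bigcup_n F n :> set R.
  apply/seteqP; split => x /=; rewrite in_itv/= ?andbT; last first.
    by move=> [n _]; rewrite /F /= in_itv/= => /andP[].
  move=> x1; exists (Num.truncn x) => //; rewrite /F/= in_itv/= x1/=.
  by rewrite ltW// truncnS_gt.
have me : measurable_fun [set: R] (fun x : R => expR (- (p * x))).
  apply: measurableT_comp; first exact: measurable_expR.
  apply: measurable_funN; apply: measurable_funM; first exact: measurable_cst.
  exact: measurable_id.
have dE (x : R) : is_derive x 1 (fun x : R => - p^-1 * expR (- (p * x))) (expR (- (p * x))).
  have d1 : is_derive x 1 (fun x : R => - (p *: x)) (- (p *: 1)).
    by apply: is_deriveN.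
  have := @is_derive1_comp _ expR (fun x : R => - (p * x)) x _ _ (is_derive_expR _) d1.
  move=> d2; have := is_deriveZ (- p^-1) d2; move=> d3; apply: is_derive_eq d3 _.
  by rewrite /GRing.scale/=; field; rewrite gt_eqF.
have cont (G : R -> R) (dG : R -> R) : (forall x : R, is_derive x 1 G (dG x)) -> continuous G.
  by move=> H x; apply/differentiable_continuous/derivable1_diffP; have [] := H x.
rewrite FE; apply: ge0_integral_bigcup_le.
- by move=> n; exact: measurable_itv.
- move=> m n mn; apply/subsetPset => x; rewrite /F/= !in_itv/= => /andP[-> mx]/=.
  by rewrite (le_trans mx)// ler_nat.
- by apply: measurable_funTS; apply/measurable_EFinP.
- by move=> x _; rewrite lee_fin expR_ge0.
- move=> n; rewrite /F (@continuous_FTC2 _ _ (fun x : R => - p^-1 * expR (- (p * x))))//.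
  + rewrite mulr0 oppr0 expR0 mulr1 -EFinB lee_fin mulNr opprK -subr_ge0 opprD opprK.
    by rewrite addrCA subrr addr0 mulr_ge0 ?expR_ge0// invr_ge0 ltW.
  + apply: continuous_subspaceT => x; apply: continuous_comp; last exact: continuous_expR.
    by apply: cvgN; apply: cvgM; [exact: cvg_cst|exact: cvg_id].
  + split => [x _||].
    * by have [] := dE x.
    * by apply: cvg_at_right_filter; exact: cont dE _.
    * by apply: cvg_at_left_filter; exact: cont dE _.
  + by move=> x _; rewrite derive1E; have [_ ->] := dE x.
Qed.

(** Extension by 0 turns fractional integrals into convolutions over the whole line. The
    normalisation [1 / Gamma a] is left out, and [kern 1] is the indicator of the positive
    half-line. *)
Definition kern (a : R) : R -> R := (fun r => r `^ (a - 1)) \_ `]0%R, +oo[.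

Lemma kernE a r : 0 < r -> kern a r = r `^ (a - 1).
Proof. by move=> r0; rewrite /kern patchE mem_set//= in_itv/= r0. Qed.

Lemma kern_out a r : r <= 0 -> kern a r = 0.
Proof. by move=> r0; rewrite /kern patchE memNset//= in_itv/= andbT ltNge r0. Qed.

Lemma kern_ge0 a r : 0 <= kern a r.
Proof. by have [r0|r0] := ltP 0 r; [rewrite kernE// powR_ge0|rewrite kern_out]. Qed.

Lemma kern_scale a p r : 0 < p -> kern a (p * r) = p `^ (a - 1) * kern a r.
Proof.
move=> p0; have [r0|r0] := ltP 0 r; last by rewrite !kern_out ?mulr0// pmulr_rle0.
by rewrite !kernE ?mulr_gt0// powRM// ltW.
Qed.

Lemma measurable_kern a : measurable_fun setT (kern a).
Proof.
have mI : measurable (`]0%R, +oo[%classic : set R) by [].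
rewrite /kern; apply/(measurable_restrictT _ mI).
by apply: measurable_funTS; exact: measurable_powR.
Qed.

Lemma measurable_laplace_kern a p :
  measurable_fun setT (fun r : R => expR (- (p * r)) * kern a r).
Proof.
apply: measurable_funM; last exact: measurable_kern.
apply: measurableT_comp; first exact: measurable_expR.
apply: measurable_funN; apply: measurable_funM; first exact: measurable_cst.
exact: measurable_id.
Qed.

Definition laplace_kern (a p : R) : \bar R :=
  (\int[leb]_r (expR (- (p * r)) * kern a r)%:E)%E.

Lemma laplace_kern_ge0 a p : (0 <= laplace_kern a p)%E.
Proof. by apply: integral_ge0 => r _; rewrite lee_fin mulr_ge0 ?expR_ge0 ?kern_ge0. Qed.

(** Up to 1 the exponential is at most 1 and the power is integrable; beyond 1 the power is at most
    1 and the exponential is integrable. *)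
Lemma laplace_kern_lty a p : 0 < a <= 1 -> 0 < p -> (laplace_kern a p < +oo)%E.
Proof.
move=> /andP[a0 a1] p0.
have mk := measurable_laplace_kern a p.
rewrite /laplace_kern.
have k0 r : (0 <= (expR (- (p * r)) * kern a r)%:E)%E.
  by rewrite lee_fin mulr_ge0 ?expR_ge0 ?kern_ge0.
have mkE : measurable_fun setT (fun r => (expR (- (p * r)) * kern a r)%:E).
  exact/measurable_EFinP.
have -> : [set: R] = `]-oo, 0%R] `|` (`]0%R, 1%R] `|` `]1%R, +oo[).
  apply/seteqP; split => x //= _; rewrite !in_itv/=.
  have [x0|x0] := leP x 0; first by left.
  by have [x1|x1] := leP x 1; right; [left|right].
rewrite ge0_integral_setU//=; last 3 first.
- exact: measurableU.
- exact: measurable_funTS.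
- apply/disj_setPS => x [/=]; rewrite !in_itv/= => x0 [/andP[x1 _]|]; first by rewrite ltNge x0 in x1.
  by rewrite andbT ltNge (le_trans x0).
rewrite ge0_integral_setU//=; last 2 first.
- exact: measurable_funTS.
- apply/disj_setPS => x [/=]; rewrite !in_itv/= => /andP[x0 x1].
  by rewrite andbT ltNge x1.
rewrite [X in (X + _)%E]integral0_eq ?add0e; last first.
  by move=> x; rewrite /= in_itv/= => x0; rewrite kern_out ?mulr0.
apply: lte_add_pinfty.
- apply: (@le_lt_trans _ _ (a^-1)%:E); last exact: ltry.
  apply: le_trans (integral_powR_01 a0).
  apply: ge0_le_integral => //.
  + exact: measurable_funTS.
  + by apply: measurable_funTS; apply/measurable_EFinP; exact: measurable_powR.
  + move=> x; rewrite /= in_itv/= => /andP[x0 x1]; rewrite lee_fin kernE//.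
    by rewrite ler_piMl ?powR_ge0// -expR0 ler_expR oppr_le0 mulr_ge0// ltW.
- apply: (@le_lt_trans _ _ (p^-1)%:E); last exact: ltry.
  apply: le_trans (integral_expRN_0y p0).
  have me : measurable_fun [set: R] (fun x : R => (expR (- (p * x)))%:E).
    apply/measurable_EFinP; apply: measurableT_comp; first exact: measurable_expR.
    apply: measurable_funN; apply: measurable_funM; first exact: measurable_cst.
    exact: measurable_id.
  apply: (@le_trans _ _ (\int[leb]_(x in `]1%R, +oo[) (expR (- (p * x)))%:E)%E).
    apply: ge0_le_integral => //.
    + exact: measurable_funTS.
    + exact: measurable_funTS.
    + move=> x; rewrite /= in_itv/= andbT => x1; rewrite lee_fin kernE ?(lt_trans _ x1)//.
      rewrite ler_piMr ?expR_ge0// -[leRHS](powRr0 x).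
      by rewrite ler_powR ?(ltW x1)// subr_le0.
  apply: ge0_subset_integral => //.
  + exact: measurable_funTS.
  + move=> x; rewrite /= !in_itv/= !andbT => x1.
    by rewrite (le_trans ler01)// ltW.
Qed.

Lemma Gamma_laplace a : laplace_kern a 1 = (\int[leb]_(t in `]0%R, +oo[) (t `^ (a - 1) * expR (- t))%:E)%E.
Proof.
rewrite /laplace_kern [RHS]integral_mkcond; apply: eq_integral => t _.
rewrite patchE; case: ifPn => [|/negP]; rewrite inE/= in_itv/= andbT.
  by move=> t0; rewrite kernE// mul1r mulrC.
by move=> /negP; rewrite -leNgt => t0; rewrite kern_out ?mulr0.
Qed.

Lemma Gamma_laplaceE a : 0 < a <= 1 -> laplace_kern a 1 = (Gamma a)%:E.
Proof.
move=> a01; rewrite /Gamma /Rintegral -Gamma_laplace fineK// ge0_fin_numE ?laplace_kern_ge0//.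
exact: laplace_kern_lty.
Qed.

(** The substitution [r -> p r] in the integral for [Gamma a], by homogeneity of [kern]. *)
Lemma laplace_kernE (a p : R) : 0 < a <= 1 -> 0 < p ->
  laplace_kern a p = (p `^ (- a) * Gamma a)%:E.
Proof.
move=> a01 p0; have p0' : p != 0 by rewrite gt_eqF.
have m1 := measurable_laplace_kern a 1.
have Ha := @ge0_integral_affine p 0 (fun r => (expR (- (1 * r)) * kern a r)%:E) p0'
  (proj2 (measurable_EFinP _ _) m1) _.
have {Ha} : laplace_kern a 1 = (`|p|%:E *
    \int[leb]_x (expR (- (1 * (p * x + 0))) * kern a (p * x + 0))%:E)%E.
  by apply: Ha => x; rewrite lee_fin mulr_ge0 ?expR_ge0 ?kern_ge0.
rewrite Gamma_laplaceE//.
have E : (\int[leb]_x (expR (- (1 * (p * x + 0))) * kern a (p * x + 0))%:E =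
    (p `^ (a - 1))%:E * laplace_kern a p)%E.
  rewrite -ge0_integralZl_EFin ?powR_ge0//.
  - apply: eq_integral => x _; rewrite addr0 mul1r kern_scale// -EFinM; congr EFin; ring.
  - by move=> x _; rewrite lee_fin mulr_ge0 ?expR_ge0 ?kern_ge0.
  - by apply/measurable_EFinP; exact: measurable_laplace_kern.
move=> H; have {}H : (Gamma a)%:E = ((p `^ a)%:E * laplace_kern a p)%E.
  have /andP[a0 _] := a01.
  by rewrite H E (gtr0_norm p0) -(mulr_powRB1 (ltW p0) a0) EFinM muleA.
have := laplace_kern_lty a01 p0; rewrite -ge0_fin_numE ?laplace_kern_ge0// => fin.
move: H; rewrite -(fineK fin) -EFinM => -[->].
by rewrite mulrA powRN mulVf ?mul1r// gt_eqF// powR_gt0.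
Qed.

Lemma Gamma_gt0 (a : R) : 0 < a <= 1 -> 0 < Gamma a.
Proof.
move=> a01; rewrite -lte_fin -Gamma_laplaceE//.
have e1 : 0 < expR (- 1) :> R by exact: expR_gt0.
apply: (@lt_le_trans _ _ (\int[leb]_(x in `]0%R, 1%R]) (expR (- 1))%:E)%E).
  by rewrite integral_cst//= lebesgue_measure_itv/= lte_fin ltr01 oppr0 adde0 mule1 lte_fin.
apply: (@le_trans _ _ (\int[leb]_(x in `]0%R, 1%R]) (expR (- (1 * x)) * kern a x)%:E)%E).
  apply: ge0_le_integral => //.
  - by apply: measurable_funTS; apply/measurable_EFinP; exact: measurable_laplace_kern.
  - move=> x; rewrite /= in_itv/= => /andP[x0 x1]; rewrite lee_fin kernE// mul1r.
    rewrite -[leLHS]mulr1; apply: ler_pM; [exact: ltW|exact: ler01|by rewrite ler_expR lerN2|].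
    have /andP[_ a1] := a01.
    by rewrite -[leLHS](powRr0 x) ger_powR ?x0// subr_le0.
apply: ge0_subset_integral => //.
- by apply/measurable_EFinP; exact: measurable_laplace_kern.
- by move=> x _; rewrite lee_fin mulr_ge0 ?expR_ge0 ?kern_ge0.
Qed.

End one_dimensional.

(** * Positivity of the fractional kernel and convolutions *)

Section kernel_convolution.
Context {R : realType}.
Local Notation leb := (@lebesgue_measure R).
Local Notation leb2 := (leb \x leb)%E.

Lemma ge0_integral_shift (d : R) (f : R -> \bar R) :
  measurable_fun setT f -> (forall x, 0 <= f x)%E ->
  (\int[leb]_x f (x - d)%R = \int[leb]_x f x)%E.
Proof.
move=> mf f0; rewrite (@ge0_integral_affine _ 1 (- d) f)//= normr1 mul1e.
by apply: eq_integral => x _; rewrite mul1r.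
Qed.

Lemma ge0_integral_reflect (d : R) (f : R -> \bar R) :
  measurable_fun setT f -> (forall x, 0 <= f x)%E ->
  (\int[leb]_x f (d - x)%R = \int[leb]_x f x)%E.
Proof.
move=> mf f0; rewrite (@ge0_integral_affine _ (-1) d f)//= ?oppr_eq0// normrN1 mul1e.
by apply: eq_integral => x _; rewrite mulN1r addrC.
Qed.

Lemma measurable_sub_r (s : R) : measurable_fun [set: R] (fun t : R => t - s).
Proof. by apply: measurable_funB; [exact: measurable_id|exact: measurable_cst]. Qed.

Lemma measurable_sub_l (t : R) : measurable_fun [set: R] (fun s : R => t - s).
Proof. by apply: measurable_funB; [exact: measurable_cst|exact: measurable_id]. Qed.

Lemma measurable_kern2 a d (T : measurableType d) (f g : T -> R) :
  measurable_fun setT f -> measurable_fun setT g ->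
  measurable_fun setT (fun z => kern a (f z - g z)).
Proof.
by move=> mf mg; apply: measurableT_comp; [exact: measurable_kern|exact: measurable_funB].
Qed.

Lemma measurable_fst_R : measurable_fun [set: R * R] (fst : R * R -> R).
Proof. exact: measurable_fst. Qed.

Lemma measurable_snd_R : measurable_fun [set: R * R] (snd : R * R -> R).
Proof. exact: measurable_snd. Qed.

Lemma measurable_comp_fst (f : R -> R) : measurable_fun setT f ->
  measurable_fun [set: R * R] (fun z => f z.1).
Proof. by move=> mf; exact: (measurableT_comp mf measurable_fst_R). Qed.

Lemma measurable_comp_snd (f : R -> R) : measurable_fun setT f ->
  measurable_fun [set: R * R] (fun z => f z.2).
Proof. by move=> mf; exact: (measurableT_comp mf measurable_snd_R). Qed.

Lemma tonelli_swap (F : R -> R -> \bar R) :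
  measurable_fun [set: R * R] (fun z => F z.1 z.2) -> (forall t s, 0 <= F t s)%E ->
  (\int[leb]_t \int[leb]_s F t s = \int[leb]_s \int[leb]_t F t s)%E.
Proof.
move=> mF F0; have := @fubini_tonelli _ _ _ _ _ leb leb (fun z => F z.1 z.2) mF.
by move=> /(_ (fun z => F0 z.1 z.2)).
Qed.

Section positivity.
Variable a : R.
Hypothesis a01 : 0 < a < 1.

Let b := a / 2.

(** What is left of the kernel [K2] below after the substitution [th = s - (t - s) y]. It converges
    at 0 because [b > 0], and at infinity because the integrand is at most
    [y^(2 (b - 1)) = y^(a - 2)] and [a < 1]. *)
Let C : \bar R := (\int[leb]_y (kern b (1 + y) * kern b y)%:E)%E.

Let C_gt0 : (0 < C)%E.
Proof.
have /andP[a0 a1] := a01; rewrite /C.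
have b1 : b - 1 <= 0 by rewrite subr_le0 ler_pdivrMr// mul1r (le_trans (ltW a1))// ler1n.
have m0 : measurable_fun [set: R] (fun y => (kern b (1 + y) * kern b y)%:E).
  apply/measurable_EFinP; apply: measurable_funM; last exact: measurable_kern.
  apply: measurableT_comp; first exact: measurable_kern.
  by apply: measurable_funD; [exact: measurable_cst|exact: measurable_id].
have p2 : 0 < 2 `^ (b - 1) :> R by exact: powR_gt0.
apply: (@lt_le_trans _ _ (\int[leb]_(x in `]0%R, 1%R]) (2 `^ (b - 1))%:E)%E).
  by rewrite integral_cst//= lebesgue_measure_itv/= lte_fin ltr01 oppr0 adde0 mule1 lte_fin.
apply: (@le_trans _ _ (\int[leb]_(y in `]0%R, 1%R]) (kern b (1 + y) * kern b y)%:E)%E).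
  apply: ge0_le_integral => //.
  - exact: measurable_funTS.
  - move=> x; rewrite /= in_itv/= => /andP[x0 x1].
    rewrite lee_fin !kernE// ?addr_gt0// -[leLHS]mulr1; apply: ler_pM; rewrite ?powR_ge0//.
      have [->|b0] := eqVneq b 1; first by rewrite subrr !powRr0.
      rewrite -(opprK (b - 1)) !(powRN _ (- (b - 1))) lef_pV2 ?posrE ?powR_gt0 ?addr_gt0//.
      by apply: ge0_ler_powR; rewrite ?nnegrE ?oppr_ge0 ?addr_ge0 ?(ltW x0)//; rewrite -[leRHS]/(1 + 1) lerD2l.
    by rewrite -[leLHS](powRr0 x) ger_powR ?x0.
apply: ge0_subset_integral => //.
by move=> x _; rewrite lee_fin mulr_ge0 ?kern_ge0.
Qed.

Let C_lty : (C < +oo)%E.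
Proof.
have /andP[a0 a1] := a01; rewrite /C.
have b0 : 0 < b by rewrite divr_gt0.
have b1 : b - 1 <= 0 by rewrite subr_le0 ler_pdivrMr// mul1r (le_trans (ltW a1))// ler1n.
have m0 : measurable_fun [set: R] (fun y => (kern b (1 + y) * kern b y)%:E).
  apply/measurable_EFinP; apply: measurable_funM; last exact: measurable_kern.
  apply: measurableT_comp; first exact: measurable_kern.
  by apply: measurable_funD; [exact: measurable_cst|exact: measurable_id].
have k0 r : (0 <= (kern b (1 + r) * kern b r)%:E)%E by rewrite lee_fin mulr_ge0 ?kern_ge0.
have -> : [set: R] = `]-oo, 0%R] `|` (`]0%R, 1%R] `|` `]1%R, +oo[).
  apply/seteqP; split => x //= _; rewrite !in_itv/=.
  have [x0|x0] := leP x 0; first by left.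
  by have [x1|x1] := leP x 1; right; [left|right].
rewrite ge0_integral_setU//=; last 3 first.
- exact: measurableU.
- exact: measurable_funTS.
- apply/disj_setPS => x [/=]; rewrite !in_itv/= => x0 [/andP[x1 _]|]; first by rewrite ltNge x0 in x1.
  by rewrite andbT ltNge (le_trans x0).
rewrite ge0_integral_setU//=; last 2 first.
- exact: measurable_funTS.
- apply/disj_setPS => x [/=]; rewrite !in_itv/= => /andP[x0 x1].
  by rewrite andbT ltNge x1.
rewrite [X in (X + _)%E]integral0_eq ?add0e; last first.
  by move=> x; rewrite /= in_itv/= => x0; rewrite (kern_out b x0) mulr0.
have pw (x : R) : 0 < x -> (1 + x) `^ (b - 1) <= x `^ (b - 1).
  move=> x0; rewrite -(opprK (b - 1)) !(powRN _ (- (b - 1))) lef_pV2 ?posrE ?powR_gt0 ?addr_gt0//.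
  by apply: ge0_ler_powR; rewrite ?nnegrE ?oppr_ge0 ?addr_ge0 ?(ltW x0)// lerDr.
have pw1 (x : R) : 0 < x -> (1 + x) `^ (b - 1) <= 1.
  move=> x0; rewrite -[leRHS](powRr0 (1 + x)) ler_powR// lerDl ltW//.
have mp q (A : set R) : measurable_fun A (fun y : R => (y `^ q)%:E).
  by apply: measurable_funTS; apply/measurable_EFinP; exact: measurable_powR.
apply: lte_add_pinfty.
- apply: (@le_lt_trans _ _ (b^-1)%:E); last exact: ltry.
  apply: le_trans (integral_powR_01 b0).
  apply: ge0_le_integral => //.
  + exact: measurable_funTS.
  + exact: mp.
  + move=> x; rewrite /= in_itv/= => /andP[x0 x1]; rewrite lee_fin !kernE// ?addr_gt0//.
    by rewrite ler_piMl ?powR_ge0// pw1.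
- have a1' : 0 < 1 - a by rewrite subr_gt0.
  apply: (@le_lt_trans _ _ ((1 - a)^-1)%:E); last exact: ltry.
  apply: le_trans (integral_powR_1y a1').
  apply: (@le_trans _ _ (\int[leb]_(x in `]1%R, +oo[) (x `^ (- (1 - a) - 1))%:E)%E).
    apply: ge0_le_integral => //.
    + exact: measurable_funTS.
    + exact: mp.
    + move=> x; rewrite /= in_itv/= andbT => x1; have x0 : 0 < x by exact: lt_trans x1.
      rewrite lee_fin !kernE// ?addr_gt0//.
      have -> : - (1 - a) - 1 = (b - 1) + (b - 1) by rewrite /b; field.
      rewrite (@powRD _ x (b - 1) (b - 1)) ?(gt_eqF x0) ?implybT//.
      by rewrite ler_wpM2r ?powR_ge0// pw.
  apply: ge0_subset_integral => //.
  - exact: mp.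
  - by move=> x _; rewrite lee_fin powR_ge0.
  - by move=> x; rewrite /= !in_itv/= !andbT => /ltW.
Qed.

(* With [b = a / 2], [K2 t s] is a multiple of [|t - s|^(a - 1)]: this factorisation
   exhibits the kernel as positive definite. *)
Let K2 (t s : R) : \bar R := (\int[leb]_th (kern b (t - th) * kern b (s - th))%:E)%E.

Let K2_lt (t s : R) : s < t -> K2 t s = (C * (kern a (t - s))%:E)%E.
Proof.
move=> st; have ts : 0 < t - s by rewrite subr_gt0.
have c0 : - (t - s) != 0 by rewrite oppr_eq0 gt_eqF.
rewrite /K2 (@ge0_integral_affine _ (- (t - s)) s)//; last 2 first.
- by apply/measurable_EFinP; apply: measurable_funM; apply: measurable_kern2.
- by move=> x; rewrite lee_fin mulr_ge0 ?kern_ge0.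
have E x : (kern b (t - (- (t - s) * x + s)) * kern b (s - (- (t - s) * x + s)))%:E =
    (((t - s) `^ (b - 1) * (t - s) `^ (b - 1))%:E * (kern b (1 + x) * kern b x)%:E)%E.
  have -> : t - (- (t - s) * x + s) = (t - s) * (1 + x) by ring.
  have -> : s - (- (t - s) * x + s) = (t - s) * x by ring.
  by rewrite !kern_scale// -EFinM; congr EFin; ring.
under eq_integral do rewrite E.
rewrite ge0_integralZl_EFin//; last 3 first.
- by move=> x _; rewrite lee_fin mulr_ge0 ?kern_ge0.
- apply/measurable_EFinP; apply: measurable_funM; last exact: measurable_kern.
  apply: measurableT_comp; first exact: measurable_kern.
  by apply: measurable_funD; [exact: measurable_cst|exact: measurable_id].
- by rewrite mulr_ge0 ?powR_ge0.
rewrite -/C muleA muleC; congr (_ * _)%E.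
rewrite normrN gtr0_norm// -EFinM kernE//; congr EFin.
rewrite mulrA -{1}(powRr1 (ltW ts)) -!powRD; last 2 first.
- by rewrite (gt_eqF ts) implybT.
- by rewrite (gt_eqF ts) implybT.
by congr (_ `^ _); rewrite /b; field.
Qed.

Let K2C t s : K2 t s = K2 s t.
Proof. by apply: eq_integral => x _; rewrite mulrC. Qed.

Let K2E (t s : R) : t != s -> K2 t s = (C * (kern a (t - s) + kern a (s - t))%:E)%E.
Proof.
have [ts|ts|->] := ltgtP t s; last by [].
- rewrite K2C K2_lt// => _; congr (_ * _%:E)%E.
  by rewrite [kern a (t - s)]kern_out ?add0r// subr_le0 ltW.
- rewrite K2_lt// => _; congr (_ * _%:E)%E.
  by rewrite [kern a (s - t)]kern_out ?addr0// subr_le0 ltW.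
Qed.

(** Up to a constant, the fractional integral of order [a / 2] of [f] in reversed time, which acts
    as a square root of the symmetrised kernel. *)
Let Hf (f : R -> R) (th : R) : \bar R := (\int[leb]_t (f t * kern b (t - th))%:E)%E.

(** The kernel is causal: only [s < t] contributes. Hence the combination [kform f g + kform g f] in
    what follows, which carries the symmetric kernel. *)
Definition kform (f g : R -> R) : \bar R :=
  (\int[leb]_t \int[leb]_s (f t * g s * kern a (t - s))%:E)%E.

Lemma measurable_kform_integrand (f g : R -> R) (u v : R * R -> R) :
  measurable_fun setT f -> measurable_fun setT g ->
  measurable_fun setT u -> measurable_fun setT v ->
  measurable_fun [set: R * R] (fun z => (f z.1 * g z.2 * kern a (u z - v z))%:E).
Proof.
move=> mf mg mu mv; apply/measurable_EFinP; apply: measurable_funM.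
  by apply: measurable_funM; [exact: measurable_comp_fst|exact: measurable_comp_snd].
exact: measurable_kern2.
Qed.

Lemma kform_swap (f g : R -> R) :
  measurable_fun setT f -> measurable_fun setT g ->
  (forall x, 0 <= f x) -> (forall x, 0 <= g x) ->
  kform f g = (\int[leb]_t \int[leb]_s (g t * f s * kern a (s - t))%:E)%E.
Proof.
move=> mf mg f0 g0.
transitivity (\int[leb]_s \int[leb]_t (f t * g s * kern a (t - s))%:E)%E.
  apply: (tonelli_swap (F := fun t s => (f t * g s * kern a (t - s))%:E)).
    exact: (measurable_kform_integrand mf mg measurable_fst_R measurable_snd_R).
  by move=> t s; rewrite lee_fin !mulr_ge0 ?kern_ge0.
by apply: eq_integral => t _; apply: eq_integral => s _ /=; rewrite (mulrC (f s)).
Qed.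

(** Symmetrising replaces [C * kern a] by [K2], and Tonelli's theorem moves the integral over [th]
    outside, where the double integral splits into a product. Since all integrands are nonnegative,
    values [+oo] are allowed throughout. *)
Lemma kform_sym_energy (f g : R -> R) :
  measurable_fun setT f -> measurable_fun setT g ->
  (forall x, 0 <= f x) -> (forall x, 0 <= g x) ->
  (C * (kform f g + kform g f) = \int[leb]_th (Hf f th * Hf g th))%E.
Proof.
move=> mf mg f0 g0.
have k0 x := kern_ge0 a x; have kb0 x := kern_ge0 b x.
have kE0 x : (0 <= (kern b x)%:E)%E by rewrite lee_fin.
have mker (h : R -> R) t : measurable_fun setT h ->
    measurable_fun setT (fun s => h s * kern a (t - s)).
  by move=> mh; apply: measurable_funM => //; exact: measurable_kern2.
have mker' (h : R -> R) t : measurable_fun setT h ->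
    measurable_fun setT (fun s => h s * kern a (s - t)).
  by move=> mh; apply: measurable_funM => //; exact: measurable_kern2.
have mkf2 (h : R -> R) : measurable_fun setT h ->
    measurable_fun [set: R * R] (fun z => (h z.1 * kern b (z.1 - z.2))%:E).
  move=> mh; apply/measurable_EFinP; apply: measurable_funM.
    exact: measurable_comp_fst.
  by apply: measurable_kern2; [exact: measurable_fst_R|exact: measurable_snd_R].
have mHf (h : R -> R) : measurable_fun setT h -> (forall x, 0 <= h x) -> measurable_fun setT (Hf h).
  move=> mh h0.
  apply: (@measurable_fun_fubini_tonelli_G _ _ _ _ _ leb
    (fun z : R * R => (h z.1 * kern b (z.1 - z.2))%:E)); first exact: mkf2.
  by move=> x; rewrite lee_fin mulr_ge0.
have Hf0 (h : R -> R) th : (forall x, 0 <= h x) -> (0 <= Hf h th)%E.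
  by move=> h0; apply: integral_ge0 => x _; rewrite lee_fin mulr_ge0.
transitivity (\int[leb]_t ((f t)%:E * \int[leb]_s ((g s)%:E * K2 t s)))%E.
  have mF (u v : R * R -> R) : measurable_fun setT u -> measurable_fun setT v ->
      measurable_fun setT (fun t => \int[leb]_s (f t * g s * kern a (u (t, s) - v (t, s)))%:E)%E.
    move=> mu mv; apply: (@measurable_fun_fubini_tonelli_F _ _ _ _ _ leb
      (fun z : R * R => (f z.1 * g z.2 * kern a (u z - v z))%:E)).
      exact: measurable_kform_integrand.
    by move=> x; rewrite lee_fin !mulr_ge0.
  have mF1 := mF _ _ measurable_fst_R measurable_snd_R.
  have mF2 := mF _ _ measurable_snd_R measurable_fst_R.
  have sum_kform : (kform f g + kform g f = \int[leb]_t
      (\int[leb]_s (f t * g s * kern a (t - s))%:E + \int[leb]_s (f t * g s * kern a (s - t))%:E))%E.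
    have i1 t : setT t -> (0 <= \int[leb]_s (f t * g s * kern a (t - s))%:E)%E.
      by move=> _; apply: integral_ge0 => s _; rewrite lee_fin !mulr_ge0.
    have i2 t : setT t -> (0 <= \int[leb]_s (f t * g s * kern a (s - t))%:E)%E.
      by move=> _; apply: integral_ge0 => s _; rewrite lee_fin !mulr_ge0.
    rewrite (kform_swap mg mf g0 f0).
    exact: (esym (ge0_integralD leb measurableT i1 mF1 i2 mF2)).
  rewrite sum_kform.
  have minner t : measurable_fun setT (fun s => (g s * (kern a (t - s) + kern a (s - t)))%:E).
    apply/measurable_EFinP; apply: measurable_funM => //.
    by apply: measurable_funD; apply: measurable_kern2.
  have step t : (\int[leb]_s (f t * g s * kern a (t - s))%:E +
      \int[leb]_s (f t * g s * kern a (s - t))%:E =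
      (f t)%:E * \int[leb]_s (g s * (kern a (t - s) + kern a (s - t)))%:E)%E.
    rewrite -ge0_integralD//; last 4 first.
    - by move=> s _; rewrite lee_fin !mulr_ge0.
    - by apply/measurable_EFinP; under eq_fun do rewrite -mulrA; apply: measurable_funM => //; exact: mker.
    - by move=> s _; rewrite lee_fin !mulr_ge0.
    - by apply/measurable_EFinP; under eq_fun do rewrite -mulrA; apply: measurable_funM => //; exact: mker'.
    rewrite -ge0_integralZl_EFin//.
    - by apply: eq_integral => s _; rewrite -EFinD -EFinM; congr EFin; ring.
    - by move=> s _; rewrite lee_fin mulr_ge0 ?addr_ge0.
    - exact: minner.
  under eq_integral do rewrite step.
  have mstep : measurable_fun setT (fun t : R => (\int[leb]_s (g s * (kern a (t - s) + kern a (s - t)))%:E)%E).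
    apply: (@measurable_fun_fubini_tonelli_F _ _ _ _ _ leb
      (fun z : R * R => (g z.2 * (kern a (z.1 - z.2) + kern a (z.2 - z.1)))%:E)); last first.
      by move=> x; rewrite lee_fin mulr_ge0 ?addr_ge0.
    apply/measurable_EFinP; apply: measurable_funM; first exact: measurable_comp_snd.
    by apply: measurable_funD; apply: measurable_kern2;
      first [exact: measurable_fst_R|exact: measurable_snd_R].
  rewrite -ge0_integralZl//; last 3 first.
  - by apply: emeasurable_funM => //; exact/measurable_EFinP.
  - by move=> t _; apply: mule_ge0; rewrite ?lee_fin//; apply: integral_ge0 => s _;
      rewrite lee_fin mulr_ge0 ?addr_ge0.
  - exact: ltW.
  apply: eq_integral => t _; rewrite muleCA; congr (_ * _)%E.
  rewrite -ge0_integralZl//; last 3 first.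
  - exact: minner.
  - by move=> s _; rewrite lee_fin mulr_ge0 ?addr_ge0.
  - exact: ltW.
  (* The diagonal, excluded in [K2E], is a null set. *)
  apply: ae_eq_integralW; exists [set t]; split => //; first exact: lebesgue_measure_set1.
  move=> s /= H; apply: contrapT => st; apply: H => _.
  rewrite K2E; last by apply/eqP => ts; apply: st.
  by rewrite EFinM muleCA.
have mK2 t : measurable_fun setT (K2 t).
  apply: (@measurable_fun_fubini_tonelli_F _ _ _ _ _ leb
    (fun z : R * R => (kern b (t - z.2) * kern b (z.1 - z.2))%:E)); last first.
    by move=> x; rewrite lee_fin mulr_ge0.
  apply/measurable_EFinP; apply: measurable_funM; apply: measurable_kern2;
    first [exact: measurable_fst_R|exact: measurable_snd_R|exact: measurable_cst].
transitivity (\int[leb]_t ((f t)%:E * \int[leb]_th ((kern b (t - th))%:E * Hf g th)))%E.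
  suff E t : (\int[leb]_s ((g s)%:E * K2 t s) = \int[leb]_th ((kern b (t - th))%:E * Hf g th))%E.
    by apply: eq_integral => t _; exact: (congr1 (mule (f t)%:E) (E t)).
  transitivity (\int[leb]_s \int[leb]_th ((g s * (kern b (t - th) * kern b (s - th)))%:E))%E.
    apply: eq_integral => s _; rewrite /K2 -ge0_integralZl_EFin//.
    - by move=> th _; rewrite lee_fin mulr_ge0.
    - by apply/measurable_EFinP; apply: measurable_funM; apply: measurable_kern2.
  transitivity (\int[leb]_th \int[leb]_s ((g s * (kern b (t - th) * kern b (s - th)))%:E))%E.
    apply: (tonelli_swap (F := fun s th => (g s * (kern b (t - th) * kern b (s - th)))%:E)).
      apply/measurable_EFinP; apply: measurable_funM; first exact: measurable_comp_fst.
      by apply: measurable_funM; apply: measurable_kern2;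
        first [exact: measurable_fst_R|exact: measurable_snd_R|exact: measurable_cst].
    by move=> s th; rewrite lee_fin !mulr_ge0.
  apply: eq_integral => th _; rewrite /Hf -ge0_integralZl_EFin//.
  - by apply: eq_integral => s _; rewrite -EFinM; congr EFin; ring.
  - by move=> s _; rewrite lee_fin mulr_ge0.
  - by apply/measurable_EFinP; apply: measurable_funM => //; apply: measurable_kern2.
transitivity (\int[leb]_t \int[leb]_th ((f t * kern b (t - th))%:E * Hf g th))%E.
  apply: eq_integral => t _; rewrite -ge0_integralZl_EFin//.
  - by apply: eq_integral => th _; rewrite EFinM muleA.
  - by move=> th _; exact: (mule_ge0 (kE0 _) (Hf0 _ _ g0)).
  - apply: emeasurable_funM; last exact: mHf.
    by apply/measurable_EFinP; apply: measurable_kern2.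
transitivity (\int[leb]_th \int[leb]_t ((f t * kern b (t - th))%:E * Hf g th))%E.
  apply: (tonelli_swap (F := fun t th => ((f t * kern b (t - th))%:E * Hf g th)%E)).
    apply: emeasurable_funM; first exact: mkf2.
    exact: (measurableT_comp (mHf _ mg g0) measurable_snd_R).
  move=> t th; have fk : (0 <= (f t * kern b (t - th))%:E)%E by rewrite lee_fin mulr_ge0.
  exact: (mule_ge0 fk (Hf0 _ _ g0)).
suff Z th : (\int[leb]_t ((f t * kern b (t - th))%:E * Hf g th) = Hf f th * Hf g th)%E.
  by apply: eq_integral => th _; exact: Z.
apply: (@ge0_integralZr _ _ _ leb _ measurableT (fun t => (f t * kern b (t - th))%:E)).
- by apply/measurable_EFinP; apply: measurable_funM => //; apply: measurable_kern2.
- by move=> x _; rewrite lee_fin mulr_ge0.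
- exact: Hf0.
Qed.

(* By [kform_sym_energy] this is [2 Hf Hg <= Hf^2 + Hg^2] under the integral. *)
Lemma kform_le (f g : R -> R) :
  measurable_fun setT f -> measurable_fun setT g ->
  (forall x, 0 <= f x) -> (forall x, 0 <= g x) ->
  (kform f g + kform g f <= kform f f + kform g g)%E.
Proof.
move=> mf mg f0 g0; rewrite -(lee_pmul2l _ C_gt0); last first.
  by rewrite ge0_fin_numE ?C_lty// ltW.
have kf0 (h h' : R -> R) : (forall x, 0 <= h x) -> (forall x, 0 <= h' x) -> (0 <= kform h h')%E.
  move=> h0 h0'; apply: integral_ge0 => t _; apply: integral_ge0 => s _.
  by rewrite lee_fin !mulr_ge0 ?kern_ge0.
have dbl (h : R -> R) : measurable_fun setT h -> (forall x, 0 <= h x) ->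
    (C * kform h h + C * kform h h = \int[leb]_th (Hf h th * Hf h th))%E.
  move=> mh h0; rewrite -kform_sym_energy//.
  have h1 := kf0 h h h0 h0; exact: esym (ge0_muleDr _ h1 h1).
have Hf0 (h : R -> R) th : (forall x, 0 <= h x) -> (0 <= Hf h th)%E.
  by move=> h0; apply: integral_ge0 => x _; rewrite lee_fin mulr_ge0 ?kern_ge0.
have mHf (h : R -> R) : measurable_fun setT h -> (forall x, 0 <= h x) -> measurable_fun setT (Hf h).
  move=> mh h0.
  apply: (@measurable_fun_fubini_tonelli_G _ _ _ _ _ leb
    (fun z : R * R => (h z.1 * kern b (z.1 - z.2))%:E)).
    apply/measurable_EFinP; apply: measurable_funM; first exact: measurable_comp_fst.
    by apply: measurable_kern2; [exact: measurable_fst_R|exact: measurable_snd_R].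
  by move=> x; rewrite lee_fin mulr_ge0 ?kern_ge0.
(* The comparison is made after doubling, because the diagonal case of [kform_sym_energy] yields
   twice [kform h h]. *)
have dleq (x y : \bar R) : (0 <= x)%E -> (0 <= y)%E -> (x + x <= y + y)%E -> (x <= y)%E.
  case: x y => [x| |] [y| |]//; rewrite ?leey ?leNye// -!EFinD !lee_fin => x0 y0; lra.
have CK (h h' : R -> R) : (forall x, 0 <= h x) -> (forall x, 0 <= h' x) -> (0 <= C * kform h h')%E.
  by move=> h0 h0'; rewrite mule_ge0 ?kf0// ltW.
have C0 := ltW C_gt0.
have kff := kf0 f f f0 f0; have kgg := kf0 g g g0 g0.
have kfg := kf0 f g f0 g0; have kgf := kf0 g f g0 f0.
have L0 := mule_ge0 C0 (adde_ge0 kfg kgf); have R0 := mule_ge0 C0 (adde_ge0 kff kgg).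
apply: (dleq _ _ L0 R0).
have D := ge0_muleDr C kff kgg.
have rhs := eq_trans (congr2 adde D D)
  (eq_trans (addeACA _ _ _ _) (congr2 adde (dbl f mf f0) (dbl g mg g0))).
have lhs := congr2 adde (kform_sym_energy mf mg f0 g0) (kform_sym_energy mf mg f0 g0).
refine (eq_ind_r (fun x => (_ <= x)%E) _ rhs).
refine (eq_ind_r (fun x => (x <= _)%E) _ lhs).
have mfg := emeasurable_funM (mHf f mf f0) (mHf g mg g0).
have mff := emeasurable_funM (mHf f mf f0) (mHf f mf f0).
have mgg := emeasurable_funM (mHf g mg g0) (mHf g mg g0).
have fg0 th : setT th -> (0 <= Hf f th * Hf g th)%E.
  by move=> _; exact: (mule_ge0 (Hf0 _ _ f0) (Hf0 _ _ g0)).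
have ff0 th : setT th -> (0 <= Hf f th * Hf f th)%E.
  by move=> _; exact: (mule_ge0 (Hf0 _ _ f0) (Hf0 _ _ f0)).
have gg0 th : setT th -> (0 <= Hf g th * Hf g th)%E.
  by move=> _; exact: (mule_ge0 (Hf0 _ _ g0) (Hf0 _ _ g0)).
refine (eq_ind _ (fun x => (x <= _)%E) _ _ (ge0_integralD leb measurableT fg0 mfg fg0 mfg)).
refine (eq_ind _ (fun x => (_ <= x)%E) _ _ (ge0_integralD leb measurableT ff0 mff gg0 mgg)).
apply: ge0_le_integral => //.
- by move=> th _; exact: (adde_ge0 (fg0 th I) (fg0 th I)).
- exact: emeasurable_funD.
- exact: emeasurable_funD.
- move=> th _; have := Hf0 f th f0; have := Hf0 g th g0.
  case: (Hf f th) (Hf g th) => [x| |] [y| |]//= y0 x0.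
  + rewrite -!EFinM -!EFinD lee_fin; have := sqr_ge0 (x - y); rewrite sqrrB !expr2; lra.
  + by rewrite mulyy addey ?leey// -EFinM.
  + by rewrite mulyy addye ?leey// -EFinM.
Qed.

End positivity.

(** For times in []0, T[] one has [1 <= e^T e^(-(t - s))], so the kernel may be replaced by
    [e^T E (t - s)], where [E] has the finite integral [Gamma a]. The rest is [2 x y <= x^2 + y^2],
    as in Young's inequality. *)
Lemma kform_young (a T : R) (rho : R -> R) : 0 < a < 1 -> 0 < T ->
  measurable_fun setT rho -> (forall x, 0 <= rho x) ->
  (forall x, x \notin `]0, T[ -> rho x = 0) ->
  (kform a rho rho <= (expR T * Gamma a)%:E * \int[leb]_t (rho t ^+ 2)%:E)%E.
Proof.
move=> /andP[a0 a1] T0 mr r0 rT.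
pose E r := expR (- (1 * r)) * kern a r.
have E0 r : 0 <= E r by rewrite mulr_ge0 ?expR_ge0 ?kern_ge0.
have mE := @measurable_laplace_kern R a 1.
have mE2 : measurable_fun [set: R * R] (fun z : R * R => E (z.1 - z.2)).
  apply: (measurableT_comp mE); apply: measurable_funB;
    [exact: measurable_fst_R|exact: measurable_snd_R].
have mr2 : measurable_fun setT (fun t => rho t ^+ 2) by exact: measurable_funX.
have expT0 : 0 <= expR T by exact: expR_ge0.
have G0 : 0 <= Gamma a by rewrite ltW// Gamma_gt0// a0 ltW.
have intE : (\int[leb]_r (E r)%:E = (Gamma a)%:E)%E.
  by rewrite -Gamma_laplaceE// a0 ltW.
have mEE : measurable_fun setT (fun r => (E r)%:E) by exact/measurable_EFinP.
pose F1 t s := (expR T / 2 * (rho t ^+ 2 * E (t - s)))%:E.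
pose F2 t s := (expR T / 2 * (rho s ^+ 2 * E (t - s)))%:E.
have F10 t s : (0 <= F1 t s)%E by rewrite lee_fin mulr_ge0 ?divr_ge0// mulr_ge0 ?sqr_ge0 ?E0.
have F20 t s : (0 <= F2 t s)%E by rewrite lee_fin mulr_ge0 ?divr_ge0// mulr_ge0 ?sqr_ge0 ?E0.
have mF1 : measurable_fun [set: R * R] (fun z => F1 z.1 z.2).
  apply/measurable_EFinP; apply: measurable_funM => //; apply: measurable_funM => //.
  exact: (measurable_comp_fst mr2).
have mF2 : measurable_fun [set: R * R] (fun z => F2 z.1 z.2).
  apply/measurable_EFinP; apply: measurable_funM => //; apply: measurable_funM => //.
  exact: (measurable_comp_snd mr2).
have I1 : (\int[leb]_t \int[leb]_s F1 t s =
    (expR T * Gamma a / 2)%:E * \int[leb]_t (rho t ^+ 2)%:E)%E.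
  rewrite -ge0_integralZl_EFin//; last 3 first.
  - by move=> t _; rewrite lee_fin sqr_ge0.
  - exact/measurable_EFinP.
  - by rewrite !mulr_ge0 ?invr_ge0.
  apply: eq_integral => t _.
  transitivity (\int[leb]_s ((expR T / 2 * rho t ^+ 2)%:E * (E (t - s))%:E))%E.
    by apply: eq_integral => s _; rewrite /F1 -EFinM mulrA.
  rewrite ge0_integralZl_EFin//; last 3 first.
  - by move=> s _; rewrite lee_fin.
  - by apply/measurable_EFinP; apply: (measurableT_comp mE); exact: measurable_sub_l.
  - by rewrite !mulr_ge0 ?sqr_ge0 ?invr_ge0.
  rewrite (ge0_integral_reflect t mEE) ?intE; last by move=> x; rewrite lee_fin.
  by rewrite -!EFinM; congr EFin; ring.
have I2 : (\int[leb]_t \int[leb]_s F2 t s =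
    (expR T * Gamma a / 2)%:E * \int[leb]_t (rho t ^+ 2)%:E)%E.
  rewrite (tonelli_swap mF2 F20) -ge0_integralZl_EFin//; last 3 first.
  - by move=> t _; rewrite lee_fin sqr_ge0.
  - exact/measurable_EFinP.
  - by rewrite !mulr_ge0 ?invr_ge0.
  apply: eq_integral => s _.
  transitivity (\int[leb]_t ((expR T / 2 * rho s ^+ 2)%:E * (E (t - s))%:E))%E.
    by apply: eq_integral => t _; rewrite /F2 -EFinM mulrA.
  rewrite ge0_integralZl_EFin//; last 3 first.
  - by move=> t _; rewrite lee_fin.
  - by apply/measurable_EFinP; apply: (measurableT_comp mE); exact: measurable_sub_r.
  - by rewrite !mulr_ge0 ?sqr_ge0 ?invr_ge0.
  rewrite (ge0_integral_shift s mEE) ?intE; last by move=> x; rewrite lee_fin.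
  by rewrite -!EFinM; congr EFin; ring.
have split_sum : ((expR T * Gamma a)%:E * \int[leb]_t (rho t ^+ 2)%:E =
   \int[leb]_t \int[leb]_s F1 t s + \int[leb]_t \int[leb]_s F2 t s)%E.
  rewrite I1 I2 -ge0_muleDl ?lee_fin ?mulr_ge0 ?invr_ge0//.
  by rewrite -EFinD; congr (_%:E * _)%E; field.
rewrite split_sum.
have i10 t : setT t -> (0 <= \int[leb]_s F1 t s)%E by move=> _; exact: integral_ge0.
have i20 t : setT t -> (0 <= \int[leb]_s F2 t s)%E by move=> _; exact: integral_ge0.
have mi1 : measurable_fun setT (fun t => \int[leb]_s F1 t s)%E.
  by apply: (@measurable_fun_fubini_tonelli_F _ _ _ _ _ leb (fun z => F1 z.1 z.2)).
have mi2 : measurable_fun setT (fun t => \int[leb]_s F2 t s)%E.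
  by apply: (@measurable_fun_fubini_tonelli_F _ _ _ _ _ leb (fun z => F2 z.1 z.2)).
rewrite -(ge0_integralD leb measurableT i10 mi1 i20 mi2).
have mK : measurable_fun [set: R * R] (fun z => (rho z.1 * rho z.2 * kern a (z.1 - z.2))%:E).
  exact: (measurable_kform_integrand a mr mr measurable_fst_R measurable_snd_R).
apply: ge0_le_integral => //.
- by move=> t _; apply: integral_ge0 => s _; rewrite lee_fin !mulr_ge0 ?kern_ge0.
- apply: (@measurable_fun_fubini_tonelli_F _ _ _ _ _ leb
    (fun z : R * R => (rho z.1 * rho z.2 * kern a (z.1 - z.2))%:E)) => //.
  by move=> x; rewrite lee_fin !mulr_ge0 ?kern_ge0.
- exact: emeasurable_funD.
move=> t _.
have sec (F : R -> R -> \bar R) : measurable_fun [set: R * R] (fun z => F z.1 z.2) ->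
    measurable_fun setT (F t).
  by move=> mF; apply: (measurableT_comp mF (@measurable_pair1 _ _ _ _ t)).
have m1 := sec _ mF1; have m2 := sec _ mF2.
have m3 := sec (fun t s => (rho t * rho s * kern a (t - s))%:E) mK.
rewrite -(ge0_integralD leb measurableT (fun s _ => F10 t s) m1 (fun s _ => F20 t s) m2).
apply: ge0_le_integral => //.
- by move=> s _; rewrite lee_fin !mulr_ge0 ?kern_ge0.
- exact: emeasurable_funD.
move=> s _; rewrite -EFinD lee_fin.
have x1 : 0 <= expR T / 2 * (rho t ^+ 2 * E (t - s)) by rewrite -lee_fin; exact: F10.
have x2 : 0 <= expR T / 2 * (rho s ^+ 2 * E (t - s)) by rewrite -lee_fin; exact: F20.
have [ts|ts] := leP (t - s) 0; first by rewrite (kern_out _ ts) mulr0 addr_ge0.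
(* The weight is available only for both times in the interval; elsewhere [rho] vanishes. *)
have [tT|tT] := boolP (t \in `]0, T[); last by rewrite {1}(rT _ tT) !mul0r addr_ge0.
have [sT|sT] := boolP (s \in `]0, T[); last by rewrite {1}(rT _ sT) mulr0 mul0r addr_ge0.
have kE : kern a (t - s) <= expR T * E (t - s).
  rewrite /E mulrA -expRD ler_peMl ?kern_ge0//; apply: le_trans (expR_ge1Dx _); rewrite lerDl.
  by move: tT sT; rewrite !in_itv/= => /andP[? ?] /andP[? ?]; lra.
have := sqr_ge0 (rho t - rho s); rewrite sqrrB => sq.
have p0 : 0 <= rho t * rho s by rewrite mulr_ge0.
apply: le_trans (ler_wpM2l p0 kE) _.
have eE : 0 <= expR T * E (t - s) by rewrite mulr_ge0.
have -> : expR T / 2 * (rho t ^+ 2 * E (t - s)) + expR T / 2 * (rho s ^+ 2 * E (t - s)) =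
    (rho t ^+ 2 + rho s ^+ 2) / 2 * (expR T * E (t - s)).
  by move: (expR T) (E _) (rho t) (rho s) => ? ? ? ?; field.
by rewrite ler_wpM2r//; lra.
Qed.

Lemma kform_integral2 (a : R) (f g : R -> R) :
  measurable_fun setT f -> measurable_fun setT g ->
  (forall x, 0 <= f x) -> (forall x, 0 <= g x) ->
  kform a f g = (\int[leb2]_z (f z.1 * g z.2 * kern a (z.1 - z.2))%:E)%E.
Proof.
move=> mf mg f0 g0.
have mK := measurable_kform_integrand a mf mg measurable_fst_R measurable_snd_R.
have K0 (z : R * R) : (0 <= (f z.1 * g z.2 * kern a (z.1 - z.2))%:E)%E.
  by rewrite lee_fin !mulr_ge0 ?kern_ge0.
exact: esym (@fubini_tonelli1 _ _ _ _ _ leb leb _ mK K0).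
Qed.

Lemma kform_lty (a T : R) (f g : R -> R) : 0 < a < 1 -> 0 < T ->
  measurable_fun setT f -> measurable_fun setT g ->
  (forall x, 0 <= f x) -> (forall x, 0 <= g x) ->
  (forall x, x \notin `]0, T[ -> f x = 0) -> (forall x, x \notin `]0, T[ -> g x = 0) ->
  (\int[leb]_t (f t ^+ 2)%:E < +oo)%E -> (\int[leb]_t (g t ^+ 2)%:E < +oo)%E ->
  (kform a f g < +oo)%E.
Proof.
move=> a01 T0 mf mg f0 g0 fT gT f2 g2.
have G0 : 0 <= Gamma a by move: (a01) => /andP[a0 a1]; rewrite ltW// Gamma_gt0// a0 ltW.
have fin (h : R -> R) : measurable_fun setT h -> (forall x, 0 <= h x) ->
    (forall x, x \notin `]0, T[ -> h x = 0) ->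
    (\int[leb]_t (h t ^+ 2)%:E < +oo)%E -> (kform a h h < +oo)%E.
  move=> mh h0 hT h2; apply: (le_lt_trans (kform_young a01 T0 mh h0 hT)).
  have h2' : (\int[leb]_t (h t ^+ 2)%:E)%E \is a fin_num.
    by rewrite ge0_fin_numE//; apply: integral_ge0 => t _; rewrite lee_fin sqr_ge0.
  by rewrite -(fineK h2') -EFinM ltry.
have kf0 : (0 <= kform a g f)%E.
  by apply: integral_ge0 => t _; apply: integral_ge0 => s _; rewrite lee_fin !mulr_ge0 ?kern_ge0.
apply: (@le_lt_trans _ _ (kform a f g + kform a g f)%E); first by rewrite leeDl.
apply: (le_lt_trans (kform_le a01 mf mg f0 g0)).
exact: lte_add_pinfty (fin _ mf f0 fT f2) (fin _ mg g0 gT g2).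
Qed.

Lemma kernel_integrable (a T : R) (f g : R -> R) : 0 < a < 1 -> 0 < T ->
  measurable_fun setT f -> measurable_fun setT g ->
  (forall x, x \notin `]0, T[ -> f x = 0) -> (forall x, x \notin `]0, T[ -> g x = 0) ->
  (\int[leb]_t (f t ^+ 2)%:E < +oo)%E -> (\int[leb]_t (g t ^+ 2)%:E < +oo)%E ->
  leb2.-integrable setT (fun z : R * R => (f z.1 * g z.2 * kern a (z.1 - z.2))%:E).
Proof.
move=> a01 T0 mf mg fT gT f2 g2.
have mabs (h : R -> R) : measurable_fun setT h -> measurable_fun setT (fun t => `|h t|).
  by move=> mh; exact: (measurableT_comp (@normr_measurable R setT) mh).
have absT (h : R -> R) : (forall x, x \notin `]0, T[ -> h x = 0) ->
    forall x, x \notin `]0, T[ -> `|h x| = 0 by move=> hT x /hT ->; rewrite normr0.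
have abs2 (h : R -> R) : (\int[leb]_t (h t ^+ 2)%:E < +oo)%E -> (\int[leb]_t (`|h t| ^+ 2)%:E < +oo)%E.
  by under eq_integral do rewrite -real_normK ?num_real//.
apply/integrableP; split.
  exact: measurable_kform_integrand mf mg measurable_fst_R measurable_snd_R.
have := kform_lty a01 T0 (mabs _ mf) (mabs _ mg) (fun x => normr_ge0 _) (fun x => normr_ge0 _)
  (absT _ fT) (absT _ gT) (abs2 _ f2) (abs2 _ g2).
rewrite (kform_integral2 a (mabs _ mf) (mabs _ mg)) => [H|x|x]; rewrite ?normr_ge0//.
apply: le_lt_trans H; rewrite le_eqVlt; apply/orP; left; apply/eqP; apply: eq_integral => z _ /=.
by rewrite !normrM (ger0_norm (kern_ge0 _ _)).
Qed.

(** With [y = P - M] the difference of its positive and negative parts, the claim expands to [kform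
    P M + kform M P <= kform P P + kform M M], which is [kform_le]; [kernel_integrable] makes the
    expansion legitimate. *)
Lemma kernel_positive (a T : R) (y : R -> R) : 0 < a < 1 -> 0 < T ->
  measurable_fun setT y -> (forall x, x \notin `]0, T[ -> y x = 0) ->
  (\int[leb]_t (y t ^+ 2)%:E < +oo)%E ->
  (0 <= \int[leb2]_z (y z.1 * y z.2 * kern a (z.1 - z.2))%:E)%E.
Proof.
move=> a01 T0 my yT y2.
pose P t := Num.max (y t) 0; pose M t := Num.max (- y t) 0.
have mP : measurable_fun setT P by exact: measurable_maxr.
have mM : measurable_fun setT M.
  by apply: measurable_maxr => //; exact: measurable_funN.
have P0 t : 0 <= P t by rewrite le_max lexx orbT.
have M0 t : 0 <= M t by rewrite le_max lexx orbT.
have yE t : y t = P t - M t.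
  by rewrite /P /M; have [|] := leP (y t) 0; have [|] := leP (- y t) 0; lra.
have PT x : x \notin `]0, T[ -> P x = 0 by move=> /yT; rewrite /P => ->; rewrite maxxx.
have MT x : x \notin `]0, T[ -> M x = 0 by move=> /yT; rewrite /M => ->; rewrite oppr0 maxxx.
have sq (h : R -> R) : measurable_fun setT h -> (forall t, h t ^+ 2 <= y t ^+ 2) ->
    (\int[leb]_t (h t ^+ 2)%:E < +oo)%E.
  move=> mh hy; apply: le_lt_trans y2; apply: ge0_le_integral => //.
  - by move=> t _; rewrite lee_fin sqr_ge0.
  - by apply/measurable_EFinP; exact: measurable_funX.
  - by apply/measurable_EFinP; exact: measurable_funX.
  - by move=> t _; rewrite lee_fin.
have P2 : (\int[leb]_t (P t ^+ 2)%:E < +oo)%E.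
  by apply: sq => // t; rewrite /P; have [_|//] := leP (y t) 0; rewrite expr0n sqr_ge0.
have M2 : (\int[leb]_t (M t ^+ 2)%:E < +oo)%E.
  by apply: sq => // t; rewrite /M; have [_|_] := leP (- y t) 0; rewrite ?sqrrN// expr0n sqr_ge0.
pose G (f g : R -> R) (z : R * R) : \bar R := (f z.1 * g z.2 * kern a (z.1 - z.2))%:E.
have iPP : leb2.-integrable setT (G P P) by exact: (kernel_integrable a01 T0 mP mP PT PT P2 P2).
have iMM : leb2.-integrable setT (G M M) by exact: (kernel_integrable a01 T0 mM mM MT MT M2 M2).
have iPM : leb2.-integrable setT (G P M) by exact: (kernel_integrable a01 T0 mP mM PT MT P2 M2).
have iMP : leb2.-integrable setT (G M P) by exact: (kernel_integrable a01 T0 mM mP MT PT M2 P2).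
have iS := integrableD measurableT iPP iMM; have iX := integrableD measurableT iPM iMP.
have -> : (\int[leb2]_z (y z.1 * y z.2 * kern a (z.1 - z.2))%:E =
    \int[leb2]_z ((G P P \+ G M M) \- (G P M \+ G M P))%E z)%E.
  apply: eq_integral => z _; rewrite /G/= -!EFinD; congr EFin.
  by rewrite !yE; ring.
rewrite (integralB measurableT iS iX) (integralD measurableT iPP iMM) (integralD measurableT iPM iMP).
have fin := integrable_fin_num measurableT iX.
rewrite (integralD measurableT iPM iMP) in fin.
rewrite sube_ge0 ?fin//.
have := kform_le a01 mP mM P0 M0.
by rewrite !kform_integral2.
Qed.

Lemma laplace_kern_shift (a p s : R) :
  (\int[leb]_t (expR (- (p * (t - s))) * kern a (t - s))%:E)%E = laplace_kern a p.
Proof.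
apply: (@ge0_integral_shift s (fun r => (expR (- (p * r)) * kern a r)%:E)).
  by apply/measurable_EFinP; exact: measurable_laplace_kern.
by move=> x; rewrite lee_fin mulr_ge0 ?expR_ge0 ?kern_ge0.
Qed.

Lemma laplace_convolution_ge0 (a p : R) (y : R -> R) :
  measurable_fun setT y -> (forall x, 0 <= y x) ->
  (\int[leb]_t \int[leb]_s (expR (- (p * t)) * kern a (t - s) * y s)%:E =
   laplace_kern a p * \int[leb]_s (expR (- (p * s)) * y s)%:E)%E.
Proof.
move=> my y0.
have mexp : measurable_fun setT (fun t : R => expR (- (p * t))).
  apply: measurableT_comp; first exact: measurable_expR.
  apply: measurable_funN; apply: measurable_funM; first exact: measurable_cst.
  exact: measurable_id.
pose F (t s : R) : \bar R := (expR (- (p * t)) * kern a (t - s) * y s)%:E.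
have F0 t s : (0 <= F t s)%E by rewrite lee_fin !mulr_ge0 ?expR_ge0 ?kern_ge0.
have mF : measurable_fun [set: R * R] (fun z : R * R => F z.1 z.2).
  apply/measurable_EFinP; apply: measurable_funM; last exact: measurable_comp_snd.
  apply: measurable_funM; first exact: (measurable_comp_fst mexp).
  exact: (measurable_kern2 a measurable_fst_R measurable_snd_R).
rewrite (tonelli_swap mF F0) -ge0_integralZl//; last 3 first.
- by apply/measurable_EFinP; exact: measurable_funM.
- by move=> s _; rewrite lee_fin mulr_ge0 ?expR_ge0.
- exact: laplace_kern_ge0.
apply: eq_integral => s _.
transitivity (\int[leb]_t ((expR (- (p * s)) * y s)%:E * (expR (- (p * (t - s))) * kern a (t - s))%:E))%E.
  apply: eq_integral => t _; rewrite /F -EFinM; congr EFin.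
  by rewrite (_ : - (p * t) = - (p * s) + - (p * (t - s))) ?expRD; ring.
have mL := measurable_laplace_kern a p.
rewrite ge0_integralZl_EFin//; last 3 first.
- by move=> t _; rewrite lee_fin mulr_ge0 ?expR_ge0 ?kern_ge0.
- by apply/measurable_EFinP; apply: (measurableT_comp mL); exact: measurable_sub_r.
- by rewrite mulr_ge0 ?expR_ge0.
by rewrite laplace_kern_shift muleC.
Qed.

(** The nonnegative case applied to [|y|] gives absolute integrability in the plane, after which
    Fubini's theorem applies to [y]. *)
Lemma laplace_convolution (a p : R) (y : R -> R) : 0 < a <= 1 -> 0 < p ->
  measurable_fun setT y -> leb.-integrable setT (fun s => (expR (- (p * s)) * y s)%:E) ->
  (\int[leb]_t \int[leb]_s (expR (- (p * t)) * kern a (t - s) * y s)%:E =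
   (p `^ (- a) * Gamma a)%:E * \int[leb]_s (expR (- (p * s)) * y s)%:E)%E.
Proof.
move=> a01 p0 my iy.
have mexp : measurable_fun setT (fun t : R => expR (- (p * t))).
  apply: measurableT_comp; first exact: measurable_expR.
  apply: measurable_funN; apply: measurable_funM; first exact: measurable_cst.
  exact: measurable_id.
have may : measurable_fun setT (fun t => `|y t|).
  exact: (measurableT_comp (@normr_measurable R setT) my).
have mL := measurable_laplace_kern a p.
pose F (z : R * R) : \bar R := (expR (- (p * z.1)) * kern a (z.1 - z.2) * y z.2)%:E.
have mF : measurable_fun [set: R * R] F.
  apply/measurable_EFinP; apply: measurable_funM; last exact: measurable_comp_snd.
  apply: measurable_funM; first exact: (measurable_comp_fst mexp).
  exact: (measurable_kern2 a measurable_fst_R measurable_snd_R).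
have absF z : `|F z|%E = (expR (- (p * z.1)) * kern a (z.1 - z.2) * `|y z.2|)%:E.
  by rewrite /F/= !normrM (ger0_norm (kern_ge0 _ _)) (ger0_norm (expR_ge0 _)).
have iF : leb2.-integrable setT F.
  apply/integrableP; split; first exact: mF.
  have abs0 z : setT z -> (0 <= `|F z|)%E by [].
  have mabsF : measurable_fun setT (fun z => `|F z|)%E by exact: measurableT_comp.
  rewrite (@fubini_tonelli1 _ _ _ _ _ leb leb _ mabsF (fun z => abs0 z I)).
  have -> : (\int[leb]_x fubini_F leb (fun z => `|F z|) x =
     \int[leb]_t \int[leb]_s (expR (- (p * t)) * kern a (t - s) * `|y s|)%:E)%E.
    by apply: eq_integral => t _; apply: eq_integral => s _; rewrite absF.
  rewrite laplace_convolution_ge0// laplace_kernE//.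
  have /integrableP[_] := iy.
  have -> : (\int[leb]_x `|(expR (- (p * x)) * y x)%:E| = \int[leb]_s (expR (- (p * s)) * `|y s|)%:E)%E.
    by apply: eq_integral => s _; rewrite /= normrM (ger0_norm (expR_ge0 _)).
  move=> fin; have fin' : (\int[leb]_s (expR (- (p * s)) * `|y s|)%:E)%E \is a fin_num.
    by rewrite ge0_fin_numE//; apply: integral_ge0 => s _; rewrite lee_fin mulr_ge0 ?expR_ge0.
  by rewrite -(fineK fin') -EFinM ltry.
have fub := @Fubini _ _ _ _ _ leb leb F iF.
rewrite -[LHS]/(\int[leb]_t \int[leb]_s F (t, s))%E fub -integralZl//.
apply: eq_integral => s _.
transitivity (\int[leb]_t ((expR (- (p * s)) * y s)%:E * (expR (- (p * (t - s))) * kern a (t - s))%:E))%E.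
  apply: eq_integral => t _; rewrite /F -EFinM; congr EFin.
  by rewrite (_ : - (p * t) = - (p * s) + - (p * (t - s))) ?expRD /=; ring.
have intE : (\int[leb]_t (expR (- (p * (t - s))) * kern a (t - s))%:E = (p `^ (- a) * Gamma a)%:E)%E.
  by rewrite laplace_kern_shift laplace_kernE.
rewrite integralZl//; first by rewrite intE muleC.
apply/integrableP; split.
  by apply/measurable_EFinP; apply: (measurableT_comp mL); exact: measurable_sub_r.
under eq_integral do rewrite gee0_abs ?lee_fin ?mulr_ge0 ?expR_ge0 ?kern_ge0//.
by rewrite intE ltry.
Qed.

(* Convolution with [kern 1], the indicator function of ]0, +oo[, yields the
   primitive of [E], bounded by [K t]. *)
Lemma laplace_lty_linear_growth (K p : R) (E : R -> R) : 0 < p -> 0 <= K ->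
  measurable_fun setT E -> (forall t, 0 <= E t) -> (forall t, t <= 0 -> E t = 0) ->
  (forall T : R, 0 < T -> (\int[leb]_(t in `]0%R, T[) (E t)%:E <= (K * T)%:E)%E) ->
  (\int[leb]_t (expR (- (p * t)) * E t)%:E < +oo)%E.
Proof.
move=> p0 K0 mE E0 Eneg EK.
have p2 : 0 < p / 2 by rewrite divr_gt0.
have mexp q : measurable_fun setT (fun t : R => expR (- (q * t))).
  apply: measurableT_comp; first exact: measurable_expR.
  apply: measurable_funN; apply: measurable_funM; first exact: measurable_cst.
  exact: measurable_id.
pose I := (\int[leb]_t (expR (- (p * t)) * E t)%:E)%E.
have a1 : 0 < (1 : R) <= 1 by rewrite ltr01 lexx.
have := @laplace_convolution_ge0 1 p E mE E0.
rewrite (laplace_kernE a1 p0) -/I => conv.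
have c0 : 0 < p `^ (- 1) * Gamma 1 by rewrite mulr_gt0 ?powR_gt0 ?Gamma_gt0.
suff : ((p `^ (- 1) * Gamma 1)%:E * I < +oo)%E.
  have I0 : (0 <= I)%E by apply: integral_ge0 => t _; rewrite lee_fin mulr_ge0 ?expR_ge0.
  move: I0; clear conv; move: I => [r| |]//= _; rewrite ?ltry// gt0_muley// lte_fin.
rewrite -conv.
(* The primitive of [E] is at most [K t]. Half of the exponential absorbs the factor [t], as
   [t e^(-p t / 2) <= 2 / p]; the other half remains integrable. *)
apply: (@le_lt_trans _ _ (\int[leb]_(t in `[0%R, +oo[) ((2 * K / p)%:E * (expR (- (p / 2 * t)))%:E))%E); last first.
  rewrite ge0_integralZl_EFin//; last 2 first.
  - by apply: measurable_funTS; apply/measurable_EFinP; exact: mexp.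
  - by rewrite divr_ge0 ?mulr_ge0// ltW.
  apply: (@le_lt_trans _ _ ((2 * K / p)%:E * ((p / 2)^-1)%:E)%E); last by rewrite -EFinM ltry.
  by apply: lee_wpmul2l; rewrite ?lee_fin ?divr_ge0 ?mulr_ge0 ?(ltW p0)//; exact: integral_expRN_0y.
rewrite [leRHS]integral_mkcond; apply: ge0_ae_le_integralW.
- by move=> t _; apply: integral_ge0 => s _; rewrite lee_fin !mulr_ge0 ?expR_ge0 ?kern_ge0.
- by move=> t _; rewrite patchE; case: ifP => // _; rewrite -EFinM lee_fin !mulr_ge0 ?expR_ge0 ?invr_ge0// ltW.
apply: aeW => t _; have [t0|t0] := leP t 0.
  rewrite integral0_eq; last first.
    move=> s _; have [ts|st] := leP t s; first by rewrite kern_out ?subr_le0// mulr0 mul0r.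
    by rewrite Eneg ?mulr0// ltW// (lt_le_trans st).
  by rewrite patchE; case: ifP => // _; rewrite -EFinM lee_fin !mulr_ge0 ?expR_ge0 ?invr_ge0// ltW.
rewrite patchE mem_set; last by rewrite /= in_itv/= ltW.
have -> : (\int[leb]_s (expR (- (p * t)) * kern 1 (t - s) * E s)%:E =
    (expR (- (p * t)))%:E * \int[leb]_(s in `]0%R, t[) (E s)%:E)%E.
  rewrite [in RHS]integral_mkcond -ge0_integralZl_EFin ?expR_ge0//; last 2 first.
  - by move=> s _; rewrite patchE; case: ifP => // _; rewrite lee_fin.
  - apply/(measurable_restrictT _ (measurable_itv _)); apply: measurable_funTS.
    exact/measurable_EFinP.
  apply: eq_integral => s _; rewrite patchE; case: ifPn => [|/negP].
    by rewrite inE/= in_itv/= => /andP[s0 st]; rewrite kernE ?subr_gt0// subrr powRr0 mulr1.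
  rewrite inE/= in_itv/= => /negP; rewrite negb_and -!leNgt => /orP[s0|st].
    by rewrite Eneg// mulr0 mule0.
  by rewrite kern_out ?subr_le0// mulr0 mul0r mule0.
apply: (@le_trans _ _ ((expR (- (p * t)))%:E * (K * t)%:E)%E).
  by apply: lee_wpmul2l; rewrite ?lee_fin ?expR_ge0// EK.
rewrite -!EFinM lee_fin.
have -> : expR (- (p * t)) = expR (- (p / 2 * t)) * expR (- (p / 2 * t)).
  by rewrite -expRD; congr expR; field.
have := expRxMexpNx_1 (p / 2 * t); have := expR_ge1Dx (p / 2 * t).
have := expR_ge0 (- (p / 2 * t)).
move: (expR (- (p / 2 * t))) (expR (p / 2 * t)) => x y x0 yt xy.
have tx : t * x <= 2 / p.
  have h : p / 2 * t * x <= 1.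
    have /(ler_wpM2r x0) : p / 2 * t <= y by apply: le_trans yt; rewrite lerDr.
    by rewrite xy.
  rewrite ler_pdivlMr// (_ : t * x * p = 2 * (p / 2 * t * x)); last by field.
  by rewrite -[leRHS]mulr1 ler_wpM2l.
rewrite (_ : x * x * (K * t) = (K * x) * (t * x)); last by ring.
rewrite (_ : 2 * K / p * x = K * x * (2 / p)); last by field; rewrite gt_eqF.
by rewrite ler_wpM2l// mulr_ge0.
Qed.
End kernel_convolution.

(** * Scalar functions of Bochner integrals *)

Lemma ae_imply2 d (T : measurableType d) (R : realType)
    (mu : {measure set T -> \bar R}) (P Q S : T -> Prop) :
  {ae mu, forall x, P x} -> {ae mu, forall x, Q x} -> (forall x, P x -> Q x -> S x) ->
  {ae mu, forall x, S x}.
Proof. by move=> aP aQ H; apply: filterS2 aP aQ. Qed.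

Section bochner_scalar.
Context {R : realType} {V : lmodType R}.
Variables (E : set V) (nrm : V -> R).
Local Notation leb := (@lebesgue_measure R).
Hypothesis E0 : E 0.
Hypothesis Elin : forall (c : R) u v, E u -> E v -> E (c *: u + v).
Hypothesis nrm_ge0 : forall v, 0 <= nrm v.

Lemma lincomb_closed n (c : 'I_n -> R) (v : 'I_n -> V) : (forall k, E (v k)) ->
  E (\sum_k c k *: v k).
Proof.
move=> Ev; apply: (big_ind E) => // [x y Ex Ey|k _]; first by rewrite -[x]scale1r; exact: Elin.
by rewrite -[_ *: _]addr0; exact: Elin.
Qed.

Lemma step_eval_closed (s : step_map) t : step_wf E s -> E (step_eval s t).
Proof. by move=> ws; apply: lincomb_closed => k; have [] := ws k. Qed.

Lemma subr_closed u v : E u -> E v -> E (u - v).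
Proof. by move=> Eu Ev; rewrite addrC -scaleN1r; exact: Elin. Qed.

Section linear.
Variable l : V -> R.
Hypothesis llin : forall c u v, E u -> E v -> l (c *: u + v) = c * l u + l v.

(** Linearity is assumed on [E] alone, because integrals of products are additive only for suitable
    functions; membership in [E] is therefore carried along the sum. *)
Lemma lincomb_linear n (c : 'I_n -> R) (v : 'I_n -> V) : (forall k, E (v k)) ->
  l (\sum_k c k *: v k) = \sum_k c k * l (v k).
Proof.
move=> Ev; suff : E (\sum_k c k *: v k) /\ l (\sum_k c k *: v k) = \sum_k c k * l (v k) by case.
have l0 : l 0 = 0.
  have := llin 1 E0 E0; rewrite scale1r addr0 mul1r => /eqP.
  by rewrite -subr_eq0 opprD addrA subrr sub0r oppr_eq0 => /eqP.
apply: (big_ind2 (fun x y => E x /\ l x = y)) => // [x1 x2 y1 y2 [Ex <-] [Ey <-]|k _].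
  split; first by rewrite -[x1]scale1r; exact: Elin.
  by rewrite -[in LHS](scale1r x1) llin// mul1r.
split; first by rewrite -[_ *: _]addr0; exact: Elin.
by rewrite -[in LHS](addr0 (c k *: v k)) llin// l0 addr0.
Qed.

Lemma linearB u v : E u -> E v -> l (u - v) = l u - l v.
Proof. by move=> Eu Ev; rewrite addrC -scaleN1r llin// mulN1r addrC. Qed.

Lemma step_eval_linear (s : step_map) t : step_wf E s ->
  l (step_eval s t) = \sum_k (\1_(@step_set _ _ s k) t : R) * l (@step_val _ _ s k).
Proof. by move=> ws; apply: lincomb_linear => k; have [] := ws k. Qed.

Lemma measurable_step_linear (s : step_map) : step_wf E s ->
  measurable_fun setT (fun t => l (step_eval s t)).
Proof.
move=> ws; under eq_fun do rewrite step_eval_linear//.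
apply: measurable_sum => k; apply: measurable_funM; last exact: measurable_cst.
by apply: measurable_indic; have [] := ws k.
Qed.

Lemma measurable_linear_limit C (D : set R) (s : nat -> step_map) (x : R -> V) :
  (forall v, E v -> `|l v| <= C * nrm v) ->
  (forall n, step_wf E (s n)) ->
  (forall t, D t -> E (x t) /\ (nrm (x t - step_eval (s n) t) @[n --> \oo] --> (0 : R))) ->
  measurable_fun D (fun t => l (x t)).
Proof.
move=> lC ws xs.
apply: (@measurable_fun_cvg _ _ R D (fun n t => l (step_eval (s n) t))) => [n|t Dt].
  by apply: measurable_funTS; exact: measurable_step_linear.
have [Ex xn] := xs t Dt.
have xn' : C * nrm (x t - step_eval (s n) t) @[n --> \oo] --> (0 : R).
  by rewrite -[X in _ --> X](mulr0 C); apply: cvgMr.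
apply/cvgrPdist_le => e e0.
have /cvgrPdist_le/(_ e e0) := xn'; apply: filterS => n; rewrite sub0r normrN => H.
have En := step_eval_closed t (ws n).
rewrite -linearB//; apply: (le_trans (lC _ (subr_closed Ex En))).
exact: le_trans (ler_norm _) H.
Qed.

Lemma step_integral_linear (D : set R) (s : step_map) : measurable D -> step_wf E s ->
  leb.-integrable D (EFin \o (fun t => l (step_eval s t))) /\
  (\int[leb]_(t in D) (l (step_eval s t))%:E = (l (step_integral D s))%:E)%E.
Proof.
move=> mD ws.
have EI : l (step_integral D s) = \sum_k fine (leb (@step_set _ _ s k `&` D)) * l (@step_val _ _ s k).
  by apply: lincomb_linear => k; have [] := ws k.
have mA k : measurable (@step_set _ _ s k) by have [] := ws k.
have fA k : (leb (@step_set _ _ s k `&` D) < +oo)%E.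
  apply: le_lt_trans (_ : leb (@step_set _ _ s k) < +oo)%E; last by have [] := ws k.
  by apply: le_measure; rewrite ?inE//; exact: measurableI.
have ik k : leb.-integrable D (fun t => (\1_(@step_set _ _ s k) t : R)%:E).
  apply/integrableP; split.
    by apply/measurable_EFinP; apply: measurable_indic.
  under eq_integral => t _ do rewrite gee0_abs ?lee_fin//.
  by rewrite integral_indic//; exact: fA.
have ikl k : leb.-integrable D (fun t => ((l (@step_val _ _ s k))%:E * (\1_(@step_set _ _ s k) t : R)%:E)%E).
  exact: integrableZl.
have hE : (EFin \o (fun t => l (step_eval s t))) =
    (fun t => \sum_k ((l (@step_val _ _ s k))%:E * (\1_(@step_set _ _ s k) t : R)%:E)%E)%E.
  apply/funext => t /=; rewrite step_eval_linear// -sumEFin; apply: eq_bigr => k _.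
  by rewrite -EFinM mulrC.
split; first by rewrite hE; apply: integrable_sum.
rewrite -[LHS]/(\int[leb]_(t in D) (EFin \o (fun t => l (step_eval s t))) t)%E hE integral_sum//.
rewrite EI -sumEFin; apply: eq_bigr => k _.
rewrite integralZl// integral_indic// muleC EFinM fineK// ge0_fin_numE//.
Qed.

(** A bounded functional commutes with the integral on step maps, and its error is controlled by the
    distances that tend to 0. The function [g] is a measurable representative of [l \o F], which the
    approximation determines only almost everywhere. *)
Lemma bochner_integral_linear C (D : set R) (F : R -> V) (I : V) (g : R -> R) :
  measurable D -> 0 < C -> (forall v, E v -> `|l v| <= C * nrm v) ->
  bochner_integral E nrm D F I -> measurable_fun D g ->
  {ae leb, forall t, D t -> g t = l (F t)} ->
  leb.-integrable D (EFin \o g) /\ (\int[leb]_(t in D) (g t)%:E = (l I)%:E)%E.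
Proof.
move=> mD C0 lC [EI [s [[ws xs] int0 lim0]]] mg gF.
pose h n t := l (step_eval (s n) t).
pose r n := (\int[leb]_(t in D) (nrm (F t - step_eval (s n) t))%:E)%E.
have mh n : measurable_fun D (h n) by apply: measurable_funTS; exact: measurable_step_linear.
have mgh n : measurable_fun D (fun t => `|g t - h n t|).
  by apply: (measurableT_comp (@normr_measurable R setT)); exact: measurable_funB.
have gh n : (\int[leb]_(t in D) (`|g t - h n t|)%:E <= C%:E * r n)%E.
  (* The constant is extracted on the side known to be measurable; nothing of the kind is known
     about the integrand of [r n]. *)
  have -> : (\int[leb]_(t in D) (`|g t - h n t|)%:E = C%:E * \int[leb]_(t in D) (C^-1 * `|g t - h n t|)%:E)%E.
    rewrite -ge0_integralZl_EFin ?(ltW C0)//.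
    - by apply: eq_integral => t _; rewrite -EFinM mulrA divff ?mul1r// gt_eqF.
    - by move=> t _; rewrite lee_fin mulr_ge0 ?invr_ge0// ltW.
    - by apply/measurable_EFinP; apply: measurable_funM; [exact: measurable_cst|exact: mgh].
  apply: lee_wpmul2l; first by rewrite lee_fin ltW.
  apply: ge0_ae_le_integralW => [t _|t _|]; rewrite ?lee_fin ?mulr_ge0 ?invr_ge0 ?(ltW C0)//.
  refine (@ae_imply2 _ _ _ leb _ _ _ gF xs _) => t gt xt Dt; have [Ex _] := xt Dt.
  have En := step_eval_closed t (ws n).
  rewrite lee_fin gt// /h -linearB// mulrC ler_pdivrMr// mulrC.
  exact: lC (subr_closed Ex En).
have near_e e : 0 < e -> exists n, (r n <= e%:E)%E /\ nrm (I - step_integral D (s n)) <= e.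
  move=> e0; have /fine_cvgP[fin /cvgrPdist_le/(_ e e0) rn] := int0.
  have /cvgrPdist_le/(_ e e0) In := lim0.
  have [n [[fn rn'] In']] := @filter_ex _ _ _ _ (filterI (filterI fin rn) In).
  exists n; split.
    rewrite /r -(fineK fn) lee_fin; move: rn'; rewrite sub0r normrN; exact: le_trans (ler_norm _).
  by move: In'; rewrite sub0r normrN; exact: le_trans (ler_norm _).
have igh n e : (r n <= e%:E)%E -> leb.-integrable D (EFin \o (fun t => g t - h n t)).
  move=> rn; apply/integrableP; split.
    by apply/measurable_EFinP; exact: (measurable_funB mg (mh n)).
  apply: (le_lt_trans (gh n)); apply: (@le_lt_trans _ _ (C%:E * e%:E)%E).
    by apply: lee_wpmul2l => //; rewrite lee_fin ltW.
  by rewrite -EFinM ltry.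
have gE n : EFin \o g = ((EFin \o h n) \+ (EFin \o (fun t => (g t - h n t)%R)))%E.
  by apply/funext => t /=; rewrite -EFinD addrC subrK.
have ig : leb.-integrable D (EFin \o g).
  have [n [rn _]] := near_e _ (ltr01).
  have [ih _] := step_integral_linear mD (ws n).
  by rewrite (gE n); apply: integrableD => //; exact: igh rn.
split=> //.
have fg : (\int[leb]_(t in D) (EFin \o g) t)%E \is a fin_num by exact: integrable_fin_num.
rewrite -[LHS](fineK fg); congr EFin; apply/eqP; rewrite -subr_eq0 -normr_le0.
apply: (@ler_small _ _ (C + C)) => [|e e0]; first by rewrite addr_ge0// ltW.
have [n [rn In]] := near_e _ e0.
have [ih Ih] := step_integral_linear mD (ws n).
have Esi : E (step_integral D (s n)) by apply: lincomb_closed => k; have [] := ws n k.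
have ign := igh _ _ rn.
have fign : (\int[leb]_(t in D) (EFin \o (fun t => (g t - h n t)%R)) t)%E \is a fin_num.
  exact: integrable_fin_num.
rewrite -[fine _]/(fine (\int[leb]_(t in D) (EFin \o g) t)%E).
have -> : fine (\int[leb]_(t in D) (EFin \o g) t)%E =
    l (step_integral D (s n)) + fine (\int[leb]_(t in D) (EFin \o (fun t => (g t - h n t)%R)) t)%E.
  by rewrite {1}(gE n) integralD// Ih fineD.
rewrite addrAC mulrDl; apply: (le_trans (ler_normD _ _)); apply: lerD.
  rewrite -normrN opprB -linearB//; apply: (le_trans (lC _ (subr_closed EI Esi))).
  by rewrite ler_pM2l.
rewrite -lee_fin -abse_EFin fineK//.
apply: (@le_trans _ _ (\int[leb]_(t in D) `|(EFin \o (fun t => (g t - h n t)%R)) t|)%E).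
  by apply: le_abse_integral => //; exact: measurable_int ign.
apply: (le_trans (gh n)); rewrite EFinM.
by apply: lee_wpmul2l => //; rewrite lee_fin ltW.
Qed.
End linear.

Section bilinear.
Variables (b : V -> V -> R) (C : R).
Hypothesis blinl : forall c u v w, E u -> E v -> E w -> b (c *: u + v) w = c * b u w + b v w.
Hypothesis blinr : forall c u v w, E u -> E v -> E w -> b w (c *: u + v) = c * b w u + b w v.
Hypothesis bC : forall u v, E u -> E v -> `|b u v| <= C * nrm u * nrm v.

Lemma step_eval_bilinear (s : step_map) t t' : step_wf E s ->
  b (step_eval s t) (step_eval s t') = \sum_k \sum_j
    (\1_(@step_set _ _ s k) t : R) * (\1_(@step_set _ _ s j) t' : R) *
    b (@step_val _ _ s k) (@step_val _ _ s j).
Proof.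
move=> ws; have Ev := step_eval_closed t' ws.
rewrite (@step_eval_linear (b^~ (step_eval s t'))) => [|c u v Eu Ev'|//]; last exact: blinl.
apply: eq_bigr => k _; have [_ _ Ek] := ws k.
rewrite (@step_eval_linear (b (step_val k))) => [|c u v Eu Ev'|//]; last exact: blinr.
by rewrite mulr_sumr; apply: eq_bigr => j _; rewrite mulrA.
Qed.

Lemma measurable_step_bilinear (s : step_map) : step_wf E s ->
  measurable_fun [set: R * R] (fun z => b (step_eval s z.1) (step_eval s z.2)).
Proof.
move=> ws; under eq_fun do rewrite step_eval_bilinear//.
apply: measurable_sum => k; apply: measurable_sum => j.
have mk : measurable (@step_set _ _ s k) by have [] := ws k.
have mj : measurable (@step_set _ _ s j) by have [] := ws j.
apply: measurable_funM; last exact: measurable_cst.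
apply: measurable_funM; first exact: (measurable_comp_fst (measurable_indic mk)).
exact: (measurable_comp_snd (measurable_indic mj)).
Qed.

Lemma cvg_bilinear (u v : V) (un vn : nat -> V) : E u -> E v ->
  (forall n, E (un n)) -> (forall n, E (vn n)) ->
  nrm (u - un n) @[n --> \oo] --> (0 : R) -> nrm (v - vn n) @[n --> \oo] --> (0 : R) ->
  b (un n) (vn n) @[n --> \oo] --> b u v.
Proof.
move=> Eu Ev Eun Evn uu vv.
have bnd : C * nrm (u - un n) * nrm v + C * nrm u * nrm (v - vn n)
    + C * nrm (u - un n) * nrm (v - vn n) @[n --> \oo] --> (0 : R).
  rewrite (_ : 0 = C * 0 * nrm v + C * nrm u * 0 + C * 0 * 0); last by ring.
  exact: cvgD (cvgD (cvgM (cvgM (cvg_cst C) uu) (cvg_cst (nrm v)))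
    (cvgM (cvg_cst (C * nrm u)) vv)) (cvgM (cvgM (cvg_cst C) uu) vv).
apply/cvgrPdist_le => e e0.
have /cvgrPdist_le/(_ e e0) := bnd; apply: filterS => n; rewrite sub0r normrN => H.
have Edu := subr_closed Eu (Eun n); have Edv := subr_closed Ev (Evn n).
have bBl x y z : E x -> E y -> E z -> b (x - y) z = b x z - b y z.
  by move=> *; rewrite (@linearB (b^~ z)) // => c x' y' *; exact: blinl.
have bBr x y z : E x -> E y -> E z -> b z (x - y) = b z x - b z y.
  by move=> *; rewrite (@linearB (b z)) // => c x' y' *; exact: blinr.
(* Only the limits and the differences appear, so no bound on the approximating sequences is
   needed. *)
have -> : b u v - b (un n) (vn n) = b (u - un n) v + b u (v - vn n) - b (u - un n) (v - vn n).
  by rewrite !bBl// !bBr//; ring.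
apply: le_trans (le_trans (ler_norm _) H).
apply: (le_trans (ler_normB _ _)); apply: lerD; last exact: bC.
by apply: (le_trans (ler_normD _ _)); apply: lerD; exact: bC.
Qed.

Lemma measurable_quadratic_limit (D : set R) (s : nat -> step_map) (x : R -> V) :
  (forall n, step_wf E (s n)) ->
  (forall t, D t -> E (x t) /\ (nrm (x t - step_eval (s n) t) @[n --> \oo] --> (0 : R))) ->
  measurable_fun D (fun t : R => b (x t) (x t)).
Proof.
move=> ws xs.
apply: (@measurable_fun_cvg _ _ R D
  (fun n t => b (step_eval (s n) t) (step_eval (s n) t))) => [n|t Dt].
  have mdiag : measurable_fun [set: R] (fun t : R => (t, t) : R * R).
    by apply: measurable_fun_pair; exact: measurable_id.
  by apply: measurable_funTS; exact: (measurableT_comp (measurable_step_bilinear (ws n)) mdiag).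
have [Ex xn] := xs t Dt.
by apply: cvg_bilinear => // n; exact: step_eval_closed.
Qed.

End bilinear.
End bochner_scalar.

(** * Positivity of the fractional derivative *)

Section frac_positivity.
Context {R : realType} {N : nat} (Omega : set 'rV[R]_N).
Hypothesis oO : open Omega.
Local Notation fct := ('rV[R]_N -> R).
Local Notation leb := (@lebesgue_measure R).
Local Notation leb2 := (leb \x leb)%E.
Local Notation L2 := (L2 Omega).
Local Notation inner := (inner Omega).
Local Notation norm2 := (norm2 Omega).

Let mO : measurable Omega. Proof. exact: open_measurable_rV. Qed.

Let L2_0 : L2 0. Proof. exact: L20. Qed.

Let Llin (c : R) (u v : fct) : L2 u -> L2 v -> L2 (c *: u + v).
Proof. exact: L2_lin. Qed.

Let ilinl (c : R) (u v w : fct) : L2 u -> L2 v -> L2 w ->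
  inner (c *: u + v) w = c * inner u w + inner v w.
Proof. exact: inner_linl. Qed.

Let ilinr (c : R) (u v w : fct) : L2 u -> L2 v -> L2 w ->
  inner w (c *: u + v) = c * inner w u + inner w v.
Proof. exact: inner_linr. Qed.

Let iC (u v : fct) : L2 u -> L2 v -> `|inner u v| <= 1 * norm2 u * norm2 v.
Proof. by move=> Lu Lv; rewrite mul1r; exact: inner_CauchySchwarz. Qed.

(* Pointwise in the space variable this is [kernel_positive]. *)
Lemma step_kernel_positive (a T : R) (s : @step_map R fct) (B : set R) :
  0 < a < 1 -> 0 < T -> step_wf L2 s -> measurable B -> B `<=` `]0, T[%classic ->
  (0 <= \int[leb2]_z ((\1_B z.1 : R) * (\1_B z.2 : R) *
     inner (step_eval s z.1) (step_eval s z.2) * kern a (z.1 - z.2))%:E)%E.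
Proof.
move=> a01 T0 ws mB BT.
pose f k (t : R) : R := (\1_(@step_set _ _ s k) t : R) * (\1_B t : R).
pose v k : fct := @step_val _ _ s k.
have Lv k : L2 (v k) by have [] := ws k.
have mf k : measurable_fun setT (f k).
  by apply: measurable_funM; apply: measurable_indic => //; have [] := ws k.
have fT k x : x \notin `]0, T[ -> f k x = 0.
  move=> xT; rewrite /f [X in _ * X]indicE memNset ?mulr0// => /BT /=.
  by rewrite (negbTE xT).
have mf2 k : measurable_fun setT (fun t => f k t ^+ 2).
  by apply: measurable_funX; exact: mf.
have i01 (A : set R) t : 0 <= (\1_A t : R) <= 1 by rewrite indicE; case: (_ \in _); rewrite ?lexx ?ler01.
have f2 k : (\int[leb]_t (f k t ^+ 2)%:E < +oo)%E.
  apply: (@le_lt_trans _ _ (\int[leb]_t (\1_(`]0%R, T[%classic) t : R)%:E)%E); last first.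
    by rewrite integral_indic//= setIT lebesgue_measure_itv/= lte_fin T0 -EFinD ltry.
  apply: ge0_le_integral => //.
  - by move=> t _; rewrite lee_fin sqr_ge0.
  - by apply/measurable_EFinP; exact: mf2.
  - by apply/measurable_EFinP; exact: measurable_indic.
  - move=> t _; rewrite lee_fin; have [tT|tT] := boolP (t \in `]0, T[); last first.
      by rewrite fT// expr0n/= (proj1 (andP (i01 _ _))).
    rewrite [leRHS]indicE mem_set//= /f exprMn; have /andP[x0 x1] := i01 (@step_set _ _ s k) t.
    by have /andP[y0 y1] := i01 B t; rewrite mulr_ile1 ?sqr_ge0 ?expr_le1.
pose G k j (z : R * R) : \bar R := (f k z.1 * f j z.2 * kern a (z.1 - z.2))%:E.
have iG k j : leb2.-integrable setT (G k j) by exact: kernel_integrable (fT k) (fT j) (f2 k) (f2 j).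
have iZ r k j : leb2.-integrable setT (fun z => r%:E * G k j z)%E.
  by apply: integrableZl; [exact: measurableT|exact: iG].
pose K k j := fine (\int[leb2]_z G k j z)%E.
have KE k j : (\int[leb2]_z G k j z = (K k j)%:E)%E.
  by rewrite /K fineK//; exact: integrable_fin_num.
have sumE (c : 'I_(step_size s) -> 'I_(step_size s) -> R) :
    (\int[leb2]_z (\sum_k \sum_j (c k j)%:E * G k j z) = (\sum_k \sum_j c k j * K k j)%:E)%E.
  rewrite integral_sum//; last first.
    by move=> k; apply: integrable_sum => // j; exact: iZ.
  rewrite -sumEFin; apply: eq_bigr => k _; rewrite integral_sum//.
  by rewrite -sumEFin; apply: eq_bigr => j _; rewrite integralZl// KE.
have -> : (\int[leb2]_z ((\1_B z.1 : R) * (\1_B z.2 : R) *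
     inner (step_eval s z.1) (step_eval s z.2) * kern a (z.1 - z.2))%:E)%E =
   (\int[leb2]_z (\sum_k \sum_j (inner (v k) (v j))%:E * G k j z))%E.
  apply: eq_integral => z _.
  have -> : (\sum_k \sum_j (inner (v k) (v j))%:E * G k j z =
     (\sum_k \sum_j inner (v k) (v j) * (f k z.1 * f j z.2 * kern a (z.1 - z.2)))%:E)%E.
    by rewrite -sumEFin; apply: eq_bigr => k _; rewrite -sumEFin.
  congr EFin; rewrite (step_eval_bilinear L2_0 Llin ilinl ilinr)//.
  rewrite mulr_sumr mulr_suml; apply: eq_bigr => k _.
  by rewrite mulr_sumr mulr_suml; apply: eq_bigr => j _; rewrite /f /v; ring.
rewrite sumE.
(* For finite sums the time and space integrals may be exchanged: the quadratic form with matrix [K]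
   in the inner products is the integral over [Omega] of the same form in the values at [x]. *)
pose W k : fct := fun x => \sum_j K k j * v j x.
have LW k : L2 (W k) by apply: L2_sum => // j; exact: L2Z.
have -> : (\sum_k \sum_j inner (v k) (v j) * K k j)%:E =
    (\int[@lebesgue_rV R N]_(x in Omega) (\sum_k (v k x * W k x)%:E))%E.
  rewrite integral_sum//; last by move=> k; exact: L2_integrable.
  rewrite -sumEFin; apply: eq_bigr => k _.
  have -> : (\int[@lebesgue_rV R N]_(x in Omega) (v k x * W k x)%:E = (inner (v k) (W k))%:E)%E.
    by rewrite /Defs.inner /Rintegral fineK//; apply: integrable_fin_num => //; exact: L2_integrable.
  congr EFin; rewrite innerC inner_suml//; last by move=> j; exact: L2Z.
  by apply: eq_bigr => j _; rewrite innerZl// mulrC innerC.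
apply: integral_ge0 => x _.
have := sumE (fun k j => v k x * v j x).
have -> : (\sum_k (v k x * W k x)%:E)%E = (\sum_k \sum_j v k x * v j x * K k j)%:E.
  rewrite -sumEFin; apply: eq_bigr => k _; congr EFin; rewrite mulr_sumr.
  by apply: eq_bigr => j _; ring.
(* The truncated step map at a fixed point [x], a bounded scalar function of time. *)
move=> <-; pose y t := \sum_k v k x * f k t.
have my : measurable_fun setT y.
  by apply: measurable_sum => k; apply: measurable_funM => //; exact: measurable_cst.
have yT t : t \notin `]0, T[ -> y t = 0.
  by move=> tT; rewrite /y big1// => k _; rewrite fT ?mulr0.
pose M := \sum_k `|v k x|.
have M0 : 0 <= M by apply: sumr_ge0.
have yM t : y t ^+ 2 <= M ^+ 2 * (\1_(`]0%R, T[%classic) t : R).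
  have [tT|tT] := boolP (t \in `]0, T[); last first.
    by rewrite yT// expr0n/= mulr_ge0 ?sqr_ge0// (proj1 (andP (i01 _ _))).
  rewrite indicE mem_set//= mulr1 -real_normK ?num_real// lerXn2r ?nnegrE//.
  apply: (le_trans (ler_norm_sum _ _ _)); apply: ler_sum => k _.
  rewrite normrM ler_piMr// /f normrM mulr_ile1//.
    by have /andP[? ?] := i01 (@step_set _ _ s k) t; rewrite ger0_norm.
  by have /andP[? ?] := i01 B t; rewrite ger0_norm.
have y2 : (\int[leb]_t (y t ^+ 2)%:E < +oo)%E.
  apply: (@le_lt_trans _ _ (\int[leb]_t ((M ^+ 2)%:E * (\1_(`]0%R, T[%classic) t : R)%:E))%E); last first.
    rewrite ge0_integralZl_EFin ?sqr_ge0//; last first.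
      by apply/measurable_EFinP; exact: measurable_indic.
    by rewrite integral_indic//= setIT lebesgue_measure_itv/= lte_fin T0 -EFinD -EFinM ltry.
  apply: ge0_le_integral => //.
  - by move=> t _; rewrite lee_fin sqr_ge0.
  - by apply/measurable_EFinP; exact: measurable_funX.
  - apply/measurable_EFinP; apply: measurable_funM; first exact: measurable_cst.
    exact: measurable_indic.
  - by move=> t _; rewrite -EFinM lee_fin.
have := kernel_positive a01 T0 my yT y2.
congr (_ <= _)%E; apply: eq_integral => z _.
have -> : (\sum_k \sum_j (v k x * v j x)%:E * G k j z =
   (\sum_k \sum_j v k x * v j x * (f k z.1 * f j z.2 * kern a (z.1 - z.2)))%:E)%E.
  by rewrite -sumEFin; apply: eq_bigr => k _; rewrite -sumEFin.
congr EFin; rewrite /y mulr_suml mulr_suml; apply: eq_bigr => k _.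
by rewrite mulr_sumr mulr_suml; apply: eq_bigr => j _; ring.
Qed.

(** Removing one null set yields a set [D] on which the step maps converge at every point. There the
    squared norm is a limit of measurable functions, so [rho], the norm extended by 0, is measurable
    and square integrable on the whole line. *)
Lemma bochner_L2_truncation (T : R) (w : R -> fct) : 0 < T ->
  bochner_L2 L2 norm2 `]0, T[ w ->
  exists (D : set R) (s : nat -> step_map) (rho : R -> R),
  [/\ [/\ measurable D, D `<=` `]0, T[%classic & leb (`]0, T[%classic `\` D) = 0%E],
      (forall n, step_wf L2 (s n)) /\ (forall t, D t -> L2 (w t) /\
        (norm2 (w t - step_eval (s n) t) @[n --> \oo] --> (0 : R))),
      [/\ measurable_fun setT rho, (forall t, 0 <= rho t),
        (forall t, D t -> rho t = norm2 (w t)) & (forall t, ~ D t -> rho t = 0)] &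
      (\int[leb]_t (rho t ^+ 2)%:E < +oo)%E].
Proof.
move=> T0 [[s [ws [Nu [mNu Nu0 sNu]]]] wfin].
pose D := `]0, T[%classic `\` Nu.
have mD : measurable D by exact: measurableD.
have xs t : D t -> L2 (w t) /\ (norm2 (w t - step_eval (s n) t) @[n --> \oo] --> (0 : R)).
  by move=> [Dt Nt]; apply: contrapT => H; apply: Nt; apply: sNu => /= /(_ Dt).
have mq : measurable_fun D (fun t => inner (w t) (w t)).
  exact: (@measurable_quadratic_limit R fct L2 norm2 L2_0 Llin inner 1 ilinl ilinr iC D s w ws xs).
pose rho := (fun t => Num.sqrt (inner (w t) (w t))) \_ D.
have rhoE t : D t -> rho t = norm2 (w t).
  by move=> Dt; rewrite /rho patchE mem_set// norm2_inner//; have [] := xs t Dt.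
have rho0 t : ~ D t -> rho t = 0 by move=> Dt; rewrite /rho patchE memNset.
exists D, s, rho; split.
- split=> //; first by move=> t [].
  rewrite setDD; apply: (@subset_measure0 _ _ _ leb _ Nu) => //; first exact: measurableI.
- by [].
- split=> //; last by move=> t; rewrite /rho patchE; case: ifP => // _; rewrite sqrtr_ge0.
  apply/(measurable_restrictT _ mD).
  have msqrt : measurable_fun setT (@Num.sqrt R) by exact: (continuous_measurable_fun (@sqrt_continuous R)).
  exact: (measurableT_comp msqrt mq).
- move: wfin; rewrite unlock /=.
  have -> : (\int[leb]_x (`|((norm2 \o w) \_ `]0, T[) x| `^ 2)%:E = \int[leb]_t (rho t ^+ 2)%:E)%E.
    apply: ae_eq_integralW; exists Nu; split=> // t /= H; apply: contrapT => Nt; apply: H => _.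
    rewrite patchE; case: ifPn => [|/negP] tT.
      rewrite inE in tT; rewrite rhoE//= ger0_norm ?norm2_ge0//.
      by rewrite powR_mulrn ?norm2_ge0.
    rewrite rho0 ?normr0 ?powR0// ?expr0n//.
    by move=> [Dt _]; apply: tT; rewrite inE.
  by apply: lty_poweRy; rewrite invr_eq0.
Qed.

(** Since [z] is the fractional integral of [w], the pairing of [w] with [z] is a double integral
    against the kernel, nonnegative for step maps and hence in the limit. [Y] is its inner integral,
    an integrable representative of a function known only almost everywhere. *)
Lemma frac_derivative_positive (a T : R) (z w : R -> fct) : 0 < a < 1 -> 0 < T ->
  frac_derivative Omega a T z w ->
  exists Y : R -> \bar R, [/\ leb.-integrable `]0, T[ Y,
    (0 <= \int[leb]_(t in `]0%R, T[) Y t)%E &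
    {ae leb, forall t, `]0, T[%classic t -> Y t = (Gamma a * inner (w t) (z t))%:E}].
Proof.
move=> a01 T0 [wL2 zw]; have /andP[a0 a1] := a01.
have ind0 (A : set R) t : ~ A t -> (\1_A t : R) = 0 by move=> At; rewrite indicE memNset.
have ind1 (A : set R) t : A t -> (\1_A t : R) = 1 by move=> At; rewrite indicE mem_set.
have [D [s [rho [[mD DT D0] [ws xs] [mrho rho_ge0 rhoE rho0] rho2]]]] :=
  bochner_L2_truncation T0 wL2.
have Ls n t : L2 (step_eval (s n) t) by exact: (step_eval_closed L2_0 Llin).
have mdiag : measurable_fun [set: R] (fun t : R => (t, t) : R * R).
  by apply: measurable_fun_pair; exact: measurable_id.
have mss n := @measurable_step_bilinear R fct L2 L2_0 Llin inner ilinl ilinr (s n) (ws n).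
have mns n : measurable_fun setT (fun t => norm2 (step_eval (s n) t)).
  under eq_fun do rewrite norm2_inner//.
  have msqrt : measurable_fun setT (@Num.sqrt R) by exact: (continuous_measurable_fun (@sqrt_continuous R)).
  exact: (measurableT_comp msqrt (measurableT_comp (mss n) mdiag)).
(* Pointwise convergence provides no dominating function. Restricting the n-th step map to times
   where its norm is at most [rho + 1] creates one, and each point of [D] lies in [B n] for all
   large [n]. *)
pose B n := D `&` ((fun t => rho t + 1 - norm2 (step_eval (s n) t)) @^-1` `[0, +oo[%classic).
have mB n : measurable (B n).
  apply: measurableI => //; rewrite -[X in measurable X]setTI.
  have mf : measurable_fun setT (fun t => rho t + 1 - norm2 (step_eval (s n) t)).
    by apply: measurable_funB; [apply: measurable_funD; [exact: mrho|exact: measurable_cst]|exact: mns].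
  exact: (mf measurableT _ (measurable_itv _)).
have BD n t : B n t -> D t by case.
have BT n : B n `<=` `]0, T[%classic by move=> t /BD /DT.
have Brho n t : B n t -> norm2 (step_eval (s n) t) <= rho t + 1.
  by move=> [_]; rewrite /= in_itv/= andbT subr_ge0.
have nearB t : D t -> \forall n \near \oo, B n t.
  move=> Dt; have [Lw /cvgrPdist_le/(_ 1 ltr01)] := xs t Dt; apply: filterS => n.
  rewrite sub0r normrN ger0_norm ?norm2_ge0// => H; split=> //=.
  rewrite in_itv/= andbT subr_ge0 rhoE//.
  have {1}-> : step_eval (s n) t = w t - (w t - step_eval (s n) t) by rewrite opprB addrC subrK.
  have Ld : L2 (w t - step_eval (s n) t) by exact: L2B.
  by apply: (le_trans (norm2B _ Lw Ld)) => //; rewrite lerD2l.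
pose Gn n (x : R * R) : \bar R := ((\1_(B n) x.1 : R) * (\1_(B n) x.2 : R) *
  inner (step_eval (s n) x.1) (step_eval (s n) x.2) * kern a (x.1 - x.2))%:E.
pose G (x : R * R) : \bar R := ((\1_D x.1 : R) * (\1_D x.2 : R) *
  inner (w x.1) (w x.2) * kern a (x.1 - x.2))%:E.
have mGn n : measurable_fun setT (Gn n).
  apply/measurable_EFinP; apply: measurable_funM; last first.
    exact: (measurable_kern2 a measurable_fst_R measurable_snd_R).
  apply: measurable_funM; last exact: mss.
  apply: measurable_funM; first exact: (measurable_comp_fst (measurable_indic (mB n))).
  exact: (measurable_comp_snd (measurable_indic (mB n))).
have cvgG x : Gn n x @[n --> \oo] --> G x.
  have out : ~ (D x.1 /\ D x.2) -> Gn n x @[n --> \oo] --> G x.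
    move=> nD; have GnE n : Gn n x = 0%E.
      rewrite /Gn; have [B1|B1] := pselect (B n x.1); last by rewrite (ind0 _ _ B1) !mul0r.
      have [B2|B2] := pselect (B n x.2); last by rewrite (ind0 _ _ B2) mulr0 !mul0r.
      by exfalso; apply: nD; split; [exact: BD B1|exact: BD B2].
    have -> : G x = 0%E.
      rewrite /G; have [B1|B1] := pselect (D x.1); last by rewrite (ind0 _ _ B1) !mul0r.
      have [B2|B2] := pselect (D x.2); last by rewrite (ind0 _ _ B2) mulr0 !mul0r.
      by exfalso; apply: nD.
    by under eq_fun do rewrite GnE; exact: cvg_cst.
  have [[D1 D2]|nD] := pselect (D x.1 /\ D x.2); last exact: out nD.
  have [L1 c1] := xs _ D1; have [L2' c2] := xs _ D2.
  apply: cvg_EFin; first by apply: nearW.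
  rewrite /= (ind1 _ _ D1) (ind1 _ _ D2) !mul1r.
  have lim : inner (step_eval (s n) x.1) (step_eval (s n) x.2) * kern a (x.1 - x.2) @[n --> \oo] -->
      inner (w x.1) (w x.2) * kern a (x.1 - x.2).
    apply: cvgMl.
    exact: (@cvg_bilinear R fct L2 norm2 Llin inner 1 ilinl ilinr iC _ _ _ _ L1 L2' (Ls^~ _) (Ls^~ _) c1 c2).
  apply: cvg_trans lim; apply: near_eq_cvg.
  apply: filterS2 (nearB _ D1) (nearB _ D2) => n B1 B2.
  by rewrite /= (ind1 _ _ B1) (ind1 _ _ B2) !mul1r.
have mG : measurable_fun setT G.
  by apply: (@emeasurable_fun_cvg _ _ R setT Gn G mGn) => x _; exact: cvgG.
(* Square integrable and supported in []0, T[], so [kernel_integrable] applies to the dominating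
   function [g]. *)
pose r t := (rho t + 1) * (\1_(`]0%R, T[%classic) t : R).
have i01 (A : set R) t : 0 <= (\1_A t : R) <= 1.
  by rewrite indicE; case: (_ \in _); rewrite ?lexx ?ler01.
have mr : measurable_fun setT r.
  apply: measurable_funM; last exact: measurable_indic.
  by apply: measurable_funD; [exact: mrho|exact: measurable_cst].
have rT t : t \notin `]0, T[ -> r t = 0.
  by move=> tT; rewrite /r ind0 ?mulr0//=; exact/negP.
have r2 : (\int[leb]_t (r t ^+ 2)%:E < +oo)%E.
  apply: (@le_lt_trans _ _ (\int[leb]_t (2%:E * (rho t ^+ 2)%:E + 2%:E * (\1_(`]0%R, T[%classic) t : R)%:E))%E).
    apply: ge0_le_integral => //.
    - by move=> t _; rewrite lee_fin sqr_ge0.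
    - by apply/measurable_EFinP; apply: measurable_funX.
    - apply: emeasurable_funD; apply/measurable_EFinP; apply: measurable_funM;
        [exact: measurable_cst|exact: measurable_funX|exact: measurable_cst|exact: measurable_indic].
    - move=> t _; rewrite -!EFinM -EFinD lee_fin /r indicE.
      by case: (_ \in _); have := sqr_ge0 (rho t - 1); have := sqr_ge0 (rho t); rewrite ?mulr1 ?mulr0; lra.
  have mrho2 : measurable_fun setT (fun t => (rho t ^+ 2)%:E).
    by apply/measurable_EFinP; exact: measurable_funX.
  have mind : measurable_fun setT (fun t => (\1_(`]0%R, T[%classic) t : R)%:E).
    by apply/measurable_EFinP; exact: measurable_indic.
  have rho20 t : setT t -> (0 <= (rho t ^+ 2)%:E)%E by rewrite lee_fin sqr_ge0.
  have ind_ge0 t : setT t -> (0 <= (\1_(`]0%R, T[%classic) t : R)%:E)%E.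
    by rewrite lee_fin (proj1 (andP (i01 _ _))).
  have two0 : 0 <= (2 : R) by [].
  have A0 t : setT t -> (0 <= 2%:E * (rho t ^+ 2)%:E)%E by move=> /rho20 ?; exact: mule_ge0.
  have B0 t : setT t -> (0 <= 2%:E * (\1_(`]0%R, T[%classic) t : R)%:E)%E.
    by move=> /ind_ge0 ?; exact: mule_ge0.
  rewrite (ge0_integralD leb measurableT A0 (measurable_funeM _ mrho2) B0 (measurable_funeM _ mind)).
  rewrite !ge0_integralZl_EFin//.
  have fin : (\int[leb]_t (rho t ^+ 2)%:E)%E \is a fin_num.
    by rewrite ge0_fin_numE//; apply: integral_ge0 => t _; rewrite lee_fin sqr_ge0.
  rewrite -(fineK fin) integral_indic//= setIT lebesgue_measure_itv/= lte_fin T0.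
  by rewrite -!EFinM -EFinD ltry.
pose g (x : R * R) : \bar R := (r x.1 * r x.2 * kern a (x.1 - x.2))%:E.
have ig : leb2.-integrable setT g by exact: (kernel_integrable a01 T0 mr mr rT rT r2 r2).
have r0 t : 0 <= r t by rewrite mulr_ge0 ?addr_ge0// (proj1 (andP (i01 _ _))).
have bound n x : (`|Gn n x| <= g x)%E.
  rewrite /Gn /g abse_EFin lee_fin normrM (ger0_norm (kern_ge0 _ _)) ler_wpM2r ?kern_ge0//.
  have [B1|B1] := pselect (B n x.1); last by rewrite (ind0 _ _ B1) !mul0r normr0 mulr_ge0.
  have [B2|B2] := pselect (B n x.2); last by rewrite (ind0 _ _ B2) mulr0 mul0r normr0 mulr_ge0.
  rewrite (ind1 _ _ B1) (ind1 _ _ B2) !mul1r /r (ind1 _ _ (BT _ _ B1)) (ind1 _ _ (BT _ _ B2)) !mulr1.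
  apply: (le_trans (inner_CauchySchwarz mO (Ls n _) (Ls n _))).
  by apply: ler_pM; rewrite ?norm2_ge0// Brho.
have aeG : {ae leb2, forall x, setT x -> Gn n x @[n --> \oo] --> G x}.
  by apply: aeW => x _; exact: cvgG.
have aeg : {ae leb2, forall x, forall n, setT x -> (`|Gn n x| <= g x)%E}.
  by apply: aeW => x n _; exact: bound.
have [iG _ limG] := @dominated_convergence _ _ R leb2 setT measurableT Gn G g mGn mG aeG ig aeg.
have G0 : (0 <= \int[leb2]_x G x)%E.
  rewrite -(cvg_lim _ limG)//; apply: lime_ge; first by apply/cvg_ex; eexists; exact: limG.
  apply: nearW => n; exact: step_kernel_positive a01 T0 (ws n) (mB n) (@BT n).
have Fout t : ~ D t -> fubini_F leb G t = 0%E.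
  move=> Dt; rewrite /fubini_F integral0_eq// => y _.
  by rewrite /G/= (ind0 _ _ Dt) !mul0r.
exists (fubini_F leb G); split.
- by apply: (integrableS measurableT) => //; exact: integrable_fubini_F.
- move: G0; rewrite -(integral12_prod_meas1 iG); congr (_ <= _)%E.
  rewrite [RHS]integral_mkcond; apply: eq_integral => t _; rewrite patchE.
  by case: ifPn => // /negP; rewrite inE => tT; apply: Fout => /DT.
have aeD : {ae leb, forall t, `]0, T[%classic t -> D t}.
  exists (`]0, T[%classic `\` D); split=> //; first exact: measurableD.
  by move=> t /= /not_implyP.
refine (@ae_imply2 _ _ _ leb _ _ _ aeD zw _) => t Dt zt tT.
have {}Dt := Dt tT; have {}zt := zt tT.
have [Lt _] := xs t Dt.
pose h := (fun y => inner (w y) (w t)) \_ D.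
have mh : measurable_fun setT h.
  apply/(measurable_restrictT _ mD).
  apply: (@measurable_linear_limit R fct L2 norm2 L2_0 Llin (inner^~ (w t)) _ (norm2 (w t)) D s w _ ws xs).
    by move=> c u v Lu Lv; exact: ilinl.
  by move=> v Lv; rewrite mulrC; exact: inner_CauchySchwarz.
pose gt y := (Gamma a)^-1 * kern a (t - y) * h y.
have mgt : measurable_fun setT gt.
  apply: measurable_funM; last exact: mh.
  apply: measurable_funM; first exact: measurable_cst.
  by apply: measurable_kern2; [exact: measurable_cst|exact: measurable_id].
have C0 : 0 < norm2 (w t) + 1 by rewrite ltr_wpDl ?norm2_ge0.
have Gam0 : Gamma a != 0 by rewrite gt_eqF// Gamma_gt0// a0 ltW.
(* With [t] fixed, the functional is the pairing with [w t]; it turns the fractional integral [z t]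
   into a scalar integral over []0, t[]. *)
have [] := @bochner_integral_linear R fct L2 norm2 L2_0 Llin (fun v => norm2_ge0 Omega v)
  (inner^~ (w t)) _ (norm2 (w t) + 1) `]0, t[%classic _ (z t) gt (measurable_itv _) C0 _ zt _ _.
- by move=> c u v Lu Lv; exact: ilinl.
- move=> v Lv; apply: (le_trans (inner_CauchySchwarz mO Lv Lt)).
  by rewrite mulrC ler_wpM2r ?norm2_ge0// lerDl.
- exact: measurable_funTS.
- refine (@ae_imply2 _ _ _ leb _ _ _ aeD aeD _) => y Dy _ /=; rewrite in_itv/= => /andP[y0 yt].
  have {}Dy : D y.
    apply: Dy; rewrite /= in_itv/= y0; apply: (lt_trans yt).
    by move: tT; rewrite /= in_itv/= => /andP[].
  have [Ly _] := xs y Dy.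
  by rewrite /gt /h patchE mem_set// kernE ?subr_gt0// innerZl.
move=> igt Igt; rewrite -[LHS]/(\int[leb]_y G (t, y))%E innerC EFinM -Igt -integralZl//.
rewrite [RHS]integral_mkcond; apply: eq_integral => y _; rewrite patchE.
case: ifPn => [|/negP]; rewrite inE/= in_itv/=.
  move=> /andP[y0 yt]; rewrite /G /gt /h/= -EFinM; congr EFin; rewrite patchE (ind1 _ _ Dt) mul1r.
  have [Dy|Dy] := pselect (D y); last by rewrite (ind0 _ _ Dy) memNset// !mul0r !mulr0.
  by rewrite (ind1 _ _ Dy) mem_set// mul1r innerC !mulrA divff// mul1r mulrC.
move=> /negP; rewrite negb_and -!leNgt => /orP[y0|ty]; last by rewrite /G/= kern_out ?subr_le0// mulr0.
rewrite /G/= (ind0 D y) ?mulr0 ?mul0r// => /DT.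
by rewrite /= in_itv/= ltNge y0.
Qed.
End frac_positivity.

(** * Laplace asymptotics of the solution *)

#[local] Opaque bform Defs.H10 Defs.H1 Defs.L2 Defs.inner Defs.norm2 Defs.H1norm Defs.H2norm.

Section time_data.
Context {R : realType}.
Local Notation leb := (@lebesgue_measure R).
Implicit Types m : R -> R.

Lemma memL_oo_bounded m : memL leb +oo%E `]0, +oo[ m ->
  measurable_fun setT (m \_ `]0, +oo[) /\
  exists2 M, 0 <= M & {ae leb, forall t, `|(m \_ `]0, +oo[) t| <= M}.
Proof.
rewrite /memL => Lm; split; first by have := sub_Lfun_mfun Lm; rewrite inE.
move: Lm; rewrite inE/= => /andP[_]; rewrite inE/= /finite_norm unlock.
have -> : (0 < leb [set: R])%E.
  apply: (@lt_le_trans _ _ (leb `]0%R, 1%R[)); last by apply: le_measure; rewrite ?inE.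
  by rewrite lebesgue_measure_itv/= lte_fin ltr01 oppr0 adde0 lte_fin.
move=> fin; have [M HM] : exists M : R, {ae leb, forall t, `|(m \_ `]0, +oo[) t| <= M}.
  exact: (@ess_sup_inf.ess_supr_bounded _ _ _ leb (Num.norm \o (m \_ `]0, +oo[))).
 exists (Num.max M 0); first by rewrite le_max lexx orbT.
refine (@ae_imply2 _ _ _ leb _ _ _ HM HM _) => t H _.
by rewrite le_max H.
Qed.

Lemma decaying_integrable (p0 : R) m : 0 < p0 -> measurable_fun setT (m \_ `]0, +oo[) ->
  memL leb 1%:E `]0, +oo[ (fun t => expR (p0 * t) * m t) ->
  leb.-integrable setT (EFin \o (m \_ `]0, +oo[)).
Proof.
move=> p00 mm /Lfun1_integrable I.
apply: (le_integrable measurableT _ _ I); first exact/measurable_EFinP.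
move=> t _; rewrite /= lee_fin !patchE; case: ifPn => [|_]; last by rewrite normr0.
rewrite inE/= in_itv/= andbT => t0; rewrite normrM ler_peMl// ger0_norm ?expR_ge0//.
by apply: le_trans (expR_ge1Dx _); rewrite lerDl mulr_ge0// ltW.
Qed.
End time_data.

Section laplace_transform.
Context {R : realType}.
Local Notation leb := (@lebesgue_measure R).
Implicit Types (p k : R) (h : R -> R).

Definition laplace p h : R := (\int[leb]_t (expR (- (p * t)) * h t))%R.

Definition laplace_integrable p h :=
  leb.-integrable setT (fun t => (expR (- (p * t)) * h t)%:E).

Lemma laplaceE p h : laplace_integrable p h ->
  (\int[leb]_t (expR (- (p * t)) * h t)%:E = (laplace p h)%:E)%E.
Proof. by move=> ih; rewrite /laplace /Rintegral fineK//; exact: integrable_fin_num. Qed.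

Lemma laplace_lin p k h1 h2 : laplace_integrable p h1 -> laplace_integrable p h2 ->
  laplace_integrable p (fun t => k * h1 t + h2 t) /\
  laplace p (fun t => k * h1 t + h2 t) = k * laplace p h1 + laplace p h2.
Proof.
move=> i1 i2; have iZ : leb.-integrable setT (fun t => k%:E * (expR (- (p * t)) * h1 t)%:E)%E.
  exact: integrableZl.
have E : (fun t => (expR (- (p * t)) * (k * h1 t + h2 t))%:E) =
    ((fun t => k%:E * (expR (- (p * t)) * h1 t)%:E) \+ (fun t => (expR (- (p * t)) * h2 t)%:E))%E.
  by apply/funext => t; rewrite /= -EFinM -EFinD; congr EFin; ring.
have iD : laplace_integrable p (fun t => k * h1 t + h2 t).
  by rewrite /laplace_integrable E; exact: integrableD.
split=> //; apply: EFin_inj; rewrite -(laplaceE iD) E integralD// integralZl//.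
by rewrite !laplaceE// -EFinM -EFinD.
Qed.

Lemma laplace_measurable p h : measurable_fun setT h ->
  measurable_fun setT (fun t => (expR (- (p * t)) * h t)%:E).
Proof.
move=> mh; apply/measurable_EFinP; apply: measurable_funM => //.
apply: measurableT_comp; first exact: measurable_expR.
apply: measurable_funN; apply: measurable_funM; first exact: measurable_cst.
exact: measurable_id.
Qed.

Lemma laplace_dominated p k h q : measurable_fun setT h ->
  laplace_integrable p q -> (forall t, `|h t| <= k * q t) ->
  laplace_integrable p h /\ `|laplace p h| <= k * laplace p q.
Proof.
move=> mh iq hq.
have iZ : leb.-integrable setT (fun t => k%:E * (expR (- (p * t)) * q t)%:E)%E.
  exact: integrableZl.
have le t : (`|(expR (- (p * t)) * h t)%:E| <= k%:E * (expR (- (p * t)) * q t)%:E)%E.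
  rewrite abse_EFin -EFinM lee_fin normrM ger0_norm ?expR_ge0// mulrCA.
  by rewrite ler_wpM2l ?expR_ge0.
have ih : laplace_integrable p h.
  apply: (le_integrable measurableT _ _ iZ); first exact: laplace_measurable.
  by move=> t _; apply: le_trans (le t) _; exact: lee_abs.
split=> //; rewrite -lee_fin -abse_EFin -laplaceE// EFinM -laplaceE//.
apply: (@le_trans _ _ (\int[leb]_t `|(expR (- (p * t)) * h t)%:E|)%E).
  by apply: le_abse_integral => //; exact: laplace_measurable.
rewrite -integralZl//; apply: ge0_le_integral => //.
- by apply: measurableT_comp => //; exact: laplace_measurable.
- exact: measurable_int iZ.
Qed.

Lemma laplace_kern1 p : 0 < p ->
  laplace_integrable p (kern 1) /\ laplace p (kern 1) = p `^ (- 1) * Gamma 1.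
Proof.
move=> p0; have a1 : 0 < (1 : R) <= 1 by rewrite ltr01 lexx.
have ik : laplace_integrable p (kern 1).
  apply/integrableP; split; first exact: (laplace_measurable p (measurable_kern 1)).
  under eq_integral do rewrite gee0_abs ?lee_fin ?mulr_ge0 ?expR_ge0 ?kern_ge0//.
  exact: laplace_kern_lty.
split=> //; apply: EFin_inj; rewrite -laplaceE//; exact: laplace_kernE.
Qed.

Lemma kern1E t : kern 1 t = (if 0 < t then 1 else 0) :> R.
Proof.
have [t0|t0] := ltP 0 t; last by rewrite kern_out.
by rewrite kernE// subrr powRr0.
Qed.
End laplace_transform.

Section solution.
Context {R : realType} {N : nat} (Omega : set 'rV[R]_N).
Hypotheses (oO : open Omega) (bO : bounded_set Omega) (N_gt0 : (0 < N)%N).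
Local Notation fct := ('rV[R]_N -> R).
Local Notation leb := (@lebesgue_measure R).
Local Notation L2 := (L2 Omega).
Local Notation inner := (inner Omega).
Local Notation norm2 := (norm2 Omega).
Local Notation H1 := (H1 Omega).
Local Notation H10 := (H10 Omega).
Local Notation H1norm := (H1norm Omega).
Variables (a : 'I_N -> 'I_N -> fct) (c : fct).
Hypothesis ac : elliptic_coefficients Omega a c.
Local Notation bform := (bform Omega a c).
Variables (alpha : R) (u0 : fct) (m : R -> R) (f : fct) (u : R -> fct).
Hypothesis alpha01 : 0 < alpha < 1.
Hypothesis u0_H10 : H10 u0.
Hypothesis f_L2 : L2 f.
Hypothesis u_sol : is_solution Omega a c alpha u0 m f u.

Let mO : measurable Omega. Proof. exact: open_measurable_rV. Qed.

Let H10_0 : H10 0.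
Proof. by rewrite -(subrr u0); exact: H10B. Qed.

Let Hlin (k : R) (v w : fct) : H10 v -> H10 w -> H10 (k *: v + w).
Proof. exact: H10_lin. Qed.

Let bl (k : R) (v w h : fct) : H10 v -> H10 w -> H10 h ->
  bform (k *: v + w) h = k * bform v h + bform w h.
Proof. by move=> /H10_H1 ? /H10_H1 ? /H10_H1 ?; exact: bform_linl. Qed.

Let br (k : R) (v w h : fct) : H10 v -> H10 w -> H10 h ->
  bform h (k *: v + w) = k * bform h v + bform h w.
Proof. by move=> /H10_H1 ? /H10_H1 ? /H10_H1 ?; exact: bform_linr. Qed.

Let H10_L2 (v : fct) : H10 v -> L2 v.
Proof. by move=> /H10_H1/H1_L2. Qed.

Let bform0l v : H10 v -> bform 0 v = 0.
Proof.
move=> Hv; have := bl (-1) H10_0 H10_0 Hv.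
by rewrite scaler0 addr0 mulN1r addNr.
Qed.

(** Step approximations exist on each bounded interval, outside a null set of its own. [U] is [u]
    where those for [T = n + 1] all converge, and 0 elsewhere, so that it lies in [H10] at every
    time. Convergence in [H2norm] is weakened to [H1norm], which is all the form needs. *)
Lemma solution_representative : exists U : R -> fct,
  [/\ forall t, H10 (U t), forall t, t <= 0 -> U t = 0,
      {ae leb, forall t, 0 < t -> U t = u t},
      forall eta, L2 eta -> measurable_fun setT (fun t => inner (U t) eta) &
      (forall eta, H10 eta -> measurable_fun setT (fun t => bform (U t) eta)) /\
      measurable_fun setT (fun t => bform (U t) (U t))].
Proof.
have step (n : nat) : exists F : (nat -> @step_map R fct) * set R,
  [/\ forall k, step_wf H10 (F.1 k), measurable F.2, leb F.2 = 0%E &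
      forall t, `]0, n.+1%:R[%classic t -> ~ F.2 t -> H10 (u t) /\
        (H1norm (u t - step_eval (F.1 k) t) @[k --> \oo] --> (0 : R))].
  have n0 : 0 < n.+1%:R :> R by [].
  have [H _ _] := u_sol; have [[[s [ws [Nu [mNu Nu0 sNu]]]] _] _] := H _ n0.
  exists (s, Nu); split; [|exact: mNu|exact: Nu0|].
    by move=> k j; have [? ? [_ Hj]] := ws k j.
  move=> t tT Nt.
  have : H2H10 Omega (u t) /\
      (H2norm Omega (u t - step_eval (s k) t) @[k --> \oo] --> (0 : R)).
    by apply: contrapT => H'; apply: Nt; apply: sNu => /= /(_ tT).
  move=> [[_ Hu] cu]; split=> //.
  apply/cvgrPdist_le => e e0; have /cvgrPdist_le/(_ e e0) := cu; apply: filterS => k.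
  rewrite !sub0r !normrN (ger0_norm (H1norm_ge0 _ _)) => H'.
  by apply: le_trans (H1norm_le_H2norm _ _) _; exact: le_trans (ler_norm _) H'.
have [F HF] := choice step.
pose Nu := \bigcup_n (F n).2.
have mNu : measurable Nu by apply: bigcup_measurable => n _; have [] := HF n.
have Nu0 : leb Nu = 0%E.
  have : leb.-negligible Nu.
    by apply: negligible_bigcup => n; exists (F n).2; have [_ mF F0 _] := HF n; split.
  by move=> [B [mB B0 sB]]; apply: (@subset_measure0 _ _ _ leb _ B).
pose Dn (n : nat) := `]0, n.+1%:R[%classic `\` Nu.
pose D := \bigcup_n Dn n.
have mDn n : measurable (Dn n) by exact: measurableD.
have mD : measurable D by exact: bigcup_measurable.
pose U t := if t \in D then u t else 0.
have UD t : D t -> U t = u t by move=> Dt; rewrite /U mem_set.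
have UnD t : ~ D t -> U t = 0 by move=> Dt; rewrite /U memNset.
have Dn_lim n t : Dn n t -> H10 (u t) /\
    (H1norm (u t - step_eval ((F n).1 k) t) @[k --> \oo] --> (0 : R)).
  move=> [tT Nt]; have [_ _ _ H] := HF n; apply: H => //.
  by move=> Ft; apply: Nt; exists n.
have ws n k : step_wf H10 ((F n).1 k) by have [] := HF n.
have glue (l : fct -> R) : l 0 = 0 -> (forall n, measurable_fun (Dn n) (fun t => l (u t))) ->
    measurable_fun setT (fun t => l (U t)).
  move=> l0 ml; rewrite (_ : (fun t => l (U t)) = (fun t => l (u t)) \_ D).
    by apply/(measurable_restrictT _ mD); apply/measurable_fun_bigcup.
  apply/funext => t; rewrite patchE /U; case: ifP => // _; exact: l0.
exists U; split.
- move=> t; have [Dt|Dt] := pselect (D t); last by rewrite UnD.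
  by rewrite (UD _ Dt); have [n _ Hn] := Dt; exact: (proj1 (Dn_lim _ _ Hn)).
- move=> t t0; rewrite UnD// => -[n _ []] /=; rewrite in_itv/= => /andP[t0'].
  by rewrite ltNge t0 in t0'.
- exists Nu; split=> // t /= H; apply: contrapT => Nt; apply: H => t0; rewrite UD//.
  (* With [n = ceil t], the point [t] lies strictly below [n + 1]. *)
  exists `|Num.ceil t|%N => //; split=> //=; rewrite in_itv/= t0/=.
  have := ceil_ge t; rewrite -natr1 => H; apply: le_lt_trans H _.
  by rewrite natr_absz ger0_norm ?ceil_ge0 ?ltrDl// (lt_trans _ t0)// ltrN10.
- move=> eta Leta; apply: (glue (inner^~ eta)) => [|n]; first exact: inner0l.
  apply: (@measurable_linear_limit R fct H10 H1norm H10_0 Hlin (inner^~ eta) _ (norm2 eta) (Dn n) _ u _ (ws n) (Dn_lim n)).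
    by move=> k v w /H10_L2 Lv /H10_L2 Lw; exact: inner_linl.
  move=> v /H10_L2 Lv; apply: (le_trans (inner_CauchySchwarz mO Lv Leta)).
  by rewrite mulrC ler_wpM2l ?norm2_ge0 ?norm2_le_H1norm.
- have [C C0 HC] := bform_H1norm oO bO ac; split.
    move=> eta Heta; apply: (glue (bform^~ eta)) => [|n]; first exact: bform0l.
    apply: (@measurable_linear_limit R fct H10 H1norm H10_0 Hlin (bform^~ eta) _ (C * H1norm eta) (Dn n) _ u _ (ws n) (Dn_lim n)).
      by move=> k v w Hv Hw; exact: bl.
    move=> v /H10_H1 Hv; have := HC _ _ Hv (H10_H1 Heta).
    by rewrite mulrAC.
  apply: (glue (fun v => bform v v)) => [|n]; first exact: bform0l.
  apply: (@measurable_quadratic_limit R fct H10 H1norm H10_0 Hlin bform C bl br _ (Dn n) _ u (ws n) (Dn_lim n)).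
  by move=> v w /H10_H1 Hv /H10_H1 Hw; exact: HC.
Qed.

(** After this lemma the operator acting on [u] is seen only through its bilinear form. *)
Lemma solution_weak_form (T : R) : 0 < T -> exists w : R -> fct,
  frac_derivative Omega alpha T (fun t => u t - u0) w /\
  {ae leb, forall t, `]0, T[%classic t -> [/\ H10 (u t), L2 (w t) &
    forall eta, H10 eta -> inner (w t) eta = m t * inner f eta - bform (u t) eta]}.
Proof.
move=> T0; have [H _ _] := u_sol; have [_ [w [Au [fd aeA aeq]]]] := H _ T0.
exists w; split=> //; have [[[s [_ aew]] _] _] := fd.
have {}aew := @ae_imply2 _ _ _ leb _ _ _ aew aew (fun t h _ => h).
have aeE := @ae_imply2 _ _ _ leb _ _ _ aeA aeq (fun t h1 h2 => conj h1 h2).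
refine (@ae_imply2 _ _ _ leb _ _ _ aew aeE _) => t wt [At qt] tT.
have [Lw _] := wt tT; have {}At := At tT; have {}qt := qt tT.
have [[_ Hu] _] := At; split=> // eta Heta.
have Leta := H10_L2 Heta; have Lmf : L2 (m t *: f) by exact: L2Z.
rewrite -(elliptic_green oO bO ac At Heta).
have -> : inner (Au t) eta = inner (m t *: f - w t) eta.
  apply: inner_ae; last by apply: aeW.
  apply: filterS qt => x H' Ox; rewrite -[RHS]/((m t *: f) x - w t x) -H'//.
  by rewrite -[(w t + Au t) x]/(w t x + Au t x) addrAC subrr add0r.
rewrite innerBl//.
have -> : inner (m t *: f) eta = m t * inner f eta by exact: innerZl.
by rewrite opprB addrC subrK.
Qed.

Section representative.
Variable U : R -> fct.
Hypothesis U_H10 : forall t, H10 (U t).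
Hypothesis U_neg : forall t, t <= 0 -> U t = 0.
Hypothesis U_u : {ae leb, forall t, 0 < t -> U t = u t}.
Local Notation m0 := (m \_ `]0, +oo[).

(* Tests the equation with [u - u0]. *)
Lemma solution_energy_growth (M : R) : 0 <= M -> {ae leb, forall t, `|m0 t| <= M} ->
  exists2 K, 0 <= K & forall T : R, 0 < T ->
    (\int[leb]_(t in `]0%R, T[) (bform (U t) (U t))%:E <= (K * T)%:E)%E.
Proof.
move=> M0 mM; have [Cc Cc0 HCc] := bform_coercive oO bO N_gt0 ac.
have H1u0 := H10_H1 u0_H10; have b0 := bform_ge0 oO bO ac H1u0.
pose F := M * norm2 f; have F0 : 0 <= F by rewrite mulr_ge0 ?norm2_ge0.
(* In [(w, u - u0) = m (f, u - u0) - B(u, u) + B(u, u0)], half of [B(u, u)] absorbs [B(u, u0)],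
   leaving [B(u0, u0) / 2], and a quarter absorbs the source, leaving [Cc F^2 + F norm2 u0]. Hence
   [(w, u - u0) <= K0 - B(u, u) / 4]. *)
pose K0 := Cc * F ^+ 2 + F * norm2 u0 + bform u0 u0 / 2.
have K00 : 0 <= K0.
  by rewrite !addr_ge0 ?mulr_ge0 ?norm2_ge0 ?sqr_ge0 ?(ltW Cc0)//.
exists (4 * K0); first by rewrite mulr_ge0.
move=> T T0; have [w [fd wf]] := solution_weak_form T0.
have [Y [iY Y0 YE]] := frac_derivative_positive oO alpha01 T0 fd.
have Gam : 0 < Gamma alpha by have /andP[? ?] := alpha01; rewrite Gamma_gt0// ltW ?andbT.
(* The 4 undoes the quarter of [B(u, u)] left over, and [Gamma alpha] is the factor that [Y]
   carries. *)
pose k := 4 / Gamma alpha; have k0 : 0 <= k by rewrite divr_ge0// ltW.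
pose Z t := ((4 * K0)%:E - k%:E * Y t)%E.
have bound : {ae leb, forall t, `]0, T[%classic t -> ((bform (U t) (U t))%:E <= Z t)%E}.
  have ae1 := @ae_imply2 _ _ _ leb _ _ _ YE wf (fun t h1 h2 => conj h1 h2).
  have ae2 := @ae_imply2 _ _ _ leb _ _ _ U_u mM (fun t h1 h2 => conj h1 h2).
  refine (@ae_imply2 _ _ _ leb _ _ _ ae1 ae2 _) => t [Yt wt] [Ut mt] tT.
  have t0 : 0 < t by move: tT; rewrite /= in_itv/= => /andP[].
  have [Hv Lw wE] := wt tT; rewrite /Z Yt// Ut//.
  have Hd : H10 (u t - u0) by exact: H10B.
  rewrite (wE _ Hd) -EFinM -EFinB lee_fin mulrA /k divfK ?gt_eqF//.
  have -> : bform (u t) (u t - u0) = bform (u t) (u t) - bform (u t) u0.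
    by rewrite subr_scaleN1 br// mulN1r addrC.
  have /(bform_ge0 oO bO ac) : H1 (-1 *: u0 + u t) by apply: H1_lin => //; exact: H10_H1.
  rewrite (bform_quad oO bO ac _ (H10_H1 Hv) H1u0) => quad.
  have coer := HCc _ Hv; have L2v := H10_L2 Hv; have L2u0 := H10_L2 u0_H10.
  have nd := norm2B oO L2v L2u0.
  have m0E : m0 t = m t by rewrite patchE mem_set//= in_itv/= t0.
  rewrite m0E in mt.
  have fb : m t * inner f (u t - u0) <= F * (norm2 (u t) + norm2 u0).
    apply: (le_trans (ler_norm _)); rewrite normrM /F -mulrA; apply: ler_pM => //.
    apply: (le_trans (inner_CauchySchwarz mO f_L2 (H10_L2 Hd))).
    by rewrite ler_wpM2l ?norm2_ge0.
  have amgm : F * norm2 (u t) <= Cc * F ^+ 2 + bform (u t) (u t) / 4.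
    have C4 : 0 < 4 * Cc by rewrite mulr_gt0.
    rewrite -(ler_pM2l C4); have := sqr_ge0 (2 * Cc * F - norm2 (u t)).
    move: coer; move: (norm2 (u t)) (bform (u t) (u t)) => x y coer sq.
    have -> : 4 * Cc * (Cc * F ^+ 2 + y / 4) = 4 * Cc ^+ 2 * F ^+ 2 + Cc * y by field.
    have E : (2 * Cc * F - x) ^+ 2 = 4 * Cc ^+ 2 * F ^+ 2 - 4 * Cc * (F * x) + x ^+ 2 by ring.
    by rewrite E in sq; lra.
  move: quad fb amgm; rewrite /K0.
  move: (bform (u t) (u t)) (bform (u t) u0) (bform u0 u0) (m t * _) (norm2 (u t)) (norm2 u0).
  move=> x y z p q r; rewrite mulrDr mulrN1 sqrrN expr1n mulr1 -mulr_natr; lra.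
have U0 t : 0 <= bform (U t) (U t) by exact: (bform_ge0 oO bO ac (H10_H1 (U_H10 t))).
(* [Z] is nonnegative only almost everywhere; its positive part is so everywhere, as the comparison
   of integrals demands. *)
have ZE : (\int[leb]_(t in `]0%R, T[) maxe (Z t) 0 = \int[leb]_(t in `]0%R, T[) Z t)%E.
  apply: ae_eq_integralW; refine (@ae_imply2 _ _ _ leb _ _ _ bound bound _) => t H _ tT.
  by apply/max_idPl; apply: le_trans (H tT); rewrite lee_fin.
apply: (@le_trans _ _ (\int[leb]_(t in `]0%R, T[) maxe (Z t) 0)%E).
  apply: ge0_ae_le_integralW => [t _|t _|]; rewrite ?lee_fin// ?le_max ?lexx ?orbT//.
  refine (@ae_imply2 _ _ _ leb _ _ _ bound bound _) => t H _ tT.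
  by rewrite le_max H.
have lT : leb `]0%R, T[%classic = T%:E by rewrite lebesgue_measure_itv/= lte_fin T0 oppr0 adde0.
have ic : leb.-integrable `]0%R, T[ (fun=> (4 * K0)%:E).
  apply/integrableP; split; first exact: measurable_cst.
  by rewrite integral_cst//= -abse_EFin lT -EFinM ltry.
have ikY : leb.-integrable `]0%R, T[ (fun t => k%:E * Y t)%E by exact: integrableZl.
rewrite ZE integralB// integralZl// integral_cst//= lT -EFinM.
have fY : (\int[leb]_(t in `]0%R, T[) Y t)%E \is a fin_num by exact: integrable_fin_num.
rewrite -(fineK fY) -EFinM -EFinB lee_fin gerBl mulr_ge0//.
by rewrite fine_ge0.
Qed.

(** The Volterra form of the equation: applying the pairing with [phi] to the fractional integral of
    [w] eliminates the fractional derivative, which depends on [T], in favour of [U] and the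
    data. *)
Lemma solution_convolution (phi : fct) : H10 phi ->
  measurable_fun setT m0 -> measurable_fun setT (fun t => bform (U t) phi) ->
  {ae leb, forall t, 0 < t ->
     leb.-integrable setT (fun s => (kern alpha (t - s) *
        (m0 s * inner f phi - bform (U s) phi))%:E) /\
     (\int[leb]_s (kern alpha (t - s) * (m0 s * inner f phi - bform (U s) phi))%:E =
       (Gamma alpha * (inner (U t) phi - inner u0 phi))%:E)%E}.
Proof.
move=> Hphi mm mb; have Lphi := H10_L2 Hphi.
have Gam : 0 < Gamma alpha by have /andP[? ?] := alpha01; rewrite Gamma_gt0// ltW ?andbT.
pose y s := m0 s * inner f phi - bform (U s) phi.
have my : measurable_fun setT y.
  by apply: measurable_funB => //; apply: measurable_funM => //; exact: measurable_cst.
have yneg s : s <= 0 -> y s = 0.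
  move=> s0; rewrite /y U_neg// bform0l// patchE memNset ?mul0r ?subr0//=.
  by rewrite in_itv/= andbT ltNge s0.
(* The notion of solution supplies one [w] for each [T]; countably many [T] keep the exceptional set
   null. *)
suff H (n : nat) : {ae leb, forall t, `]0, n.+1%:R[%classic t ->
     leb.-integrable setT (fun s => (kern alpha (t - s) * y s)%:E) /\
     (\int[leb]_s (kern alpha (t - s) * y s)%:E =
       (Gamma alpha * (inner (U t) phi - inner u0 phi))%:E)%E}.
  have := negligible_bigcup H; apply: negligibleS => t /= /not_implyP[t0 Ht].
  exists `|Num.ceil t|%N => //= Hn; apply: Ht; apply: Hn; rewrite in_itv/= t0/=.
  have := ceil_ge t; rewrite -natr1 => H'; apply: le_lt_trans H' _.
  by rewrite natr_absz ger0_norm ?ceil_ge0 ?ltrDl// (lt_trans _ t0)// ltrN10.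
have n0 : 0 < n.+1%:R :> R by [].
have [w [[_ fd] wf]] := solution_weak_form n0.
have ae1 := @ae_imply2 _ _ _ leb _ _ _ wf U_u (fun t h1 h2 => conj h1 h2).
refine (@ae_imply2 _ _ _ leb _ _ _ fd ae1 _) => t zt [wt Ut] tT.
have {}zt := zt tT; have [Hu _ _] := wt tT.
have t0 : 0 < t by move: tT; rewrite /= in_itv/= => /andP[].
have tn : t < n.+1%:R by move: tT; rewrite /= in_itv/= => /andP[].
pose gt s := (Gamma alpha)^-1 * kern alpha (t - s) * y s.
have mgt : measurable_fun setT gt.
  apply: measurable_funM; last exact: my.
  apply: measurable_funM; first exact: measurable_cst.
  by apply: measurable_kern2; [exact: measurable_cst|exact: measurable_id].
have C0 : 0 < norm2 phi + 1 by rewrite ltr_wpDl ?norm2_ge0.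
have [] := @bochner_integral_linear R fct L2 norm2 (L20 Omega) (fun k v w => @L2_lin R N Omega k v w)
  (fun v => norm2_ge0 Omega v)
  (inner^~ phi) _ (norm2 phi + 1) `]0, t[%classic _ (u t - u0) gt (measurable_itv _) C0 _ zt _ _.
- by move=> k v v' Lv Lv'; exact: inner_linl.
- move=> v Lv; apply: (le_trans (inner_CauchySchwarz mO Lv Lphi)).
  by rewrite mulrC ler_wpM2r ?norm2_ge0// lerDl.
- exact: measurable_funTS.
- refine (@ae_imply2 _ _ _ leb _ _ _ wf U_u _) => s ws Us /=; rewrite in_itv/= => /andP[s0 st].
  have [_ Lw wE] : [/\ H10 (u s), L2 (w s) & forall eta, H10 eta ->
      inner (w s) eta = m s * inner f eta - bform (u s) eta].
    by apply: ws; rewrite /= in_itv/= s0 (lt_trans st).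
  have -> : inner (((Gamma alpha)^-1 * (t - s) `^ (alpha - 1)) *: w s) phi =
      (Gamma alpha)^-1 * (t - s) `^ (alpha - 1) * inner (w s) phi by exact: innerZl.
  rewrite /gt kernE ?subr_gt0// wE// /y Us//.
  by rewrite patchE mem_set//= in_itv/= s0.
move=> igt Igt.
have out s : ~ `]0, t[%classic s -> kern alpha (t - s) * y s = 0.
  rewrite /= in_itv/= => /negP; rewrite negb_and -!leNgt => /orP[s0|ts].
    by rewrite yneg// mulr0.
  by rewrite kern_out ?subr_le0// mul0r.
have E : (fun s => (kern alpha (t - s) * y s)%:E) =
    (fun s => ((Gamma alpha)%:E * (gt s)%:E)%E) \_ `]0, t[.
  apply/funext => s; rewrite patchE; case: ifPn => [_|/negP].
    by rewrite -EFinM /gt !mulrA divff ?gt_eqF// mul1r.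
  by rewrite inE => /out ->.
have iG : leb.-integrable `]0, t[ (fun s => ((Gamma alpha)%:E * (gt s)%:E)%E).
  by apply: integrableZl => //; exact: igt.
have mI : measurable (`]0%R, t[%classic : set R) by exact: measurable_itv.
have iGT := proj1 (@integrable_mkcond _ _ _ leb _ _ mI) iG.
split; first by rewrite E; exact: iGT.
rewrite E -integral_mkcond integralZl// Igt -EFinM Ut//; congr (_ * _)%:E.
by rewrite innerBl//; exact: H10_L2.
Qed.


Hypothesis U_inner : forall eta, L2 eta -> measurable_fun setT (fun t => inner (U t) eta).
Hypothesis U_bform : forall eta, H10 eta -> measurable_fun setT (fun t => bform (U t) eta).
Hypothesis U_energy : measurable_fun setT (fun t => bform (U t) (U t)).
Hypothesis m0_meas : measurable_fun setT m0.

(** One majorant for every quantity linear in [U]: by [x <= 1 + x^2] and coercivity, each is at most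
    a multiple of [1 + B(U, U)]. The constant is written [kern 1] so that [Q] vanishes for
    [t <= 0]. *)
Let Q t := kern 1 t + bform (U t) (U t).

Let Qpos t : 0 < t -> Q t = 1 + bform (U t) (U t).
Proof. by move=> t0; rewrite /Q kern1E t0. Qed.

Let bUU_ge0 t : 0 <= bform (U t) (U t).
Proof. exact: (bform_ge0 oO bO ac (H10_H1 (U_H10 t))). Qed.

Let Q_ge0 t : 0 <= Q t.
Proof. by rewrite addr_ge0 ?kern_ge0. Qed.

Lemma inner_dominated eta : L2 eta -> exists2 C, 0 <= C & forall t, `|inner (U t) eta| <= C * Q t.
Proof.
move=> Leta; have [Cc Cc0 HCc] := bform_coercive oO bO N_gt0 ac.
exists (norm2 eta * (1 + Cc)); first by rewrite mulr_ge0 ?norm2_ge0// addr_ge0// ltW.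
move=> t; have [t0|t0] := ltP 0 t; last first.
  rewrite (U_neg t0) (inner0l Omega eta) normr0 mulr_ge0// mulr_ge0 ?norm2_ge0//.
  by rewrite addr_ge0// ltW.
rewrite Qpos//; have L2U := H10_L2 (U_H10 t).
apply: (le_trans (inner_CauchySchwarz mO L2U Leta)).
rewrite mulrC -mulrA ler_wpM2l ?norm2_ge0//.
have := HCc _ (U_H10 t); have := bUU_ge0 t; move: (norm2 (U t)) (bform (U t) (U t)) => x y y0 xy.
have := sqr_ge0 x; have := sqr_ge0 (x - 1); rewrite sqrrB1 => h h'; have : 0 <= Cc + y by rewrite addr_ge0// ltW.
move: xy h h'; have -> : (1 + Cc) * (1 + y) = 1 + Cc + y + Cc * y by ring.
move: (Cc * y) (x ^+ 2) => q r; rewrite -mulr_natr; lra.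
Qed.

Lemma bform_dominated phi : H10 phi -> exists2 C, 0 <= C & forall t, `|bform (U t) phi| <= C * Q t.
Proof.
move=> Hphi; have b0 := bform_ge0 oO bO ac (H10_H1 Hphi).
exists (1 + bform phi phi); first by rewrite addr_ge0.
move=> t; have [t0|t0] := ltP 0 t; last by rewrite (U_neg t0) bform0l// normr0 mulr_ge0// addr_ge0.
rewrite Qpos//; have := bform_CauchySchwarz oO bO ac (H10_H1 (U_H10 t)) (H10_H1 Hphi).
have := bUU_ge0 t; move: b0; move: (bform (U t) phi) (bform (U t) (U t)) (bform phi phi) => b x y y0 x0 bxy.
have xy0 : 0 <= x * y by rewrite mulr_ge0.
apply: (@le_trans _ _ (x + y)); last first.
  by rewrite (_ : (1 + y) * (1 + x) = 1 + x + y + x * y); [lra|ring].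
rewrite -ler_sqr ?nnegrE ?addr_ge0// real_normK ?num_real//; apply: (le_trans bxy).
by rewrite sqrrD -subr_ge0 -mulr_natr; have := sqr_ge0 x; have := sqr_ge0 y; lra.
Qed.

(** The convolution theorem applied to the Volterra form; the factors [Gamma alpha] cancel. The
    constant initial value contributes the transform of [kern 1], left as [p^(-1) Gamma 1] since
    [Gamma 1] drops out of the final comparison. *)
Lemma solution_laplace (p : R) (phi : fct) : 0 < p -> H10 phi ->
  laplace_integrable p m0 -> laplace_integrable p Q ->
  laplace p (fun t => inner (U t) phi) = inner u0 phi * (p `^ (- 1) * Gamma 1) +
    p `^ (- alpha) * (laplace p m0 * inner f phi - laplace p (fun t => bform (U t) phi)).
Proof.
move=> p0 Hphi im iQ; have Lphi := H10_L2 Hphi.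
have /andP[al0 al1] := alpha01; have al : 0 < alpha <= 1 by rewrite al0 ltW.
have Gam : 0 < Gamma alpha by rewrite Gamma_gt0.
have [C1 _ d1] := inner_dominated Lphi; have [C2 _ d2] := bform_dominated Hphi.
have [iq _] := laplace_dominated (U_inner Lphi) iQ d1.
have [ib _] := laplace_dominated (U_bform Hphi) iQ d2.
have [ik kE] := laplace_kern1 p0.
pose y s := m0 s * inner f phi - bform (U s) phi.
have my : measurable_fun setT y.
  apply: measurable_funB; last exact: U_bform.
  by apply: measurable_funM; [exact: m0_meas|exact: measurable_cst].
have [iy ey] : laplace_integrable p y /\
    laplace p y = laplace p m0 * inner f phi - laplace p (fun t => bform (U t) phi).
  have [h1 h2] := laplace_lin (-1) ib im.
  (* [laplace_lin] adds a second function with coefficient 1, whence the splitting of a coefficient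
     [k] as [(k - 1) + 1]. *)
  have [h3 h4] := laplace_lin (inner f phi - 1) im h1.
  have E : y = fun t => (inner f phi - 1) * m0 t + (-1 * bform (U t) phi + m0 t).
    by apply/funext => t; rewrite /y; ring.
  by rewrite E; split=> //; rewrite h4 h2; ring.
have [ir er] : laplace_integrable p (fun t => Gamma alpha * (inner (U t) phi - inner u0 phi * kern 1 t)) /\
    laplace p (fun t => Gamma alpha * (inner (U t) phi - inner u0 phi * kern 1 t)) =
    Gamma alpha * (laplace p (fun t => inner (U t) phi) - inner u0 phi * laplace p (kern 1)).
  have [h1 h2] := laplace_lin (- inner u0 phi) ik iq.
  have [h3 h4] := laplace_lin (Gamma alpha - 1) h1 h1.
  have E : (fun t => Gamma alpha * (inner (U t) phi - inner u0 phi * kern 1 t)) =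
    fun t => (Gamma alpha - 1) * (- inner u0 phi * kern 1 t + inner (U t) phi) +
       (- inner u0 phi * kern 1 t + inner (U t) phi).
    by apply/funext => t; ring.
  by rewrite E; split=> //; rewrite h4 h2; ring.
have conv := laplace_convolution al p0 my iy.
have aec := solution_convolution Hphi m0_meas (U_bform Hphi).
have LHS : (\int[leb]_t \int[leb]_s (expR (- (p * t)) * kern alpha (t - s) * y s)%:E =
   \int[leb]_t (expR (- (p * t)) * (Gamma alpha * (inner (U t) phi - inner u0 phi * kern 1 t)))%:E)%E.
  apply: ae_eq_integralW; refine (@ae_imply2 _ _ _ leb _ _ _ aec aec _) => t Ht _ _.
  have E s : (expR (- (p * t)) * kern alpha (t - s) * y s)%:E =
      ((expR (- (p * t)))%:E * (kern alpha (t - s) * y s)%:E)%E by rewrite -EFinM mulrA.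
  have [t0|t0] := ltP 0 t.
    have [ig Ig] := Ht t0; under eq_integral do rewrite E.
    by rewrite integralZl// Ig -EFinM kern1E t0 mulr1.
  rewrite integral0_eq => [|s _].
    by rewrite (U_neg t0) (inner0l Omega phi) kern1E ltNge t0 !(mulr0, subrr).
  have [st|ts] := ltP s t; last by rewrite kern_out ?subr_le0// mulr0 mul0r.
  have s0 : s <= 0 by rewrite ltW// (lt_le_trans st).
  rewrite /y (U_neg s0) bform0l// patchE memNset ?mul0r ?subr0 ?mulr0//=.
  by rewrite in_itv/= andbT ltNge s0.
move: conv; rewrite LHS laplaceE// (laplaceE iy) -EFinM er ey kE => -[].
move: (laplace p _) (inner u0 phi * _) (laplace p m0 * _ - _) (p `^ (- alpha)) => x z v r H.
have : Gamma alpha * (x - z) = Gamma alpha * (r * v) by rewrite H; ring.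
by move=> /(mulfI (lt0r_neq0 Gam)) <-; ring.
Qed.
End representative.

(** The residual of the approximate solution [phi] is tested twice: with [U t], which gives [r], and
    with [w0], which gives [rho]. Both are of size [e], which is sent to 0 while [p] is fixed. *)
Lemma solution_asymptotics (psi w0 : fct) (p0 : R) : L2 psi -> elliptic Omega a c w0 u0 ->
  memL leb +oo%E `]0, +oo[ m -> 0 < p0 ->
  memL leb 1%:E `]0, +oo[ (fun t => expR (p0 * t) * m t) ->
  exists2 C, 0 <= C & forall p, 0 < p <= 1 ->
    `|laplace p ((fun t => inner (u t) psi) \_ `]0, +oo[) - p `^ (alpha - 1) * (Gamma 1 * inner w0 psi)|
    <= C * (p `^ (2 * alpha - 1) + 1).
Proof.
move=> Lpsi w0u0 mLoo p00 mL1; have /andP[al0 al1] := alpha01.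
have [mm [M M0 mM]] := memL_oo_bounded mLoo.
have im := decaying_integrable p00 mm mL1.
have [U [UH Un Uu Ui [Ub Ue]]] := solution_representative.
have [K K0 HK] := solution_energy_growth UH Uu M0 mM.
have [C1 C10 approx] := approximate_solution oO bO N_gt0 ac Lpsi.
have [Cc Cc0 HCc] := bform_coercive oO bO N_gt0 ac.
have [[_ Hw0] _] := w0u0; have Lw0 := H10_L2 Hw0; have H1w0 := H10_H1 Hw0.
have bU0 t : 0 <= bform (U t) (U t) by exact: (bform_ge0 oO bO ac (H10_H1 (UH t))).
have bw0 := bform_ge0 oO bO ac H1w0.
have G1 : 0 < Gamma (1 : R) by rewrite Gamma_gt0// ltr01 lexx.
pose m0 := m \_ `]0, +oo[.
pose M1 := fine (\int[leb]_t `|(m0 t)%:E|)%E.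
have fM1 : (\int[leb]_t `|(m0 t)%:E|)%E \is a fin_num.
  by rewrite ge0_fin_numE; [have /integrableP[] := im|exact: integral_ge0].
have M10 : 0 <= M1 by rewrite fine_ge0// integral_ge0.
have lm p : 0 < p -> laplace_integrable p m0 /\ `|laplace p m0| <= M1.
  move=> p_gt0; have le t : (`|(expR (- (p * t)) * m0 t)%:E| <= `|(m0 t)%:E|)%E.
    rewrite lee_fin normrM ger0_norm ?expR_ge0//; have [t0|t0] := ltP 0 t.
      by rewrite ler_piMl// -expR0 ler_expR oppr_le0 mulr_ge0// ltW.
    by rewrite {1}/m0 patchE memNset ?normr0 ?mulr0//= in_itv/= andbT ltNge t0.
  have il : laplace_integrable p m0.
    by apply: (le_integrable measurableT _ _ im); [exact: laplace_measurable|move=> t _; exact: le].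
  split=> //; rewrite -lee_fin -abse_EFin -laplaceE// /M1 fineK//.
  apply: (@le_trans _ _ (\int[leb]_t `|(expR (- (p * t)) * m0 t)%:E|)%E).
    by apply: le_abse_integral => //; exact: laplace_measurable.
  apply: ge0_le_integral => //.
  - by apply: measurableT_comp => //; exact: laplace_measurable.
  - by apply: measurableT_comp => //; exact/measurable_EFinP.
(* The first summand bounds the coefficient [Gamma 1 * inner phi w0] of [p^(2 alpha - 1)], the
   second bounds the source term; [C1] bounds [norm2 phi] for every [p]. *)
exists (Gamma 1 * (C1 * norm2 w0) + M1 * (norm2 f * C1)).
  by rewrite addr_ge0 ?mulr_ge0 ?norm2_ge0// ltW.
move=> p /andP[p_gt0 p1].
pose Q t := kern 1 t + bform (U t) (U t).
have iQ : laplace_integrable p Q.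
  have iE : laplace_integrable p (fun t => bform (U t) (U t)).
    apply/integrableP; split; first exact: laplace_measurable.
    under eq_integral do rewrite gee0_abs ?lee_fin ?mulr_ge0 ?expR_ge0//.
    apply: (laplace_lty_linear_growth p_gt0 K0 Ue bU0 _ HK) => t t0.
    by rewrite Un// bform0l.
  have [ik _] := laplace_kern1 p_gt0.
  have [] := laplace_lin 1 ik iE; rewrite (_ : (fun t => _) = Q)//.
  by apply/funext => t; rewrite mul1r.
have [iM bM] := lm p p_gt0.
have -> : laplace p ((fun t => inner (u t) psi) \_ `]0, +oo[) = laplace p (fun t => inner (U t) psi).
  rewrite /laplace /Rintegral; congr fine; apply: ae_eq_integralW.
  refine (@ae_imply2 _ _ _ leb _ _ _ Uu Uu _) => t Ut _ _; congr (_ * _)%:E.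
  have [t0|t0] := ltP 0 t; first by rewrite patchE mem_set ?Ut//= in_itv/= t0.
  rewrite Un// (inner0l Omega psi) patchE memNset//= in_itv/= andbT.
  by rewrite ltNge t0.
set lam := p `^ alpha.
have lam0 : 0 <= lam by exact: powR_ge0.
have lam1 : lam <= 1.
  by rewrite -(powRr0 p); apply: ger_powR; rewrite ?p_gt0 ?p1// ltW.
pose E0 := norm2 w0 ^+ 2 + bform w0 w0.
have E00 : 0 <= E0 by rewrite addr_ge0 ?sqr_ge0.
have lQ0 : 0 <= laplace p Q.
  by apply: Rintegral_ge0 => t _; rewrite mulr_ge0 ?expR_ge0// addr_ge0 ?kern_ge0.
have pa0 : 0 <= p `^ (alpha - 1) by exact: powR_ge0.
have plam : p `^ (alpha - 1) * lam = p `^ (2 * alpha - 1).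
  by rewrite /lam -powRD ?(gt_eqF p_gt0) ?implybT//; congr (_ `^ _); ring.
have p2 : 0 <= p `^ (2 * alpha - 1) by exact: powR_ge0.
pose S := (Cc + 1) * laplace p Q + p `^ (alpha - 1) * Gamma 1 * (1 + E0).
(* [S] collects what multiplies [e]. It may blow up as [p] tends to 0, but [p] does not move
   here. *)
set X := `|_|; rewrite -subr_le0; apply: (@ler_small _ _ S).
  have Cc1 : 0 <= Cc + 1 by rewrite addr_ge0// ltW.
  have E1 : 0 <= 1 + E0 by rewrite addr_ge0.
  exact: (addr_ge0 (mulr_ge0 Cc1 lQ0) (mulr_ge0 (mulr_ge0 pa0 (ltW G1)) E1)).
move=> e e0; have e2 : 0 < e ^+ 2 by rewrite exprn_gt0.
have [phi [tphi nphi Hphi]] := approx lam _ lam0 e2.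
have H10phi := test_function_H10 oO bO tphi; have Lphi := H10_L2 H10phi; have H1phi := H10_H1 H10phi.
(* The bound [sqrt y <= 1 + y] replaces the square root of the energy, which would not fit under the
   majorant [Q], by the energy itself. *)
have sqrt_bound (x y : R) : 0 <= y -> x ^+ 2 <= e ^+ 2 * y -> `|x| <= e * (1 + y).
  move=> y0 xy; rewrite -ler_sqr ?nnegrE ?mulr_ge0 ?addr_ge0 ?(ltW e0)//.
  rewrite real_normK ?num_real//; apply: (le_trans xy); rewrite exprMn ler_pM2l//.
  by have := sqr_ge0 y; rewrite sqrrD expr1n mul1r -mulr_natr; lra.
pose r t := lam * inner (U t) phi + (-1 * inner (U t) psi + bform (U t) phi).
have rb t : `|r t| <= e * (Cc + 1) * Q t.
  have r2 : r t ^+ 2 <= e ^+ 2 * ((Cc + 1) * bform (U t) (U t)).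
    have -> : r t = lam * inner phi (U t) + bform phi (U t) - inner psi (U t).
      rewrite /r (innerC Omega phi) (innerC Omega psi).
      by rewrite (bform_sym ac H1phi (H10_H1 (UH t))); ring.
    apply: (le_trans (Hphi _ (UH t))); rewrite ler_pM2l// /energy.
    have nU : norm2 (U t) ^+ 2 = inner (U t) (U t) by exact: (norm2_sqr mO (H10_L2 (UH t))).
    rewrite mulrDl mul1r -nU lerD2r.
    by apply: le_trans (HCc _ (UH t)); rewrite ler_piMl ?sqr_ge0.
  have [t0|t0] := ltP 0 t.
    have y0 : 0 <= (Cc + 1) * bform (U t) (U t) by rewrite mulr_ge0// addr_ge0// ltW.
    have QE : Q t = 1 + bform (U t) (U t) by rewrite /Q kern1E t0.
    have -> : e * (Cc + 1) * Q t = e * (Cc + 1 + (Cc + 1) * bform (U t) (U t)) by rewrite QE; ring.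
    apply: (le_trans (sqrt_bound _ _ y0 r2)); rewrite ler_pM2l//.
    by rewrite lerD2r lerDr ltW.
  have : r t ^+ 2 <= 0 by apply: le_trans r2 _; rewrite Un// bform0l// !mulr0.
  move=> r20; have -> : r t = 0 by apply/eqP; rewrite -sqrf_eq0 eq_le r20 sqr_ge0.
  have Qt0 : 0 <= Q t by rewrite addr_ge0 ?kern_ge0.
  have Cc1 : 0 <= Cc + 1 by rewrite addr_ge0// ltW.
  by rewrite normr0; exact: mulr_ge0 (mulr_ge0 (ltW e0) Cc1) Qt0.
have mr : measurable_fun setT r.
  apply: measurable_funD; first by apply: measurable_funM; [exact: measurable_cst|exact: Ui].
  apply: measurable_funD; last exact: Ub.
  by apply: measurable_funM; [exact: measurable_cst|exact: Ui].
have [_ lr] := laplace_dominated mr iQ rb.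
have integr (h : R -> R) : measurable_fun setT h ->
    (exists k, forall t, `|h t| <= k * Q t) -> laplace_integrable p h.
  by move=> mh [k hk]; have [] := laplace_dominated mh iQ hk.
have [iq1 iq2 ib] : [/\ laplace_integrable p (fun t => inner (U t) phi),
    laplace_integrable p (fun t => inner (U t) psi) &
    laplace_integrable p (fun t => bform (U t) phi)].
  split; apply: integr; do ?[exact: Ui|exact: Ub].
  - by have [k _ Hk] := inner_dominated UH Un Lphi; exists k.
  - by have [k _ Hk] := inner_dominated UH Un Lpsi; exists k.
  - by have [k _ Hk] := bform_dominated UH Un H10phi; exists k.
have [i1 l1] := laplace_lin (-1) iq2 ib.
have [_ l2] := laplace_lin lam iq1 i1.
have sl := solution_laplace UH Un Uu Ui Ub mm p_gt0 H10phi iM iQ.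
have green : inner u0 phi = bform phi w0.
  by rewrite (elliptic_green oO bO ac w0u0 H10phi) (bform_sym ac).
pose rho := lam * inner phi w0 + bform phi w0 - inner psi w0.
have rhob : `|rho| <= e * (1 + E0).
  apply: sqrt_bound => //; apply: (le_trans (Hphi _ Hw0)); rewrite ler_pM2l// /energy /E0.
  have nw : norm2 w0 ^+ 2 = inner w0 w0 by exact: (norm2_sqr mO Lw0).
  by rewrite -nw lerD2r ler_piMl ?sqr_ge0.
(* Multiply [solution_laplace] by [lam], then substitute [inner u0 phi = bform phi w0] and [bform
   phi w0 = inner psi w0 - lam * inner phi w0 + rho]. *)
have main : laplace p (fun t => inner (U t) psi) - p `^ (alpha - 1) * (Gamma 1 * inner w0 psi) =
   - laplace p r + laplace p m0 * inner f phi +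
   p `^ (alpha - 1) * Gamma 1 * rho - p `^ (2 * alpha - 1) * Gamma 1 * inner phi w0.
  have pinv : lam * p `^ (- alpha) = 1.
    by rewrite /lam -powRD ?(gt_eqF p_gt0) ?implybT// subrr powRr0.
  have pm1 : lam * p `^ (- 1) = p `^ (alpha - 1).
    by rewrite /lam -powRD ?(gt_eqF p_gt0) ?implybT.
  rewrite /r l2 l1 sl green /rho (innerC Omega w0) -plam -pm1.
  move: pinv; move: (p `^ (- alpha)) (p `^ (- 1)) => x y pinv.
  rewrite mulrDr [lam * (x * _)]mulrA pinv mul1r /m0.
  by ring.
rewrite /X main; have a1 := inner_CauchySchwarz mO f_L2 Lphi.
have a2 := inner_CauchySchwarz mO Lphi Lw0.
have b1 : `|laplace p m0 * inner f phi| <= M1 * (norm2 f * C1).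
  rewrite normrM; apply: ler_pM => //; apply: (le_trans a1).
  by rewrite ler_wpM2l ?norm2_ge0.
have b2 : `|p `^ (alpha - 1) * Gamma 1 * rho| <= p `^ (alpha - 1) * Gamma 1 * (e * (1 + E0)).
  by rewrite normrM ger0_norm ?mulr_ge0 ?(ltW G1)// ler_wpM2l ?mulr_ge0 ?(ltW G1).
have b3 : `|p `^ (2 * alpha - 1) * Gamma 1 * inner phi w0| <=
    p `^ (2 * alpha - 1) * Gamma 1 * (C1 * norm2 w0).
  rewrite normrM ger0_norm ?mulr_ge0 ?(ltW G1)// ler_wpM2l ?mulr_ge0 ?(ltW G1)//.
  by apply: (le_trans a2); rewrite ler_wpM2r ?norm2_ge0.
have tri (x y z v : R) : `|- x + y + z - v| <= `|x| + `|y| + `|z| + `|v|.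
  apply: (le_trans (ler_normB _ _)); rewrite lerD2r.
  apply: (le_trans (ler_normD _ _)); rewrite lerD2r.
  by apply: (le_trans (ler_normD _ _)); rewrite normrN.
rewrite lerBlDr; apply: (le_trans (tri _ _ _ _)).
apply: (le_trans (lerD (lerD (lerD lr b1) b2) b3)).
have c1 : 0 <= Gamma 1 * (C1 * norm2 w0) by rewrite mulr_ge0 ?mulr_ge0 ?norm2_ge0 ?(ltW G1).
have c2 : 0 <= M1 * (norm2 f * C1) * p `^ (2 * alpha - 1).
  by rewrite !mulr_ge0 ?norm2_ge0.
rewrite /S -subr_ge0; move: c1 c2; move: (laplace p Q) (p `^ _) (p `^ _) (Gamma 1) => x y z v.
move: (M1 * _) (C1 * _) => s1 s2 c1 c2.
by rewrite (_ : _ - _ = v * s2 + s1 * z); [rewrite addr_ge0|ring].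
Qed.
End solution.

(** * Comparison of the expansions *)

Section comparison.
Context {R : realType}.
Implicit Types (A B C th x p : R).

Lemma powR_small_le0 th x C : 0 < th -> 0 <= C ->
  (forall p, 0 < p <= 1 -> x <= C * p `^ th) -> x <= 0.
Proof.
move=> th0 C0 H; apply: (ler_small C0) => e e0.
pose p := Num.min 1 (e `^ th^-1).
have p0 : 0 < p by rewrite lt_min ltr01 powR_gt0.
apply: (le_trans (H p _)); first by rewrite p0 ge_min lexx.
rewrite ler_wpM2l//; apply: (@le_trans _ _ ((e `^ th^-1) `^ th)).
  by apply: ge0_ler_powR; rewrite ?nnegrE ?powR_ge0 ?(ltW th0) ?(ltW p0)// ge_min lexx orbT.
by rewrite -powRrM mulVf ?gt_eqF// powRr1// ltW.
Qed.

(** Multiplication by [p^(1-al)] leaves [A - p^(be-al) B], bounded by positive powers of [p]. If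
    [al < be], the second term also tends to 0 and [A] would vanish; if [al = be], the difference
    [A - B] does. *)
Lemma powR_asymptotics_le (al be A B C : R) : 0 < al < 1 -> 0 < be < 1 -> al <= be -> 0 <= C ->
  (forall p, 0 < p <= 1 -> `|p `^ (al - 1) * A - p `^ (be - 1) * B| <=
     C * (p `^ (2 * al - 1) + 1 + (p `^ (2 * be - 1) + 1))) ->
  A != 0 -> al = be /\ A = B.
Proof.
move=> /andP[al0 al1] /andP[be0 be1] ab C0 H A0.
have H' p : 0 < p <= 1 -> `|A - p `^ (be - al) * B| <=
    C * (p `^ al + p `^ (1 - al) + (p `^ (2 * be - al) + p `^ (1 - al))).
  move=> p01; have /andP[p0 _] := p01.
  have pD (x y : R) : p `^ x * p `^ y = p `^ (x + y).
    by rewrite powRD// (gt_eqF p0) implybT.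
  have q0 : 0 <= p `^ (1 - al) by exact: powR_ge0.
  have := ler_wpM2l q0 (H p p01); rewrite -[X in X * `|_|]ger0_norm// -normrM.
  have -> : p `^ (1 - al) * (p `^ (al - 1) * A - p `^ (be - 1) * B) = A - p `^ (be - al) * B.
    rewrite mulrBr !mulrA !pD (_ : 1 - al + (al - 1) = 0); last by ring.
    by rewrite (_ : 1 - al + (be - 1) = be - al) ?powRr0 ?mul1r//; ring.
  rewrite mulrCA !mulrDr !mulr1 !pD (_ : 1 - al + (2 * al - 1) = al); last by ring.
  by rewrite (_ : 1 - al + (2 * be - 1) = 2 * be - al)//; ring.
have le1 p x y : 0 < p <= 1 -> x <= y -> p `^ y <= p `^ x.
  by move=> p01 xy; exact: ger_powR.
have [abE|abn] := eqVneq al be.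
  split=> //; apply/eqP; rewrite -subr_eq0 -normr_le0.
  apply: (@powR_small_le0 (Num.min al (1 - al)) _ (4 * C)); rewrite ?mulr_ge0//.
    by rewrite lt_min al0 subr_gt0.
  move=> p p01; have := H' p p01; rewrite -abE subrr powRr0 mul1r => /le_trans; apply.
  have four (q : R) : 4 * C * q = C * (q + q + (q + q)) by ring.
  rewrite four ler_wpM2l//; apply: lerD; apply: lerD; apply: le1; rewrite // ge_min ?lexx ?orbT//.
  by rewrite (_ : 2 * al - al = al) ?lexx//; ring.
have {abn}ab : al < be by rewrite lt_neqAle abn.
exfalso; move/negP: A0; apply; rewrite -normr_le0.
(* The smallest exponent that occurs; the remaining one, [2 be - al], is at least [be - al]. *)
pose th := Num.min (be - al) (Num.min al (1 - al)).
have [t1 t2 t3] : [/\ th <= be - al, th <= al & th <= 1 - al].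
  by rewrite /th; split; rewrite !ge_min lexx ?orbT.
apply: (@powR_small_le0 th _ (`|B| + 4 * C)).
- by rewrite !lt_min !subr_gt0 ab al0.
- by rewrite addr_ge0 ?mulr_ge0.
move=> p p01; have := H' p p01 => h.
have b1 : `|p `^ (be - al) * B| <= `|B| * p `^ th.
  by rewrite normrM ger0_norm ?powR_ge0// mulrC ler_wpM2l// le1.
have -> : A = (A - p `^ (be - al) * B) + p `^ (be - al) * B by rewrite subrK.
apply: (le_trans (ler_normD _ _)); rewrite mulrDl addrC; apply: lerD => //.
have four (q : R) : 4 * C * q = C * (q + q + (q + q)) by ring.
apply: (le_trans h); rewrite four ler_wpM2l//; apply: lerD; apply: lerD; apply: le1 => //.
by apply: (le_trans t1); rewrite lerB// ler_peMl ?ler1n// ltW.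
Qed.

Lemma powR_asymptotics (al be A B C : R) : 0 < al < 1 -> 0 < be < 1 -> 0 <= C ->
  (forall p, 0 < p <= 1 -> `|p `^ (al - 1) * A - p `^ (be - 1) * B| <=
     C * (p `^ (2 * al - 1) + 1 + (p `^ (2 * be - 1) + 1))) ->
  A != 0 -> B != 0 -> al = be /\ A = B.
Proof.
move=> al01 be01 C0 H A0 B0; have [ab|/ltW ba] := leP al be.
  exact: (powR_asymptotics_le al01 be01 ab C0 H).
suff [-> ->] : be = al /\ B = A by [].
apply: (powR_asymptotics_le be01 al01 ba C0 _ B0) => p p01.
by rewrite distrC [X in C * X]addrC; exact: H.
Qed.
End comparison.

(** Without a preimage [elliptic_inv] takes its default value 0, whose pairing with [psi] vanishes.
    The assumption that the pairing is nonzero thus provides the preimage. *)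
Lemma elliptic_inv_spec (R : realType) (N : nat) (Omega : set 'rV[R]_N)
    (a : 'I_N -> 'I_N -> 'rV[R]_N -> R) (c h psi : 'rV[R]_N -> R) :
  inner Omega (elliptic_inv Omega a c h) psi != 0 ->
  elliptic Omega a c (elliptic_inv Omega a c h) h.
Proof.
move=> H; have [[w Hw]|nw] := pselect (exists w, elliptic Omega a c w h); last first.
  move: H; rewrite /elliptic_inv xgetPN ?inner0l ?eqxx// => w Hw.
  by apply: nw; exists w.
exact: (xgetI (cst 0) (P := [set w | elliptic Omega a c w h]) Hw).
Qed.

Theorem theorem2p7 (R : realType) (N : nat) (N_gt0 : (0 < N)%N)
    (Omega : set 'rV[R]_N) (Omega_domain : smooth_bounded_domain Omega)
    (aA : 'I_N -> 'I_N -> 'rV[R]_N -> R) (cA : 'rV[R]_N -> R)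
    (A_elliptic : elliptic_coefficients Omega aA cA)
    (bB : 'I_N -> 'I_N -> 'rV[R]_N -> R) (dB : 'rV[R]_N -> R)
    (B_elliptic : elliptic_coefficients Omega bB dB)
    (alpha beta : R)
    (alpha01 : 0 < alpha < 1) (beta01 : 0 < beta < 1)
    (a b f g psi : 'rV[R]_N -> R)
    (a_H10 : H10 Omega a) (b_H10 : H10 Omega b)
    (f_L2 : L2 Omega f) (g_L2 : L2 Omega g) (psi_L2 : L2 Omega psi)
    (mu nu : R -> R)
    (mu_Loo : memL lebesgue_measure +oo%E `]0, +oo[ mu)
    (nu_Loo : memL lebesgue_measure +oo%E `]0, +oo[ nu)
    (decay : exists p0 : R, [/\ 0 < p0,
       memL lebesgue_measure 1%:E `]0, +oo[ (fun t => expR (p0 * t) * mu t) &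
       memL lebesgue_measure 1%:E `]0, +oo[ (fun t => expR (p0 * t) * nu t)])
    (Ainv_neq0 : inner Omega (elliptic_inv Omega aA cA a) psi != 0)
    (Binv_neq0 : inner Omega (elliptic_inv Omega bB dB b) psi != 0)
    (u v : R -> 'rV[R]_N -> R)
    (u_sol : is_solution Omega aA cA alpha a mu f u)
    (v_sol : is_solution Omega bB dB beta b nu g v)
    (observation : forall t : R, 0 < t ->
       inner Omega (u t) psi = inner Omega (v t) psi) :
  alpha = beta /\
  inner Omega (elliptic_inv Omega aA cA a) psi =
  inner Omega (elliptic_inv Omega bB dB b) psi.
Proof.
have [_ oO _ bO _] := Omega_domain; have [p0 [p00 mu1 nu1]] := decay.
have Aw := elliptic_inv_spec Ainv_neq0; have Bw := elliptic_inv_spec Binv_neq0.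
have [C C0 HC] := solution_asymptotics oO bO N_gt0 A_elliptic alpha01 a_H10 f_L2 u_sol
  psi_L2 Aw mu_Loo p00 mu1.
have [C' C'0 HC'] := solution_asymptotics oO bO N_gt0 B_elliptic beta01 b_H10 g_L2 v_sol
  psi_L2 Bw nu_Loo p00 nu1.
have G1 : 0 < Gamma (1 : R) by rewrite Gamma_gt0// ltr01 lexx.
have obs : (fun t => inner Omega (u t) psi) \_ `]0, +oo[ =
    (fun t => inner Omega (v t) psi) \_ `]0, +oo[.
  apply/funext => t; rewrite !patchE; case: ifPn => //.
  by rewrite inE/= in_itv/= andbT => /observation.
have [|||ab AB] := @powR_asymptotics R alpha beta (Gamma 1 * inner Omega (elliptic_inv Omega aA cA a) psi)
  (Gamma 1 * inner Omega (elliptic_inv Omega bB dB b) psi) (C + C') alpha01 beta01 (addr_ge0 C0 C'0).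
- move=> p p01; have h1 := HC p p01; have h2 := HC' p p01.
  rewrite -obs in h2.
  move: h1 h2; set L := laplace _ _; set X := _ * (_ * _); set Y := p `^ (beta - 1) * _ => h1 h2.
  (* The observation makes the transform [L] common to both expansions. *)
  rewrite (_ : X - Y = (L - Y) - (L - X)); last by ring.
  apply: (le_trans (ler_normB _ _)); apply: (le_trans (lerD h2 h1)).
  have q1 : 0 <= p `^ (2 * alpha - 1) + 1 by rewrite addr_ge0 ?powR_ge0.
  have q2 : 0 <= p `^ (2 * beta - 1) + 1 by rewrite addr_ge0 ?powR_ge0.
  move: q1 q2; move: (p `^ (2 * alpha - 1) + 1) (p `^ (2 * beta - 1) + 1) => x y x0 y0.
  rewrite -subr_ge0 (_ : _ - _ = C * y + C' * x); last by ring.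
  by rewrite addr_ge0 ?mulr_ge0.
- by rewrite mulf_neq0// gt_eqF.
- by rewrite mulf_neq0// gt_eqF.
by split=> //; exact: (mulfI (lt0r_neq0 G1) AB).
Qed.
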